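(* Suppose $F \in \mathbb{Q}[x,y]$ has degree $4$, is irreducible over $\mathbb{Q}$, and satisfies $F(\mathbb{Z}^2) \subseteq \mathbb{Z}_{\geq 0}$. Then, for all sufficiently large $N$, $$\#\big(F(\mathbb{Z}^2) \cap [1,N]\big) \ll \frac{N}{\sqrt{\log N}},$$ where the implied constant depends only on $F$.
   Context: $F(\mathbb{Z}^2) = \{F(x,y) : (x,y)\in\mathbb{Z}^2\}$. The notation $f \ll g$ means $|f| \le c\, g$ for some constant $c>0$. *)

(* Defs.v *)
From HB Require Import structures.
From mathcomp Require Import all_boot all_order all_algebra.
From mathcomp Require Import finmap.
From mathcomp Require Import all_classical all_reals all_analysis.
(* The notations of mpoly clash with those of MathComp-Analysis. *)
From mathcomp Require Import -(notations) mpoly.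

Set Implicit Arguments.
Unset Strict Implicit.
Unset Printing Implicit Defensive.

Import Order.TTheory GRing.Theory Num.Theory.

Local Open Scope classical_set_scope.
Local Open Scope ring_scope.

Notation Qxy := (mpoly 2 rat).

Definition eval_xy (F : Qxy) (x y : int) : rat :=
  meval (fun i : 'I_2 => [:: x%:~R; y%:~R]`_i) F.

(* [mpoly.msize] is one more than the total degree for a nonzero polynomial,
   and 0 for the zero polynomial. *)
Definition has_degree (F : Qxy) (d : nat) : Prop := mpoly.msize F = d.+1.

Definition irreducible_elt (A : idomainType) (p : A) : Prop :=
  [/\ p != 0, p \isn't a GRing.unit &
      forall q r : A, p = q * r -> q \is a GRing.unit \/ r \is a GRing.unit].

Definition int_values (F : Qxy) : set rat :=
  [set eval_xy F z.1 z.2 | z in [set: int * int]].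

Definition nonneg_integers : set rat := [set n%:R | n in [set: nat]].

Definition values_upto (R : realType) (F : Qxy) (N : R) : set rat :=
  int_values F `&` [set q | 1 <= (ratr q : R) <= N].

(* [fset_set] sends infinite sets to the empty one; the next lemma shows that
   this case does not occur for integer-valued polynomials. *)
Definition count_values (R : realType) (F : Qxy) (N : R) : nat :=
  #|` fset_set (values_upto F N)|%fset.

Lemma finite_values_upto (R : realType) (F : Qxy) (N : R) :
  int_values F `<=` nonneg_integers -> finite_set (values_upto F N).
Proof.
move=> FZ; apply: (@sub_finite_set _ _
  ((fun n : nat => n%:R : rat) @` `I_(Num.truncn N).+1)).
  move=> q [/FZ[n _ <-]] /= /andP[_]; rewrite ratr_nat => nN.
  by exists n => //=; rewrite ltnS truncn_ge_nat // (le_trans _ nN).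
exact/finite_image/finite_II.
Qed.

(* Main.v *)
Require Import Defs.
From HB Require Import structures.
From mathcomp Require Import all_boot all_order all_algebra.
From mathcomp Require Import all_classical all_reals all_analysis.
From mathcomp Require Import -(notations) mpoly.
From mathcomp Require Import zify ring lra.

Import Order.TTheory GRing.Theory Num.Theory.

Local Open Scope classical_set_scope.
Local Open Scope ring_scope.

(* The value set is thin, O(N^(3/4)), unless the leading form is a fourth power
   of a linear form, in which case the values are, up to an affine map, of the
   form X^2 + D Y^2 with D > 0.

   - The leading form is nonnegative on the real plane.  If it is definite, the
     points with F <= N lie in a disc of radius O(N^(1/4)).  If it has a rational
     zero, that zero is double, and an integral change of variables turns the
     leading form into c x^4 or x^2 (a y^2 + c x^2).  If all its real zeros are
     irrational, it becomes a (x^2 - D y^2)^2.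
   - For x^2 (a y^2 + c x^2) and a (x^2 - D y^2)^2 one counts integer points on
     vertical or horizontal lines; nonnegativity of F along the asymptotes (for
     the second form, along integer points very close to them) makes the lower
     order terms either coercive or degenerate, and a degenerate F takes only
     values that are quadratic in one integer.
   - For c x^4, nonnegativity makes F quadratic in y with constant leading
     coefficient; completing the square leaves Z^2 + R(x) with R of even degree
     bounded below, and only deg R = 2 yields more than O(N^(3/4)) values.
   - The bound O(N / sqrt (log N)) for the number of n = X^2 + D Y^2 up to N uses
     no characters.  Primes p with -D a non-residue divide such n to even order.
     Counting the pairs of points of a box that are congruent modulo the index p
     lattices X = z Y (mod p), z^2 = -D, and comparing with the product of the
     norms of their differences gives sum ln p / p <= (ln x) / 2 + O(1) over the
     other primes.  Partial summation bounds sum 1/n over the admissible n by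
     O(sqrt (ln x)), and ln n = sum of ln p over p^j | n with Chebyshev's bound
     turns this into a bound for their number. *)

(** * Chebyshev's bound *)

(** Two obstacles shape the proof. When the leading form has a real zero, infinitely many points may
    satisfy [F <= N], so counting points is not enough: near an asymptote either [F] still grows, or
    the points must be shown to yield few distinct values. Moreover nonnegativity is known at
    integer points only, so signs along an irrational asymptote have to come from Diophantine
    approximation.

    The substitutions that normalise the leading form have integer matrices whose determinant [d]
    need not be a unit. Statements therefore concern integer polynomials on a nonempty set [L]
    stable under translation by multiples of [k]; a substitution replaces [L] by its image and
    multiplies the values by [d^4], and the bound sought is insensitive to affine maps of the
    values.

    With [T = N^(1/4)], the point counts all read [O(T^i)] lines times [O(T^j)] points with
    [i + j = 3].

    For norms, the saving [sqrt (ln N)] comes from the two square roots of [-D] modulo a split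
    prime: each such prime has weight [2 ln p / p] against norms of logarithm about [2 ln x] in a
    box of side [x], and [n] is about [x^2]. *)

Section ChebyshevBound.
Variable R : realType.
Implicit Types (p n m k K : nat).

Lemma ln_nat_ge0 n : 0 <= ln n%:R :> R.
Proof.
case: n => [|n]; first by rewrite ln0.
by apply: ln_ge0; rewrite ler1n.
Qed.

Lemma ln_nat_prod (I : Type) (r : seq I) (P : pred I) (F : I -> nat) :
  (forall i, P i -> (0 < F i)%N) ->
  ln (\prod_(i <- r | P i) F i)%N%:R = \sum_(i <- r | P i) ln (F i)%:R :> R.
Proof.
move=> F0.
suff: (0 < \prod_(i <- r | P i) F i)%N /\
  ln (\prod_(i <- r | P i) F i)%N%:R = \sum_(i <- r | P i) ln (F i)%:R :> R by case.
apply: (big_ind2 (fun (a : nat) (b : R) => (0 < a)%N /\ ln a%:R = b)).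
- by rewrite ln1.
- move=> a b c d [a0 <-] [c0 <-]; rewrite muln_gt0 a0 c0; split => //.
  by rewrite natrM lnM // posrE ltr0n.
- by move=> i Pi; split => //; exact: F0.
Qed.

Lemma ln_natX n k : ln (n ^ k)%N%:R = k%:R * ln n%:R :> R.
Proof.
case: n => [|n].
  by case: k => [|k]; rewrite ?expn0 ?ln1 ?mul0r// exp0n// ln0// mulr0.
by rewrite natrX lnXn ?ltr0n// mulr_natl.
Qed.

Lemma ln_nat_logn n K : (0 < n)%N ->
  (forall p, prime p -> p %| n -> p < K)%N ->
  ln n%:R = \sum_(0 <= p < K | prime p) (logn p n)%:R * ln p%:R :> R.
Proof.
move=> n0 nK.
have nE : n = (\prod_(0 <= p < K | prime p) p ^ logn p n)%N.
  rewrite -[LHS](partnT n0) (widen_partn _ (leq_maxl n K)).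
  rewrite (@big_cat_nat _ _ _ K)/= ?leq0n//; last by rewrite (leq_trans (leq_maxr n K)).
  rewrite [X in (_ * X)%N]big1_seq ?muln1; last first.
    move=> p /andP[_]; rewrite mem_index_iota => /andP[Kp _].
    suff -> : logn p n = 0%N by rewrite expn0.
    apply/eqP; rewrite eqn0Ngt logn_gt0 mem_primes; apply/negP.
    by case/and3P=> pp _ pn; have := nK p pp pn; rewrite ltnNge Kp.
  rewrite [RHS]big_mkcond/=; apply: eq_bigr => p _.
  by case: ifP => // pp; rewrite lognE pp/= expn0.
rewrite {1}nE ln_nat_prod; last by move=> p _; rewrite pfactor_gt0.
by apply: eq_bigr => p _; rewrite ln_natX.
Qed.

(* Chebyshev's function at [n], for any cutoff [K > n]. *)
Definition psi K n : R :=
  \sum_(0 <= p < K | prime p) \sum_(1 <= k < K) (p ^ k <= n)%:R * ln p%:R.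

(** Legendre's formula. One cutoff [K] serves both for primes and for exponents, as [p ^ k > n] once
    [p > n] or [k > n]. *)
Lemma ln_fact n K : (n < K)%N ->
  ln n`!%:R = \sum_(0 <= p < K | prime p)
    \sum_(1 <= k < K) (n %/ p ^ k)%:R * ln p%:R :> R.
Proof.
move=> nK.
have big_pow p k : prime p -> (n < k)%N -> (n %/ p ^ k = 0)%N.
  move=> pp nk; rewrite divn_small// (leq_trans nk)// ltnW// ltn_expl//.
  exact: prime_gt1.
rewrite (@ln_nat_logn _ K) ?fact_gt0//; last first.
  move=> p pp; rewrite -[p in (p %| _)%N]expn1 pfactor_dvdn ?fact_gt0// logn_fact//.
  apply: contraTT; rewrite -leqNgt => Kp.
  rewrite big1_seq// => k /andP[_]; rewrite mem_index_iota => /andP[k1 _].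
  rewrite divn_small// (leq_trans nK)// (leq_trans Kp)//.
  by rewrite -{1}(expn1 p) leq_exp2l ?prime_gt1.
rewrite big_seq_cond [RHS]big_seq_cond; apply: eq_bigr => p /andP[_ pp].
rewrite logn_fact// -mulr_suml -natr_sum; congr (_%:R * _).
rewrite [RHS](@big_cat_nat _ _ _ n.+1)//=.
rewrite [X in (_ + X)%N]big1_seq ?addn0//.
move=> k /andP[_]; rewrite mem_index_iota => /andP[nk _].
exact: big_pow.
Qed.

(** The central binomial coefficient is at most [2 ^ n], and by Legendre's formula every prime power
    [p ^ k] in the interval from [uphalf n] (excluded) to [n] contributes a full [ln p] to its
    logarithm. *)
Lemma psi_halve n K : (n < K)%N -> psi K n <= psi K (uphalf n) + n%:R.
Proof.
move=> nK.
have hn : (half n <= n)%N by lia.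
have un : (n - half n = uphalf n)%N by lia.
have uK : (uphalf n < K)%N by rewrite -un (leq_ltn_trans _ nK)// leq_subr.
have hK : (half n < K)%N by rewrite (leq_ltn_trans hn).
have lnbin : ln 'C(n, half n)%:R <= n%:R :> R.
  have : ln 'C(n, half n)%:R <= ln (2 ^ n)%N%:R :> R.
    rewrite ler_ln ?posrE ?ltr0n ?bin_gt0 ?expn_gt0// ler_nat.
    rewrite -[2%N]/(1 + 1)%N expnDn.
    rewrite (bigD1 (inord (half n)))//= inordK ?ltnS// !exp1n !muln1.
    exact: leq_addr.
  move=> /le_trans; apply; rewrite ln_natX ler_piMr//.
  have := @le_ln1Dx R 1; rewrite -[1 + 1]/(2%:R); apply; lra.
apply: le_trans (_ : psi K (uphalf n) + ln 'C(n, half n)%:R <= _); last first.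
  by rewrite lerD2l.
have -> : ln 'C(n, half n)%:R = ln n`!%:R - ln (half n)`!%:R - ln (uphalf n)`!%:R :> R.
  rewrite -(bin_fact hn) un !natrM !lnM ?posrE ?mulr_gt0 ?ltr0n ?fact_gt0 ?bin_gt0//.
  lra.
rewrite (ln_fact _ _ nK) (ln_fact _ _ hK) (ln_fact _ _ uK) /psi.
rewrite -!sumrB -big_split/=; apply: ler_sum => p pp.
rewrite -!sumrB -big_split/=; apply: ler_sum => k _.
rewrite -!mulrBl -mulrDl; apply: ler_wpM2r; first exact: ln_nat_ge0.
set q := (p ^ k)%N.
have q0 : (0 < q)%N by rewrite expn_gt0 prime_gt0.
suff: ((q <= n) + half n %/ q + uphalf n %/ q <= (q <= uphalf n) + n %/ q)%N.
  by rewrite -(ler_nat R) !natrD; lra.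
have nE : n = (half n + uphalf n)%N by rewrite -un subnKC.
have sup : (half n %/ q + uphalf n %/ q <= n %/ q)%N.
  rewrite leq_divRL// mulnDl {3}nE leq_add//; exact: leq_trunc_div.
have [qu|uq] := leqP q (uphalf n).
  by move: sup; case: (q <= n)%N; lia.
have uq' : (half n < q)%N by lia.
rewrite (divn_small uq) (divn_small uq').
case: (leqP q n) => [qn|_]; last by rewrite /= !add0n.
have : (0 < n %/ q)%N by rewrite divn_gt0.
by lia.
Qed.

Lemma psi_le n K : (n < K)%N -> psi K n <= 4 * n%:R.
Proof.
elim/ltn_ind: n => n IH nK.
have [n1|n1] := leqP n 1.
  rewrite /psi big1 ?mulr_ge0// => p pp; rewrite big1_seq// => k /andP[_].
  rewrite mem_index_iota => /andP[k1 _].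
  rewrite leqNgt (leq_ltn_trans n1) ?mul0r//.
  by rewrite (leq_trans (prime_gt1 pp))// -{1}(expn1 p) leq_exp2l ?prime_gt1.
apply: le_trans (psi_halve _ _ nK) _.
have un : (uphalf n < n)%N by lia.
apply: le_trans (_ : 4 * (uphalf n)%:R + n%:R <= _).
  by rewrite lerD2r IH// (ltn_trans un).
(* [4 * uphalf n + n <= 2 * (n + 1) + n <= 4 * n], the last because [n >= 2]. *)
have : ((uphalf n).*2 <= n.+1)%N by lia.
rewrite -(ler_nat R) -addnn natrD -(natr1 n).
have : (2 <= n%:R :> R) by rewrite (ler_nat _ 2).
lra.
Qed.

End ChebyshevBound.

(** * Primes represented by a binary form *)

(** For prime [p]: [-D] is not a square modulo [p]. A prime dividing [D] is never inert, [z = 0]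
    being a root. *)
Definition inert (D p : nat) : bool :=
  [forall z : 'I_p, ~~ (p %| z ^ 2 + D)%N].

Section SplitPrimes.
Variable R : realType.
Implicit Types (p n m k K x z : nat).

(** Cauchy-Schwarz for the fibre sizes [n c]: the double sum counts colliding pairs, that is, the
    sum of the [n c ^ 2]. *)
Lemma collision_count (T : finType) p (f : T -> 'I_p) :
  (#|T| ^ 2 <= p * \sum_(s : T) \sum_(t : T) (f s == f t))%N.
Proof.
pose n c := (\sum_(s | f s == c) 1)%N.
have sumT (F : 'I_p -> nat) : (\sum_(s : T) F (f s) = \sum_c n c * F c)%N.
  rewrite (partition_big f xpredT)//=; apply: eq_bigr => c _.
  rewrite /n big_distrl/=; apply: eq_bigr => s /eqP ->.
  by rewrite mul1n.
have nE c : (\sum_(t : T) (c == f t) = n c)%N.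
  rewrite /n [RHS]big_mkcond; apply: eq_bigr => t _.
  by rewrite eq_sym; case: eqP.
rewrite (eq_bigr (fun s => n (f s))); last by move=> s _; exact: nE.
rewrite sumT.
have -> : #|T| = (\sum_c n c)%N.
  by have := sumT (fun=> 1%N); rewrite sum1_card => ->; apply: eq_bigr => c _; rewrite muln1.
rewrite -(leq_pmul2l (ltn0Sn 1)) -mulnn big_distrlr/= !big_distrr/=.
apply: leq_trans (_ : \sum_(i < p) \sum_(j < p) (n i ^ 2 + n j ^ 2) <= _)%N.
  apply: leq_sum => i _; rewrite big_distrr/=; apply: leq_sum => j _.
  exact: nat_Cauchy.
rewrite (eq_bigr (fun i => p * n i ^ 2 + \sum_j n j ^ 2)%N); last first.
  by move=> i _; rewrite big_split/= sum_nat_const card_ord.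
rewrite big_split/= -big_distrr/= sum_nat_const card_ord -mulnDr addnn -mul2n.
rewrite mulnCA !big_distrr/=; exact: leq_sum.
Qed.

Lemma sum_ln_le_ln n K (Q : pred nat) (e : nat -> nat) : (0 < n)%N ->
  (forall p, (p < K)%N -> prime p -> Q p -> p ^ e p %| n)%N ->
  \sum_(0 <= p < K | prime p && Q p) (e p)%:R * ln p%:R <= ln n%:R :> R.
Proof.
move=> n0 en.
rewrite (@ln_nat_logn _ n (maxn K n.+1))//; last first.
  by move=> p _ pn; rewrite leq_max ltnS (dvdn_leq n0 pn) orbT.
rewrite [leRHS](@big_cat_nat _ _ _ K)/= ?leq0n ?leq_maxl//.
apply: ler_wpDr.
  by apply: sumr_ge0 => p _; rewrite mulr_ge0// ln_nat_ge0.
rewrite big_mkcondr/= big_seq_cond [leRHS]big_seq_cond.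
apply: ler_sum => p /andP[]; rewrite mem_index_iota => /= pK pp.
case: ifP => Qp; last by rewrite mulr_ge0// ln_nat_ge0.
by rewrite ler_wpM2r ?ln_nat_ge0// ler_nat -pfactor_dvdn// en.
Qed.

(** For [D > 0] the condition [2 D < p] makes [p] odd and prime to [D], so that the roots [z] and
    [-z] of [-D] are distinct modulo [p]. The finitely many smaller primes go into constants. *)
Definition split_prime D p := [&& prime p, (D.*2 < p)%N & ~~ inert D p].

Lemma split_prime_root D p : split_prime D p ->
  {z : 'I_p | (p %| z ^ 2 + D)%N}.
Proof.
case/and3P=> _ _; rewrite negb_forall => /existsP/sigW[z].
by rewrite negbK => pz; exists z.
Qed.

Section Lattice.
Variables (D x : nat).
Hypotheses (D0 : (0 < D)%N) (x0 : (0 < x)%N).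

Let B : finType := ('I_x * 'I_x)%type.
Let nrm (s t : B) : nat :=
  absz ((s.1%:Z - t.1%:Z) ^+ 2 + D%:Z * (s.2%:Z - t.2%:Z) ^+ 2).
Let res p0 (z : int) (s : B) : 'I_p0.+1 :=
  inord (absz (modz (s.1%:Z - z * s.2%:Z) p0.+1%:Z)).

Let resP p0 (w : int) s t : res p0 w s = res p0 w t ->
  (p0.+1%:Z %| ((s.1%:Z - t.1%:Z) - w * (s.2%:Z - t.2%:Z))%R)%Z.
Proof.
move=> /(congr1 (@nat_of_ord _)); rewrite /res !inordK; last 2 first.
- by rewrite -ltz_nat gez0_abs ?modz_ge0// ltz_pmod.
- by rewrite -ltz_nat gez0_abs ?modz_ge0// ltz_pmod.
move=> /(congr1 Posz); rewrite !gez0_abs ?modz_ge0// => /eqP.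
by rewrite eqz_mod_dvd; congr (_ %| _)%Z; ring.
Qed.

Let nrm_gt0 s t : s != t -> (0 < nrm s t)%N.
Proof.
move=> st; rewrite absz_gt0; apply: contra st => /eqP st.
have h1 : 0 <= (s.1%:Z - t.1%:Z) ^+ 2 by rewrite sqr_ge0.
have h2 : 0 <= (s.2%:Z - t.2%:Z) ^+ 2 by rewrite sqr_ge0.
have hD : (1 <= D%:Z) by rewrite lez_nat.
have e2 : (s.2%:Z - t.2%:Z) ^+ 2 = 0 by nia.
have e1 : (s.1%:Z - t.1%:Z) ^+ 2 = 0 by rewrite e2 mulr0 addr0 in st.
move/eqP: e1; move/eqP: e2; rewrite !sqrf_eq0 !subr_eq0 !eqz_nat => e2 e1.
case: s t e1 e2 {st h1 h2} => [a b] [c d] /= /eqP/ord_inj -> /eqP/ord_inj ->.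
exact: eqxx.
Qed.

Let nrm_le s t : (nrm s t <= D.+1 * x ^ 2)%N.
Proof.
rewrite -lez_nat gez0_abs; last by apply: addr_ge0; [exact: sqr_ge0|apply: mulr_ge0 => //; exact: sqr_ge0].
have b (i j : 'I_x) : (i%:Z - j%:Z) ^+ 2 <= x%:Z ^+ 2.
  have := ltn_ord i; have := ltn_ord j; rewrite -!ltz_nat => jx ix.
  have := le0z_nat i; have := le0z_nat j => j0' i0'.
  by nia.
have -> : (D.+1 * x ^ 2)%N%:Z = x%:Z ^+ 2 + D%:Z * x%:Z ^+ 2.
  by rewrite mulSn PoszD PoszM -[((x ^ 2)%N : int)]natz natrX natz.
by rewrite lerD// ler_wpM2l.
Qed.

Let root_of p : int := if [pick z : 'I_p | (p %| z ^ 2 + D)%N] is Some z then z%:Z else 0.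

Let root_ofP p : split_prime D p -> (p%:Z %| root_of p ^+ 2 + D%:Z)%Z.
Proof.
case/split_prime_root => z pz; rewrite /root_of; case: pickP => [{pz}z pz|/(_ z)].
  by rewrite dvdzE; move: pz; congr (_ %| _)%N; lia.
by rewrite pz.
Qed.

Let e p s t : nat := ((res p.-1 (root_of p) s == res p.-1 (root_of p) t) +
  (res p.-1 (- root_of p) s == res p.-1 (- root_of p) t))%N.

(** Modulo [p] the norm is [(a - z b) (a + z b)], so one agreement gives a factor [p]. Two
    agreements give [p | 2 z b]; as [p] is prime to [2 D], it divides [b], then [a], and [p ^ 2]
    divides the norm. *)
Let e_dvd p s t : split_prime D p -> (p ^ e p s t %| nrm s t)%N.
Proof.
move=> sp; have pz := root_ofP _ sp; move: (sp) => /and3P[pp Dp _].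
have p1 : p.-1.+1 = p by rewrite prednK ?prime_gt0.
rewrite /e /nrm; set z := root_of p in pz *.
set a := s.1%:Z - t.1%:Z; set b := s.2%:Z - t.2%:Z.
have one w : (p%:Z %| w ^+ 2 + D%:Z)%Z -> (p%:Z %| a - w * b)%Z ->
    (p %| absz (a ^+ 2 + D%:Z * b ^+ 2)%R)%N.
  move=> pw pab; suff : (p%:Z %| a ^+ 2 + D%:Z * b ^+ 2)%Z by rewrite dvdzE.
  have -> : a ^+ 2 + D%:Z * b ^+ 2 =
    (a - w * b) * (a + w * b) + (w ^+ 2 + D%:Z) * b ^+ 2 by ring.
  by rewrite rpredD// dvdz_mulr.
have pz' : (p%:Z %| (- z) ^+ 2 + D%:Z)%Z by rewrite sqrrN.
case: eqP => [/resP h1|_]; case: eqP => [/resP h2|_].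
- rewrite p1 in h1 h2.
  have p2 : coprimez p%:Z 2.
    rewrite coprimezE/= prime_coprime//; apply/negP => /(@dvdn_leq _ 2 isT) p2.
    have : (2 < p)%N by rewrite (leq_ltn_trans _ Dp)// -addnn (leq_add D0 D0).
    by rewrite ltnNge p2.
  have pb : (p%:Z %| b)%Z.
    have : (p%:Z %| 2 * (z * b))%Z.
      have -> : 2 * (z * b) = (a - - z * b) - (a - z * b) by ring.
      by rewrite rpredB.
    rewrite Gauss_dvdzr// Gauss_dvdzr//.
    rewrite coprimezE/= prime_coprime//; apply/negP => pz1.
    have : (p%:Z %| D%:Z)%Z.
      have -> : D%:Z = (z ^+ 2 + D%:Z) - z * z by ring.
      by rewrite rpredB// dvdz_mulr// dvdzE.
    rewrite dvdzE/= => /(dvdn_leq D0) pD.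
    by move: Dp; rewrite ltnNge -addnn (leq_trans pD)// leq_addr.
  have pa : (p%:Z %| a)%Z.
    have -> : a = (a - z * b) + z * b by ring.
    by rewrite rpredD// dvdz_mull.
  suff : ((p ^ 2)%N%:Z %| a ^+ 2 + D%:Z * b ^+ 2)%Z by rewrite dvdzE.
  have -> : (p ^ 2)%N%:Z = p%:Z ^+ 2 by lia.
  by apply: rpredD; [|apply: dvdz_mull]; exact: dvdz_exp2r.
- by rewrite addn0 expn1; apply: (one z) => //; rewrite -p1.
- by rewrite add0n expn1; apply: (one (- z)) => //; rewrite -p1.
- by rewrite addn0 dvd1n.
Qed.

(* The residues [X - z Y] and [X + z Y] modulo [p], where [p] divides [z^2 + D],
   each agree on at least [x^4 / p] of the pairs of points of the box, by
   Cauchy-Schwarz; every agreement contributes a factor [p] to the norm of the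
   difference of the two points. *)
Lemma lattice_sum K :
  \sum_(0 <= p < K | split_prime D p)
    2 * ln p%:R * (x%:R ^+ 4 / p%:R - x%:R ^+ 2) <=
  x%:R ^+ 4 * ln (D.+1 * x ^ 2)%:R :> R.
Proof.
apply: le_trans (_ : \sum_(s : B) \sum_(t : B | s != t)
    \sum_(0 <= p < K | split_prime D p) (e p s t)%:R * ln p%:R <= _).
  under [leRHS]eq_bigr do rewrite exchange_big/=.
  rewrite [leRHS]exchange_big/= ler_sum// => p sp.
  rewrite [leRHS](_ : _ = (\sum_(s : B) \sum_(t : B | s != t) e p s t)%:R * ln p%:R);
    last first.
    rewrite natr_sum mulr_suml; apply: eq_bigr => s _.
    by rewrite natr_sum mulr_suml.
  rewrite mulrC mulrA ler_wpM2r ?ln_nat_ge0//.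
  have pp : prime p by case/and3P: sp.
  have p1 : p.-1.+1 = p by rewrite prednK ?prime_gt0.
  have cardB : #|B| = (x * x)%N by rewrite card_prod card_ord.
  have c1 (w : int) : x%:R ^+ 4 / p%:R - x%:R ^+ 2 <=
      (\sum_(s : B) \sum_(t : B | s != t) (res p.-1 w s == res p.-1 w t))%:R :> R.
    have := @collision_count B p.-1.+1 (res p.-1 w); rewrite [X in (_ <= X * _)%N]p1 => cc.
    (* The [x ^ 2] diagonal pairs collide trivially and have norm 0; removing them costs the term
       [- x ^ 2]. *)
    have -> : (\sum_(s : B) \sum_(t : B | s != t) (res p.-1 w s == res p.-1 w t))%N%:R
       = (\sum_(s : B) \sum_(t : B) (res p.-1 w s == res p.-1 w t))%N%:R
         - x%:R ^+ 2 :> R.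
      apply/eqP; rewrite eq_sym subr_eq eq_sym -natrX -natrD eqr_nat; apply/eqP.
      have -> : (x ^ 2 = \sum_(s : B) 1)%N by rewrite sum1_card cardB.
      rewrite -big_split; apply: eq_bigr => s _/=.
      rewrite [RHS](bigD1 s)//= eqxx addnC; congr (_ + _)%N.
      by apply: eq_bigl => t; rewrite eq_sym.
    rewrite lerB// ler_pdivrMr ?ltr0n ?prime_gt0// mulrC -natrM -natrX ler_nat.
    by apply: leq_trans cc; rewrite cardB mulnn -expnM.
  rewrite [leRHS](_ : _ =
    (\sum_(s : B) \sum_(t : B | s != t) (res p.-1 (root_of p) s == res p.-1 (root_of p) t))%:R +
    (\sum_(s : B) \sum_(t : B | s != t) (res p.-1 (- root_of p) s == res p.-1 (- root_of p) t))%:R);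
    last first.
    rewrite -natrD -big_split/=; congr (_%:R); apply: eq_bigr => s _.
    by rewrite -big_split.
  rewrite mulrC mulr_natl mulr2n; exact: lerD.
have -> : x%:R ^+ 4 * ln (D.+1 * x ^ 2)%:R =
    \sum_(s : B) \sum_(t : B) ln (D.+1 * x ^ 2)%:R :> R.
  rewrite sumr_const sumr_const card_prod card_ord -mulrnA -[RHS]mulr_natl.
  by rewrite -natrX; congr (_%:R * _); rewrite !expnS; lia.
apply: ler_sum => s _; rewrite big_mkcond; apply: ler_sum => t _.
case: ifP => st; last by rewrite ln_nat_ge0.
apply: le_trans (_ : ln (nrm s t)%:R <= _); last first.
  by rewrite ler_ln ?posrE ?ltr0n ?muln_gt0 ?expn_gt0 ?x0 ?nrm_gt0// ler_nat nrm_le.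
have n0 := nrm_gt0 _ _ st.
have := @sum_ln_le_ln _ K (split_prime D) (fun p => e p s t) n0.
rewrite (eq_bigl (split_prime D)); last first.
  by move=> p /=; rewrite /split_prime; case: (prime p).
by apply => p _ _; exact: e_dvd.
Qed.

End Lattice.

(** Choose [n <= x ^ 2 <= 4 n] and divide [lattice_sum] by [2 x ^ 4]. The main term becomes
    [ln ((D + 1) x ^ 2) / 2], and the diagonal correction is the sum of the [ln p] over [x ^ 2], at
    most [4 n / x ^ 2 <= 4] by Chebyshev. *)
Lemma sum_split_primes D : (0 < D)%N -> exists C : R, forall n, (0 < n)%N ->
  \sum_(0 <= p < n.+1 | split_prime D p) ln p%:R / p%:R <= ln n%:R / 2 + C.
Proof.
move=> D0; exists ((ln (D.+1 * 4)%N%:R + 8) / 2) => n n0.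
have [x nx xn] : exists2 x, (n <= x ^ 2)%N & (x ^ 2 <= 4 * n)%N.
  have : exists x, (n <= x ^ 2)%N by exists n; rewrite leq_pmulr.
  move=> ex; case: (ex_minnP ex) => x nx xmin; exists x => //.
  case: x nx xmin => [|[|x]] nx xmin; [by lia|by lia|].
  rewrite leqNgt; apply/negP => h.
  suff /xmin : (n <= x.+1 ^ 2)%N by lia.
  by lia.
have x0 : (0 < x)%N by case: x nx {xn} => //; lia.
have h := lattice_sum _ _ D0 x0 n.+1.
have xR : 0 < x%:R :> R by rewrite ltr0n.
have th : \sum_(0 <= p < n.+1 | split_prime D p) ln p%:R <= 4 * n%:R :> R.
  apply: le_trans (@psi_le R n n.+1 (leqnn _)); rewrite /psi.
  rewrite big_mkcond [leRHS]big_mkcond/= big_seq_cond [leRHS]big_seq_cond.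
  apply: ler_sum => p; rewrite mem_index_iota/= andbT => pn.
  have psum0 : 0 <= \sum_(1 <= k < n.+1) (p ^ k <= n)%:R * ln p%:R :> R.
    by apply: sumr_ge0 => k _; rewrite mulr_ge0// ln_nat_ge0.
  case: ifP => [/and3P[pp _ _]|_]; last by case: ifP.
  rewrite pp big_ltn ?ltnS// expn1 -ltnS pn mul1r lerDl.
  by apply: sumr_ge0 => k _; rewrite mulr_ge0// ln_nat_ge0.
have lnx : ln (D.+1 * x ^ 2)%:R <= ln (D.+1 * 4)%N%:R + ln n%:R :> R.
  rewrite -lnM ?posrE ?ltr0n ?muln_gt0// -natrM ler_ln ?posrE ?ltr0n//; last 2 first.
  - by rewrite muln_gt0 expn_gt0 x0.
  - by rewrite !muln_gt0 n0.
  by rewrite ler_nat -mulnA leq_mul2l xn orbT.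
have -> : \sum_(0 <= p < n.+1 | split_prime D p) ln p%:R / p%:R =
  ((\sum_(0 <= p < n.+1 | split_prime D p) 2 * ln p%:R * (x%:R ^+ 4 / p%:R - x%:R ^+ 2))
    + 2 * x%:R ^+ 2 * (\sum_(0 <= p < n.+1 | split_prime D p) ln p%:R)) / (2 * x%:R ^+ 4) :> R.
  rewrite [2 * _ * _]mulr_sumr -big_split/= mulr_suml; apply: eq_bigr => p sp.
  have p0 : p%:R != 0 :> R by rewrite pnatr_eq0; case: p sp.
  by field; rewrite p0 gt_eqF.
rewrite ler_pdivrMr ?mulr_gt0 ?exprn_gt0//.
have nx2 : n%:R <= x%:R ^+ 2 :> R by rewrite -natrX ler_nat.
have x2 : 0 < x%:R ^+ 2 :> R by rewrite exprn_gt0.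
apply: le_trans (_ : x%:R ^+ 4 * (ln (D.+1 * 4)%N%:R + ln n%:R) + 2 * x%:R ^+ 2 * (4 * x%:R ^+ 2) <= _).
  apply: lerD; first by apply: le_trans h _; rewrite ler_wpM2l// exprn_ge0.
  rewrite ler_wpM2l ?mulr_ge0// ?(ltW x2)// (le_trans th)// ler_wpM2l//.
rewrite le_eqVlt; apply/orP; left; apply/eqP; by field.
Qed.
End SplitPrimes.

(** * Partial summation over the split primes *)

Section ReciprocalSums.
Variable R : realType.
Implicit Types (p q n m k K x : nat).

(** [ln t <= t - 1] at [t = ln n / ln (n + 1)]; it replaces the integral of [1 / (t ln t)] in
    partial summation. *)
Lemma ln_ln_increment n : (2 <= n)%N ->
  1 - ln n%:R / ln n.+1%:R <= ln (ln n.+1%:R) - ln (ln n%:R) :> R.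
Proof.
move=> n2.
have L0 : 0 < ln n%:R :> R by apply: ln_gt0; rewrite ltr1n.
have L1 : 0 < ln n.+1%:R :> R by apply: ln_gt0; rewrite ltr1n ltnW.
have r0 : 0 < ln n%:R / ln n.+1%:R :> R by rewrite divr_gt0.
rewrite -opprB -[leRHS]opprB lerN2 -ln_div ?posrE//.
have := @le_ln1Dx R (ln n%:R / ln n.+1%:R - 1).
by rewrite addrCA subrr addr0; apply; lra.
Qed.

Lemma sum_div_ln (b : nat -> R) (C : R) :
  (forall n, (2 <= n)%N -> \sum_(2 <= k < n.+1) b k <= ln n%:R / 2 + C) ->
  exists C' : R, forall n, (2 <= n)%N ->
    \sum_(2 <= k < n.+1) b k / ln k%:R <= ln (ln n%:R) / 2 + C'.
Proof.
move=> bC.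
pose S n := \sum_(2 <= k < n.+1) b k.
pose L n : R := ln n%:R.
have L_gt0 n : (2 <= n)%N -> 0 < L n by move=> n2; apply: ln_gt0; rewrite ltr1n.
(* Abel summation as an invariant: passing from [n] to [n + 1] produces
   [S n * (1 / L n - 1 / L (n + 1))], where [S n] is replaced by its bound [L n / 2 + C]. The half
   yields a [ln ln] increment, and the [C] part telescopes. *)
have main n : (2 <= n)%N -> \sum_(2 <= k < n.+1) b k / L k <=
    S n / L n + (ln (L n) - ln (L 2%N)) / 2 + C * ((L 2%N)^-1 - (L n)^-1).
  elim: n => // n IH; rewrite ltnS leq_eqVlt => /orP[/eqP <-|n2].
    by rewrite /S !big_nat1 !subrr mul0r mulr0 !addr0.
  have {}IH := IH n2.
  rewrite /S !(@big_nat_recr _ _ _ n.+1)/= ?ltnS ?(ltnW n2)// -/(S n).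
  have Ln := L_gt0 _ n2.
  have Ln1 := L_gt0 _ (leqW n2).
  have dec : 0 <= (L n)^-1 - (L n.+1)^-1.
    by rewrite subr_ge0 lef_pV2// ler_ln ?posrE ?ltr0n ?ler_nat// ltnW.
  have h1 := ler_wpM2r dec (bC n n2).
  have h2 := ln_ln_increment _ n2; rewrite -/(L n) -/(L n.+1) in h2.
  have e1 : (L n / 2 + C) * ((L n)^-1 - (L n.+1)^-1) =
      (1 - L n / L n.+1) / 2 + C * ((L n)^-1 - (L n.+1)^-1).
    by field; rewrite !gt_eqF.
  rewrite -/(S n) -/(L n) e1 in h1.
  move: IH h1 h2; move: (L n)^-1 (L n.+1)^-1 (L n / L n.+1) => u v w.
  rewrite !mulrBr !mulrDl; lra.
exists (C / L 2%N - ln (L 2%N) / 2 + 2^-1) => n n2.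
apply: le_trans (main n n2) _.
have h : S n / L n <= 2^-1 + C / L n.
  have := ler_wpM2r (ltW (_ : 0 < (L n)^-1)) (bC n n2).
  rewrite -/(S n) -/(L n) invr_gt0 L_gt0// => /(_ isT) /le_trans; apply.
  rewrite mulrDl lerD2r le_eqVlt; apply/orP; left; apply/eqP.
  by field; rewrite gt_eqF// L_gt0.
rewrite /L mulrBl mulrBr; rewrite /L in h; lra.
Qed.

Lemma sum_inv_split_primes D : (0 < D)%N -> exists C : R, forall n, (2 <= n)%N ->
  \sum_(0 <= p < n.+1 | split_prime D p) p%:R^-1 <= ln (ln n%:R) / 2 + C.
Proof.
move=> D0; have [C hC] := @sum_split_primes R D D0.
pose b p : R := if split_prime D p then ln p%:R / p%:R else 0.
have nsp p : (p < 2)%N -> split_prime D p = false.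
  by case: p => [|[|]].
have drop2 n (F : nat -> R) : (2 <= n)%N ->
    \sum_(0 <= p < n.+1 | split_prime D p) F p =
    \sum_(2 <= p < n.+1) if split_prime D p then F p else 0.
  by move=> n2; rewrite big_mkcond/= big_ltn// big_ltn ?ltnS ?(ltnW n2)//= ?nsp// !add0r.
have [|C' hC'] := sum_div_ln b C.
  by move=> n n2; have := hC n (ltnW n2); rewrite drop2.
exists C' => n n2; rewrite drop2//; apply: le_trans (hC' n n2).
rewrite big_seq [leRHS]big_seq; apply: ler_sum => p.
rewrite mem_index_iota => /andP[p2 _]; rewrite /b; case: ifP => _; last by rewrite mul0r.
have Lp : 0 < ln p%:R :> R by apply: ln_gt0; rewrite ltr1n.
by rewrite mulrAC divff ?mul1r// gt_eqF.
Qed.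

Lemma sum_inv_sqr n : \sum_(1 <= k < n.+1) (k%:R ^+ 2)^-1 <= 2 :> R.
Proof.
suff h m : (0 < m)%N -> \sum_(1 <= k < m.+1) (k%:R ^+ 2)^-1 <= 2 - m%:R^-1 :> R.
  case: n => [|n]; first by rewrite big_nil.
  by apply: le_trans (h n.+1 _) _ => //; rewrite gerBl invr_ge0.
elim: m => // m; case: m => [_ _|m IH _]; first by rewrite big_nat1 mulr1n expr1n invr1; lra.
rewrite big_nat_recr//=; have {}IH := IH isT.
have m0 : 0 < m.+1%:R :> R by rewrite ltr0n.
rewrite -(natr1 m.+1).
suff : ((m.+1%:R + 1) ^+ 2)^-1 <= m.+1%:R^-1 - (m.+1%:R + 1)^-1 :> R.
  by move=> h; apply: le_trans (lerD IH h) _; rewrite addrA subrK.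
rewrite -subr_ge0.
have -> : m.+1%:R^-1 - (m.+1%:R + 1)^-1 - ((m.+1%:R + 1) ^+ 2)^-1 =
    (m.+1%:R * (m.+1%:R + 1) ^+ 2)^-1 :> R.
  by field; rewrite !gt_eqF//; lra.
by rewrite invr_ge0 mulr_ge0// ?exprn_ge0//; lra.
Qed.

Lemma big_nat_dvd q x (F : nat -> R) : (0 < q)%N ->
  \sum_(1 <= n < x.+1 | (q %| n)%N) F n =
  \sum_(1 <= m < (x %/ q).+1) F (q * m)%N.
Proof.
move=> q0; elim: x => [|x IH]; first by rewrite div0n !big_nil.
rewrite big_mkcond big_nat_recr//= -big_mkcond/= IH divnS//.
case: ifP => [qx|_]; last by rewrite addr0 add0n.
rewrite add1n [RHS]big_nat_recr//=; congr (_ + F _).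
by have := divnK qx; rewrite divnS// qx add1n mulnC.
Qed.

End ReciprocalSums.

(** * The integers X^2 + D Y^2 *)

Section NormSieve.
Variable R : realType.
Variable D : nat.
Hypothesis D0 : (0 < D)%N.
Implicit Types (p q n m k K x : nat).

(* Inert primes occur to even order in an admissible integer. *)
Definition period p : nat := if inert D p then 2 else 1.
Definition admissible n : bool :=
  (0 < n)%N && [forall p : 'I_n.+1, prime p ==> (period p %| logn p n)%N].

Lemma period_gt0 p : (0 < period p)%N.
Proof. by rewrite /period; case: ifP. Qed.

Lemma admissibleP n : reflect
  ((0 < n)%N /\ forall p, prime p -> (period p %| logn p n)%N) (admissible n).
Proof.
apply: (iffP andP) => [[n0 /forallP h]|[n0 h]]; split => //; last first.
  by apply/forallP => p; apply/implyP; exact: h.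
move=> p pp; have [pn|np] := ltnP p n.+1.
  by have /implyP := h (Ordinal pn); apply.
by rewrite (ltn_log0 np) dvdn0.
Qed.

Lemma admissible_divr p j n : prime p ->
  admissible (p ^ (period p * j) * n) -> admissible n.
Proof.
move=> pp /admissibleP[]; rewrite muln_gt0 => /andP[p0 n0] h.
apply/admissibleP; split => // p' pp'; have := h _ pp'.
rewrite lognM// lognX logn_prime//; have [->|_] := eqVneq.
  by rewrite dvdn_addr// muln1 dvdn_mulr.
by rewrite muln0 add0n.
Qed.

Definition smooth k n := all (fun p => p < k)%N (primes n).

Let E k x : R := \sum_(1 <= n < x.+1 | admissible n && smooth k n) n%:R^-1.

Let E_ge0 k x : 0 <= E k x.
Proof. by apply: sumr_ge0 => n _; rewrite invr_ge0. Qed.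

Lemma smooth_pred k n : (0 < n)%N -> prime k -> smooth k.+1 n -> ~~ (k %| n)%N -> smooth k n.
Proof.
move=> n0 kp /allP sm kn; apply/allP => p pn; have := sm _ pn.
rewrite ltnS leq_eqVlt => /orP[/eqP pk|//].
by move: pn kn; rewrite mem_primes pk => /and3P[_ _ ->].
Qed.

(** One Euler factor without a geometric series. An admissible multiple of [k] is a multiple of
    [q = k ^ period k]; cancelling [q] leaves an admissible smooth [m <= x / q], so the multiples
    contribute at most [1 / q] times the same sum. *)
Let E_step k x : prime k ->
  E k.+1 x <= E k x + ((k ^ period k)%:R)^-1 * E k.+1 x.
Proof.
move=> kp; set q := (k ^ period k)%N.
have q0 : (0 < q)%N by rewrite expn_gt0 prime_gt0.
rewrite [leLHS](_ : E k.+1 x =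
    \sum_(1 <= n < x.+1 | (admissible n && smooth k.+1 n) && ~~ (k %| n)%N) n%:R^-1 +
    \sum_(1 <= n < x.+1 | (admissible n && smooth k.+1 n) && (k %| n)%N) n%:R^-1);
  last by rewrite addrC; exact: bigID.
apply: lerD.
  rewrite /E big_mkcond [leRHS]big_mkcond; apply: ler_sum => n _.
  case: ifP => [/andP[/andP[an sn] kn]|_]; last by case: ifP; rewrite ?invr_ge0.
  have n0 : (0 < n)%N by case/admissibleP: an.
  by rewrite an (smooth_pred _ _ n0 kp sn kn).
have -> : \sum_(1 <= n < x.+1 | (admissible n && smooth k.+1 n) && (k %| n)%N) n%:R^-1 =
    \sum_(1 <= n < x.+1 | (q %| n)%N) (if admissible n && smooth k.+1 n then n%:R^-1 else 0) :> R.
  rewrite [RHS]big_mkcond [LHS]big_mkcond/=; apply: eq_bigr => n _.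
  case: (boolP (admissible n)) => [|_]; last by case: ifP.
  move=> /admissibleP[n0 /(_ _ kp) an]; case: (smooth _ _) => /=; last by case: ifP.
  have -> : (q %| n)%N = (k %| n)%N; last by [].
  rewrite /q -[in RHS](expn1 k) !pfactor_dvdn//.
  apply/idP/idP => h; first by rewrite (leq_trans (period_gt0 k)).
  exact: dvdn_leq.
rewrite big_nat_dvd// /E.
rewrite mulr_sumr [leRHS]big_mkcond/=.
apply: le_trans (_ : \sum_(1 <= m < (x %/ q).+1)
    (if admissible m && smooth k.+1 m then q%:R^-1 * m%:R^-1 else 0) <= _); last first.
  rewrite [leRHS](@big_cat_nat _ _ _ (x %/ q).+1)//= ?ltnS ?leq_div//.
  by rewrite lerDl; apply: sumr_ge0 => m _; case: ifP => // _; rewrite mulr_ge0 ?invr_ge0.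
apply: ler_sum => m _; case: ifP => [/andP[am sm]|_]; last first.
  by case: ifP => // _; rewrite mulr_ge0 ?invr_ge0.
have -> : admissible m by apply: (@admissible_divr k 1) => //; rewrite muln1.
have m0 : (0 < m)%N by case/admissibleP: am; rewrite muln_gt0 => /andP[].
have -> : smooth k.+1 m.
  apply/allP => p pm; have /allP := sm; apply.
  by rewrite primesM// pm orbT.
by rewrite natrM invfM.
Qed.

(** Each prime contributes a factor [1 / (1 - t)] with [t = p ^ (- period p) <= 1/2], and there
    [1 / (1 - t) <= exp (t + 2 t ^ 2)], since [(1 - t) (1 + t + 2 t ^ 2) = 1 + t ^ 2 (1 - 2 t)]. *)
Let E_le K x : E K x <= expR (\sum_(0 <= p < K | prime p)
  ((p ^ period p)%:R^-1 + 2 * (p ^ period p)%:R^-1 ^+ 2)).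
Proof.
elim: K => [|K IH].
  rewrite big_nil expR0 /E big_mkcond/=.
  apply: le_trans (_ : \sum_(1 <= n < x.+1) (n == 1%N)%:R <= _).
    rewrite big_seq [leRHS]big_seq; apply: ler_sum => n.
    rewrite mem_index_iota => /andP[n1 _]; case: ifP => // /andP[_ sm].
    have -> : n = 1%N; last by rewrite invr1.
    apply/eqP; rewrite eqn_leq n1 andbT leqNgt; apply/negP => n2.
    have /allP/(_ (pdiv n)) := sm; rewrite ltn0 mem_primes pdiv_prime// pdiv_dvd n1.
    by move=> /(_ isT).
  case: x => [|x]; first by rewrite big_nil.
  by rewrite big_ltn//= big1_seq ?addr0// => n /andP[_]; rewrite mem_index_iota; case: n => [|[|]].
rewrite big_mkcond big_nat_recr//= -big_mkcond/=.
case: ifP => [pK|npK]; last first.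
  rewrite addr0; apply: le_trans IH.
  rewrite /E le_eqVlt; apply/orP; left; apply/eqP; apply: eq_bigl => n.
  congr (_ && _); apply: eq_in_all => p; rewrite mem_primes => /andP[pp _].
  by rewrite ltnS leq_eqVlt; case: eqP => //= pKe; rewrite -pKe pp in npK.
have := E_step _ x pK; rewrite expRD; set t := (_ %:R)^-1 => h.
have t0 : 0 <= t by rewrite invr_ge0.
have t1 : t <= 2^-1.
  rewrite lef_pV2 ?posrE ?ltr0n ?expn_gt0 ?prime_gt0//.
  rewrite (ler_nat _ 2) (leq_trans (prime_gt1 pK))// -[leqLHS]expn1.
  by rewrite leq_exp2l ?prime_gt1// period_gt0.
have e1 := expR_ge1Dx (t + 2 * t ^+ 2).
have := E_ge0 K.+1 x; have := E_ge0 K x.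
move: IH h e1; set A := E K.+1 x; set B := E K x; set X := expR (\sum_(_ <= _ < _ | _) _).
set Y := expR _ => IH h e1 B0 A0.
have Y1 : 1 <= (1 - t) * Y.
  apply: le_trans (_ : (1 - t) * (1 + (t + 2 * t ^+ 2)) <= _); last by rewrite ler_wpM2l//; lra.
  have : 0 <= t ^+ 2 * (1 - 2 * t) by rewrite mulr_ge0 ?sqr_ge0//; lra.
  by rewrite -[t ^+ 2]/(t * t); nra.
have h' : A * (1 - t) <= B by lra.
have Y0 : 0 <= Y by exact: expR_ge0.
apply: le_trans (_ : B * Y <= _); last by rewrite ler_wpM2r.
apply: le_trans (_ : A * (1 - t) * Y <= _); last by rewrite ler_wpM2r.
by rewrite -mulrA ler_peMr.
Qed.

(** Every [n <= x] has its primes below [x + 1], so [E_le] applies; in its exponent only split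
    primes matter, and [ln (ln x) / 2] exponentiates to [sqrt (ln x)]. *)
Lemma sum_inv_admissible : exists C : R, forall x, (2 <= x)%N ->
  \sum_(1 <= n < x.+1 | admissible n) n%:R^-1 <= C * Num.sqrt (ln x%:R).
Proof.
have [C hC] := @sum_inv_split_primes R D D0.
exists (expR (C + (D.*2.+1)%:R + 6)) => x x2.
have -> : \sum_(1 <= n < x.+1 | admissible n) n%:R^-1 = E x.+1 x.
  rewrite /E big_seq_cond [RHS]big_seq_cond; apply: eq_bigl => n.
  rewrite mem_index_iota; case: (boolP (0 < n)%N) => //= n0.
  case: (boolP (n < x.+1)%N) => //= nx; case: (admissible n) => //=.
  apply/esym/allP => p; rewrite mem_primes => /and3P[_ _ pn].
  by rewrite (leq_ltn_trans (dvdn_leq n0 pn)).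
apply: le_trans (E_le _ _) _.
have Lx : 0 < ln x%:R :> R by apply: ln_gt0; rewrite ltr1n.
have -> : Num.sqrt (ln x%:R) = expR (ln (ln x%:R) / 2) :> R.
  have e : ln x%:R = expR (ln (ln x%:R) / 2) ^+ 2 :> R.
    by rewrite -expRM_natl mulrCA divff// mulr1 lnK.
  by rewrite [in LHS]e sqrtr_sqr ger0_norm ?expR_ge0.
rewrite -expRD ler_expR.
(* An inert prime gives [p^-2 + 2 p^-4 <= 3 p^-2]. Another prime gives [p^-1 + 2 p^-2], where [p^-1]
   is charged to the split sum or, if [p <= 2 D], to a 1. These summands total at most [2 D + 1] and
   [3 * 2 = 6] besides the split sum. *)
apply: le_trans (_ : \sum_(0 <= p < x.+1)
   ((if split_prime D p then p%:R^-1 else 0) + (p <= D.*2)%:R + 3 * (p%:R ^+ 2)^-1) <= _).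
  rewrite big_mkcond; apply: ler_sum => p _.
  have sq0 : 0 <= (p%:R ^+ 2)^-1 :> R by rewrite invr_ge0 exprn_ge0.
  have lhs0 : 0 <= (if split_prime D p then p%:R^-1 else 0 : R).
    by case: ifP; rewrite ?invr_ge0.
  case: ifP => pp; last by rewrite !addr_ge0// mulr_ge0.
  have p2 : 1 <= p%:R :> R by rewrite ler1n prime_gt0.
  have i1 : p%:R^-1 <= 1 :> R by rewrite invf_le1// ltr0n prime_gt0.
  have i0 : 0 <= p%:R^-1 :> R by rewrite invr_ge0.
  rewrite -exprVn; move: i0 i1 lhs0; rewrite /split_prime pp /period/=.
  case: (boolP (inert D p)) => hi; rewrite /= ?andbT ?andbF ?expn1.
    rewrite natrX -exprVn; move: (p%:R^-1) => u u0 u1 _.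
    have : 0 <= (p <= D.*2)%:R :> R by [].
    have : 0 <= u ^+ 2 by rewrite sqr_ge0.
    have : (u ^+ 2) ^+ 2 <= u ^+ 2.
      by rewrite -[leRHS]mulr1 [leLHS]expr2 ler_wpM2l ?sqr_ge0// expr_le1.
    lra.
  move: (p%:R^-1) => u u0 u1; have : 0 <= u ^+ 2 by rewrite sqr_ge0.
  rewrite ltnNge; case: (leqP p D.*2) => _ /=; lra.
rewrite !big_split/= -big_mkcond/= -mulr_sumr.
have h1 := hC x x2.
have h2 : \sum_(0 <= p < x.+1) (p <= D.*2)%:R <= (D.*2.+1)%:R :> R.
  rewrite -natr_sum ler_nat.
  suff h m : (\sum_(0 <= p < m) (p <= D.*2) <= minn m D.*2.+1)%N.
    by rewrite (leq_trans (h _))// geq_minr.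
  elim: m => [|m IH]; first by rewrite big_nil.
  by rewrite big_nat_recr//=; case: (leqP m D.*2) IH; lia.
have h3 : \sum_(0 <= p < x.+1) (p%:R ^+ 2)^-1 <= 2 :> R.
  by rewrite big_ltn// expr0n invr0 add0r sum_inv_sqr.
lra.
Qed.

End NormSieve.

(** * From the sum of reciprocals to the number of norms *)

Section NormCount.
Variable R : realType.
Variable D : nat.
Hypothesis D0 : (0 < D)%N.
Implicit Types (p q n m k K x : nat).

(** Prime powers are taken in blocks [p ^ (period p * j)], so that each divisor counted can be
    cancelled without leaving the admissible integers. *)
Lemma ln_admissible n K : (n < K)%N -> admissible D n ->
  ln n%:R = \sum_(0 <= p < K | prime p) \sum_(1 <= j < K)
    (p ^ (period D p * j) %| n)%N%:R * ((period D p)%:R * ln p%:R) :> R.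
Proof.
move=> nK /admissibleP[n0 an].
rewrite (@ln_nat_logn _ n K)//; last first.
  by move=> p _ pn; rewrite (leq_ltn_trans (dvdn_leq n0 pn)).
apply: eq_bigr => p pp; rewrite -mulr_suml mulrA; congr (_ * _).
rewrite -natr_sum -natrM; congr (_%:R).
have /dvdnP[k kE] := an p pp; rewrite kE; congr (_ * _)%N.
have kK : (k < K)%N.
  rewrite (leq_trans _ nK)// ltnS (leq_trans _ (ltnW (ltn_logl p n0)))//.
  by rewrite kE leq_pmulr// period_gt0.
rewrite (eq_bigr (fun j => (j <= k)%N : nat)); last first.
  move=> j _; rewrite pfactor_dvdn// kE mulnC leq_pmul2r ?period_gt0//.
rewrite (@big_cat_nat _ _ _ k.+1)//= big_nat (eq_bigr (fun=> 1%N)); last first.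
  by move=> j /andP[_]; rewrite ltnS => ->.
rewrite -big_nat sum_nat_const_nat muln1 subn1/=.
rewrite big1_seq ?addn0// => j /andP[_]; rewrite mem_index_iota => /andP[kj _].
by rewrite leqNgt kj.
Qed.

(** Write [n = q m] with [q = p ^ (period p * j)] and sum over the admissible [m] last. Since
    [p ^ j <= q <= x / m], the inner sum of [period p * ln p] is at most
    [2 psi (x / m) <= 8 x / m]. *)
Lemma sum_ln_admissible x :
  \sum_(1 <= n < x.+1 | admissible D n) ln n%:R <=
  8 * x%:R * \sum_(1 <= n < x.+1 | admissible D n) n%:R^-1 :> R.
Proof.
pose w p : R := (period D p)%:R * ln p%:R.
have w0 p : 0 <= w p by rewrite mulr_ge0// ln_nat_ge0.
have -> : \sum_(1 <= n < x.+1 | admissible D n) ln n%:R =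
    \sum_(0 <= p < x.+1 | prime p) \sum_(1 <= j < x.+1)
    \sum_(1 <= n < x.+1 | admissible D n)
      (p ^ (period D p * j) %| n)%N%:R * w p :> R.
  rewrite big_seq_cond (eq_bigr (fun n => \sum_(0 <= p < x.+1 | prime p) \sum_(1 <= j < x.+1)
    (p ^ (period D p * j) %| n)%N%:R * w p)); last first.
    move=> n /andP[]; rewrite mem_index_iota => /andP[_ nx] an.
    exact: ln_admissible.
  rewrite -big_seq_cond exchange_big/=; apply: eq_bigr => p _.
  exact: exchange_big.
apply: le_trans (_ : \sum_(1 <= m < x.+1 | admissible D m) 2 * psi R x.+1 (x %/ m) <= _);
    last first.
  rewrite mulr_sumr big_seq_cond [leRHS]big_seq_cond; apply: ler_sum => m.
  rewrite mem_index_iota => /andP[/andP[m0 mx] _].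
  apply: le_trans (_ : 2 * (4 * (x %/ m)%:R) <= _).
    by rewrite ler_wpM2l// psi_le// ltnS leq_div.
  have : (x %/ m)%:R <= x%:R / m%:R :> R.
    by rewrite ler_pdivlMr ?ltr0n// -natrM ler_nat leq_trunc_div.
  lra.
rewrite /psi.
under [leRHS]eq_bigr do rewrite mulr_sumr.
rewrite [leRHS]exchange_big/=; apply: ler_sum => p pp.
under [leRHS]eq_bigr do rewrite mulr_sumr.
rewrite [leRHS]exchange_big/= big_seq [leRHS]big_seq; apply: ler_sum => j.
rewrite mem_index_iota => /andP[j1 jx].
set q := (p ^ (period D p * j))%N.
have q0 : (0 < q)%N by rewrite expn_gt0 prime_gt0.
have -> : \sum_(1 <= n < x.+1 | admissible D n) (q %| n)%N%:R * w p =
    \sum_(1 <= n < x.+1 | (q %| n)%N) (if admissible D n then w p else 0).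
  rewrite [LHS]big_mkcond [RHS]big_mkcond/=; apply: eq_bigr => n _.
  by case: (admissible D n); case: (q %| n)%N; rewrite ?mul1r ?mul0r.
rewrite big_nat_dvd// [leRHS]big_mkcond/=.
apply: le_trans (_ : \sum_(1 <= m < (x %/ q).+1)
    (if admissible D m then 2 * ((p ^ j <= x %/ m)%:R * ln p%:R) else 0) <= _); last first.
  rewrite [leRHS](@big_cat_nat _ _ _ (x %/ q).+1)//= ?ltnS ?leq_div//.
  rewrite lerDl; apply: sumr_ge0 => m _; case: ifP => // _.
  by rewrite mulr_ge0// mulr_ge0// ln_nat_ge0.
rewrite big_seq [leRHS]big_seq; apply: ler_sum => m; rewrite mem_index_iota ltnS.
move=> /andP[m1 mx]; case: ifP => [am|_]; last first.
  by case: ifP => // _; rewrite mulr_ge0// mulr_ge0// ln_nat_ge0.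
rewrite (admissible_divr _ _ j _ pp am).
have -> : (p ^ j <= x %/ m)%N.
  rewrite leq_divRL//; move: mx; rewrite leq_divRL// mulnC => mx.
  apply: leq_trans mx; rewrite leq_mul2r leq_exp2l ?prime_gt1//.
  by rewrite leq_pmull ?orbT// period_gt0.
rewrite mul1r ler_wpM2r ?ln_nat_ge0//.
by rewrite /period; case: ifP => _; rewrite ?ler1n.
Qed.

Lemma count_admissible : exists2 C : R, 0 <= C & forall x, (2 <= x)%N ->
  \sum_(1 <= n < x.+1 | admissible D n) 1 <= C * (x%:R / Num.sqrt (ln x%:R)).
Proof.
have [C hC] := @sum_inv_admissible R D D0.
exists (9 * `|C|) => [|x x2]; first by rewrite mulr_ge0.
have Lx : 0 < ln x%:R :> R by apply: ln_gt0; rewrite ltr1n.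
have x0 : 0 < x%:R :> R by rewrite ltr0n ltnW.
have h1 : ln x%:R * (\sum_(1 <= n < x.+1 | admissible D n) 1) <=
    9 * x%:R * \sum_(1 <= n < x.+1 | admissible D n) n%:R^-1 :> R.
  (* [ln x = ln n + ln (x / n) <= ln n + x / n], whence the constant [9 = 8 + 1]. *)
  apply: le_trans (_ : \sum_(1 <= n < x.+1 | admissible D n) (ln n%:R + x%:R / n%:R) <= _).
    rewrite mulr_sumr big_seq_cond [leRHS]big_seq_cond; apply: ler_sum => n.
    rewrite mem_index_iota mulr1 => /andP[/andP[n1 _] _].
    have n0 : 0 < n%:R :> R by rewrite ltr0n.
    have := ltW (ln_sublinear (divr_gt0 x0 n0)).
    by rewrite ln_div ?posrE// lerBlDl.
  have := sum_ln_admissible x; rewrite big_split/= -mulr_sumr; lra.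
have s0 : 0 < Num.sqrt (ln x%:R) :> R by rewrite sqrtr_gt0.
have sE : ln x%:R = Num.sqrt (ln x%:R) ^+ 2 :> R by rewrite sqr_sqrtr// ltW.
have h2 : \sum_(1 <= n < x.+1 | admissible D n) n%:R^-1 <= `|C| * Num.sqrt (ln x%:R) :> R.
  by apply: le_trans (hC x x2) _; rewrite ler_wpM2r ?ler_norm// ltW.
rewrite mulrA ler_pdivlMr// -(ler_pM2r s0) -mulrA -expr2 -sE mulrC.
apply: le_trans h1 _.
have -> : 9 * `|C| * x%:R * Num.sqrt (ln x%:R) = 9 * x%:R * (`|C| * Num.sqrt (ln x%:R)) :> R.
  by ring.
by rewrite ler_wpM2l// mulr_ge0.
Qed.

(** If [p] did not divide [Y], then [X / Y] would be a square root of [-D] modulo [p]. *)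
Lemma inert_dvd p X Y : prime p -> inert D p -> (p %| X ^ 2 + D * Y ^ 2)%N ->
  (p %| X)%N /\ (p %| Y)%N.
Proof.
move=> pp /forallP ip pXY.
have pY : (p %| Y)%N.
  apply: contraT; rewrite -prime_coprime// => cpY.
  have [u uY] : exists u, u * Y = 1 %[mod p].
    have Y0 : (0 < Y)%N.
      by case: (Y) cpY => // /eqP; rewrite gcdn0 => p1; rewrite p1 in pp.
    case: (egcdnP p Y0) => u v e _.
    by exists u; rewrite e gcdnC (eqP cpY) modnMDl.
  have zp : ((u * X) %% p < p)%N by rewrite ltn_mod prime_gt0.
  have /negP := ip (Ordinal zp); case; rewrite /=.
  have : (p %| (u * X) ^ 2 + D * (u * Y) ^ 2)%N.
    have -> : ((u * X) ^ 2 + D * (u * Y) ^ 2 = u ^ 2 * (X ^ 2 + D * Y ^ 2))%N.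
      by rewrite !expnMn mulnDr mulnCA.
    exact: dvdn_mull.
  rewrite /dvdn -modnDmr -modnMmr -modnXm uY modnXm modnMmr modnDmr exp1n muln1.
  by rewrite -modnDml -modnXm modnDml.
split => //; move: pXY; rewrite dvdn_addl; last first.
  by rewrite dvdn_mull// expnS dvdn_mulr.
by rewrite Euclid_dvdX// => /andP[].
Qed.

(** Descent: an inert divisor [p] divides both coordinates, and dividing them by [p] removes exactly
    [p ^ 2] from the norm. *)
Lemma norm_admissible X Y : (0 < X ^ 2 + D * Y ^ 2)%N -> admissible D (X ^ 2 + D * Y ^ 2).
Proof.
move=> n0; apply/admissibleP; split => // p pp; rewrite /period.
case: ifP => // ip; move: n0.
have [n] := ubnP (X ^ 2 + D * Y ^ 2)%N; elim: n X Y => // n IH X Y nXY n0.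
have [pn|pn] := boolP (p %| X ^ 2 + D * Y ^ 2)%N; last first.
  by rewrite lognE pp n0 (negbTE pn).
have [/dvdnP[X' XE] /dvdnP[Y' YE]] := inert_dvd _ _ _ pp ip pn.
have e : (X ^ 2 + D * Y ^ 2 = p ^ 2 * (X' ^ 2 + D * Y' ^ 2))%N.
  by rewrite XE YE !expnMn mulnDr mulnA -mulnA; congr (_ + _)%N; ring.
have n0' : (0 < X' ^ 2 + D * Y' ^ 2)%N.
  by move: n0; rewrite e muln_gt0 => /andP[].
rewrite e lognM// ?expn_gt0 ?prime_gt0// pfactorK// dvdn_addr//.
apply: IH => //; move: nXY; rewrite ltnS => nXY; apply: leq_trans nXY; rewrite e.
rewrite -[ltnLHS]mul1n ltn_mul2r n0'/=.
by rewrite -(expn0 p) ltn_exp2l ?prime_gt1.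
Qed.

End NormCount.

Set Implicit Arguments.
Unset Strict Implicit.
Unset Printing Implicit Defensive.

(** * Counting lemmas *)

Section Counting.
Variable R : realType.

(** A cardinality bound through duplicate-free lists, so that finiteness of [S] is part of the
    conclusion and never has to be known beforehand. *)
Definition atmost (T : eqType) (S : set T) (b : R) : Prop :=
  forall s : seq T, uniq s -> (forall x, x \in s -> S x) -> (size s)%:R <= b.

Lemma sub_atmost (T : eqType) (S S' : set T) b b' :
  atmost S' b' -> S `<=` S' -> b' <= b -> atmost S b.
Proof.
by move=> h SS bb s us sS; apply: le_trans bb; apply: h => // x /sS/SS.
Qed.

Lemma atmostU (T : eqType) (A B : set T) a b :
  atmost A a -> atmost B b -> atmost (A `|` B) (a + b).
Proof.
move=> hA hB s us sS.
rewrite -(count_predC (fun x => `[< A x >]) s) -!size_filter natrD lerD//.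
  apply: hA; first exact: filter_uniq.
  by move=> x; rewrite mem_filter => /andP[/asboolP].
apply: hB; first exact: filter_uniq.
by move=> x; rewrite mem_filter => /andP[/= /asboolP xA] /sS[|].
Qed.

Lemma atmost_image (T U : eqType) (f : T -> U) (A : set T) b :
  atmost A b -> atmost (f @` A) b.
Proof.
move=> hA s us sS.
have [g gP] : exists g : U -> option T, forall u, u \in s ->
    exists2 t, g u = Some t & A t /\ f t = u.
  have /choice[g gP] : forall u, exists o : option T, u \in s ->
      exists2 t, o = Some t & A t /\ f t = u.
    move=> u; have [us'|] := boolP (u \in s); last by exists None.
    by have [t At ft] := sS _ us'; exists (Some t) => _; exists t.
  by exists g.
have gs : size (pmap g s) = size s.
  rewrite size_pmap; apply/eqP; rewrite -all_count; apply/allP => u /gP[t].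
  by move=> /= ->.
have mem_g t : t \in pmap g s -> A t /\ f t \in s.
  rewrite mem_pmap => /mapP[u us' gu]; have [t' gt [At ft]] := gP _ us'.
  by move: gu; rewrite gt => -[->]; rewrite ft.
rewrite -gs; apply: hA; last by move=> t /mem_g[].
have h : map f (pmap g s) = s.
  elim: (s) gP => //= u s' IH gP'.
  have [t gt [At ft]] := gP' u (mem_head _ _); rewrite gt/= ft IH// => v vs.
  by apply: gP'; rewrite inE vs orbT.
by apply: (@map_uniq _ _ f); rewrite h.
Qed.

Lemma atmost_fiber (T U : eqType) (S : set (T * U)) (A : set T) a b :
  0 <= b -> atmost A a -> (forall p, S p -> A p.1) ->
  (forall x, A x -> atmost [set y | S (x, y)] b) -> atmost S (a * b).
Proof.
move=> b0 hA SA hb s us sS.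
pose xs := undup (map fst s).
have hxs : (size xs)%:R <= a.
  apply: hA; first exact: undup_uniq.
  by move=> x; rewrite mem_undup => /mapP[p /sS/SA Ap ->].
apply: le_trans (_ : (size xs)%:R * b <= _); last by rewrite ler_wpM2r.
have hx x : x \in xs -> (count (fun p => p.1 == x) s)%:R <= b.
  rewrite mem_undup => /mapP[p0 ps xE].
  have Ax : A x by rewrite xE; exact/SA/sS.
  rewrite -size_filter -(size_map snd); apply: (hb x Ax).
    rewrite map_inj_in_uniq ?filter_uniq// => -[u v] [u' v'].
    by rewrite !mem_filter/= => /andP[/eqP -> _] /andP[/eqP -> _] ->.
  move=> y /mapP[[u v]]; rewrite mem_filter/= => /andP[/eqP -> ms] ->.
  exact: sS.
have -> : size s = (\sum_(x <- xs) count (fun p => p.1 == x) s)%N.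
  rewrite -(count_predT s).
  have sub : {subset map fst s <= xs} by move=> x; rewrite mem_undup.
  have uxs : uniq xs by exact: undup_uniq.
  elim: (s) sub => [|p s' IH] sub; first by rewrite big1.
  rewrite /= big_split/= IH; last by move=> x xs'; apply: sub; rewrite inE xs' orbT.
  congr (_ + _)%N; rewrite (bigD1_seq p.1) ?sub ?mem_head//= eqxx big1// => x.
  by rewrite eq_sym => /negbTE ->.
rewrite natr_sum.
have : \sum_(x <- xs) (count (fun p => p.1 == x) s)%:R <= \sum_(x <- xs) b :> R.
  by rewrite big_seq [leRHS]big_seq; apply: ler_sum.
by rewrite big_const_seq count_predT iter_addr_0 mulr_natl.
Qed.

Lemma atmost_diam (S : set int) (h : R) : 0 <= h ->
  (forall x y, S x -> S y -> x <= y -> (y - x)%:~R <= h) -> atmost S (h + 1).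
Proof.
move=> h0 Sh [|x0 s'] us sS; first by rewrite addr_ge0.
set s := x0 :: s' in us sS *.
have [m ms mP] : exists2 m, m \in s & forall x, x \in s -> m <= x.
  rewrite /s; elim: (s') (x0) => [|y r IH] x; first by exists x; rewrite ?inE// => z; rewrite inE => /eqP ->.
  have [m mr mP] := IH y; have [xm|mx] := leP x m.
    exists x; rewrite ?mem_head// => z; rewrite inE => /orP[/eqP ->//|/mP].
    exact: le_trans.
  exists m; first by rewrite inE mr orbT.
  by move=> z; rewrite inE => /orP[/eqP ->|/mP//]; exact: ltW.
have sub : {subset map (fun x => absz (x - m)) s <= iota 0 (Num.truncn h).+1}.
  move=> _ /mapP[x xs ->]; rewrite mem_iota/= add0n ltnS truncn_ge_nat//.
  apply: le_trans (Sh m x (sS _ ms) (sS _ xs) (mP _ xs)).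
  by rewrite -[leLHS]/((absz (x - m))%:Z%:~R) gez0_abs ?subr_ge0 ?mP.
have umap : uniq (map (fun x => absz (x - m)) s).
  rewrite map_inj_in_uniq// => x y xs ys /(congr1 Posz).
  by rewrite !gez0_abs ?subr_ge0 ?mP// => /addIr.
have := uniq_leq_size umap sub; rewrite size_map size_iota -(ler_nat R) => /le_trans; apply.
by rewrite -natr1 lerD2r -truncn_ge_nat.
Qed.

Lemma atmost_interval (a b : R) :
  atmost [set x : int | a <= x%:~R <= b] (`|b - a| + 1).
Proof.
apply: atmost_diam => // x y /andP[ax xb] /andP[ay yb] _.
by rewrite (le_trans _ (ler_norm _))// rmorphB/= lerB.
Qed.

Lemma atmost_norm_le (b : R) : 0 <= b ->
  atmost [set x : int | `|x%:~R : R| <= b] (2 * b + 1).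
Proof.
move=> b0; apply: sub_atmost (@atmost_interval (- b) b) _ _.
  by move=> x /=; rewrite ler_norml.
by rewrite opprK ger0_norm ?addr_ge0// lerD2r; lra.
Qed.

(* On either side of the vertex, [A (y2 - y1)^2 <= P y2 - P y1]. *)
Lemma atmost_quadratic (A B C N : R) : 0 < A -> 0 <= N ->
  atmost [set y : int | 0 <= A * y%:~R ^+ 2 + B * y%:~R + C <= N]
    (2 * (Num.sqrt (N / A) + 1)).
Proof.
move=> A0 N0.
set P := fun t : R => A * t ^+ 2 + B * t + C.
pose S1 := [set y : int | 0 <= P y%:~R <= N /\ - B <= 2 * A * y%:~R].
pose S2 := [set y : int | 0 <= P y%:~R <= N /\ 2 * A * y%:~R <= - B].
have sq (t : R) : 0 <= t -> A * t ^+ 2 <= N -> t <= Num.sqrt (N / A).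
  move=> t0 tN; rewrite -(ger0_norm t0) -sqrtr_sqr ler_wsqrtr//.
  by rewrite ler_pdivlMr// mulrC.
have h1 : atmost S1 (Num.sqrt (N / A) + 1).
  apply: atmost_diam => // x y [/andP[px _] vx] [/andP[_ py] vy] xy.
  rewrite rmorphB/=; move: px py vx vy; rewrite /P.
  have : x%:~R <= y%:~R :> R by rewrite ler_int.
  move: (x%:~R : R) (y%:~R : R) => u v uv px py vx vy.
  apply: sq; first by rewrite subr_ge0.
  have : 0 <= (v - u) * (2 * A * u + B) by rewrite mulr_ge0//; lra.
  rewrite !expr2 in px py *; nra.
have h2 : atmost S2 (Num.sqrt (N / A) + 1).
  apply: atmost_diam => // x y [/andP[_ px] vx] [/andP[py _] vy] xy.
  rewrite rmorphB/=; move: px py vx vy; rewrite /P.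
  have : x%:~R <= y%:~R :> R by rewrite ler_int.
  move: (x%:~R : R) (y%:~R : R) => u v uv px py vx vy.
  apply: sq; first by rewrite subr_ge0.
  have : 0 <= (v - u) * (- (2 * A * v + B)) by rewrite mulr_ge0//; lra.
  rewrite !expr2 in px py *; nra.
apply: sub_atmost (atmostU h1 h2) _ _; last by rewrite mulr_natl mulr2n.
by move=> y /= hy; have [v|/ltW v] := leP (- B) (2 * A * y%:~R); [left|right].
Qed.

Definition upto (V : set int) (N : R) : set int :=
  V `&` [set v | 1 <= v /\ v%:~R <= N].

Definition landau_bounded (V : set int) : Prop :=
  exists C N0 : R, forall N, N0 <= N -> atmost (upto V N) (C * (N / Num.sqrt (ln N))).

Lemma sqrt_ln_le (N : R) : 1 <= N -> Num.sqrt (ln N) <= 2 * Num.sqrt (Num.sqrt N).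
Proof.
move=> N1; have N0 : 0 < N by lra.
have s0 : 0 < Num.sqrt N by rewrite sqrtr_gt0.
apply: le_trans (_ : Num.sqrt (2 * Num.sqrt N) <= _).
  have -> : ln N = 2 * ln (Num.sqrt N).
    by rewrite mulr_natl -lnXn// sqr_sqrtr// ltW.
  by rewrite ler_wsqrtr// ler_wpM2l// ltW// ln_sublinear.
rewrite sqrtrM//; apply: ler_wpM2r; first exact: sqrtr_ge0.
rewrite -[leRHS](@ger0_norm _ (2 : R))// -sqrtr_sqr ler_wsqrtr//.
by rewrite expr2; lra.
Qed.

(** [sqrt (ln N) <= 2 N^(1/4)], so a power saving of [N^(1/4)] absorbs the logarithm. *)
Lemma three_quarters_bounded (V : set int) :
  (exists C N0 : R, forall N, N0 <= N ->
    atmost (upto V N) (C * Num.sqrt (Num.sqrt N) ^+ 3)) -> landau_bounded V.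
Proof.
move=> [C [N0 h]]; exists (2 * `|C|), (Num.max N0 3) => N.
rewrite ge_max => /andP[N0N N3].
apply: sub_atmost (h N N0N) _ _ => //.
have sl : 0 < Num.sqrt (ln N) by rewrite sqrtr_gt0 ln_gt0//; lra.
set T := Num.sqrt (Num.sqrt N).
have T0 : 0 <= T by exact: sqrtr_ge0.
have TN : T ^+ 4 = N.
  by rewrite (exprM T 2 2) sqr_sqrtr ?sqrtr_ge0// sqr_sqrtr//; lra.
apply: le_trans (_ : `|C| * T ^+ 3 <= _).
  by rewrite ler_wpM2r ?exprn_ge0// ler_norm.
rewrite [leRHS]mulrA ler_pdivlMr//.
apply: le_trans (_ : `|C| * T ^+ 3 * (2 * T) <= _).
  rewrite ler_wpM2l ?mulr_ge0 ?exprn_ge0// sqrt_ln_le//; lra.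
rewrite -TN le_eqVlt; apply/orP; left; apply/eqP; ring.
Qed.

Lemma ratio_sqrt_ln_ge1 (N : R) : 3 <= N -> 1 <= N / Num.sqrt (ln N).
Proof.
move=> N3; have lN : 0 < ln N by rewrite ln_gt0//; lra.
rewrite ler_pdivlMr ?sqrtr_gt0// mul1r.
have N0 : 0 <= N by lra.
rewrite -[leRHS](ger0_norm N0) -sqrtr_sqr ler_wsqrtr//.
apply: le_trans (_ : N <= _); first by rewrite ltW// ln_sublinear//; lra.
by rewrite expr2 ler_peMl//; lra.
Qed.

(** [v |-> m v + k] is injective and takes values up to [N] to values up to [(m + |k|) N], apart
    from at most [2 |k| + 1] positive [v] with nonpositive image. Completed squares, determinants
    and denominators are all absorbed in this way. *)
Lemma landau_bounded_affine (m k : int) (V W : set int) : 0 < m ->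
  (forall v, V v -> W (m * v + k)) -> landau_bounded W -> landau_bounded V.
Proof.
move=> m0 VW [C [N0 h]].
pose M : R := m%:~R + `|k%:~R|.
have mR : 1 <= m%:~R :> R by rewrite -[1]/(1%:~R) ler_int.
have M1 : 1 <= M by rewrite ler_wpDr.
exists (`|C| * M + (2 * `|k%:~R| + 1)), (Num.max `|N0| 3) => N.
rewrite ge_max => /andP[N0N N3].
have N0MN : N0 <= M * N.
  apply: le_trans (ler_norm _) _; apply: le_trans N0N _; rewrite ler_peMl//; lra.
have hM := h _ N0MN.
have lN : 0 < ln N by rewrite ln_gt0//; lra.
have lNM : ln N <= ln (M * N).
  by rewrite ler_ln ?posrE ?mulr_gt0 ?ler_peMl//; lra.
have sN : 0 < Num.sqrt (ln N) by rewrite sqrtr_gt0.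
have X0 : 0 <= M * N / Num.sqrt (ln (M * N)).
  by rewrite divr_ge0 ?sqrtr_ge0// mulr_ge0//; lra.
have XX : M * N / Num.sqrt (ln (M * N)) <= M * N / Num.sqrt (ln N).
  rewrite ler_wpM2l//; first by rewrite mulr_ge0//; lra.
  by rewrite lef_pV2 ?posrE ?sqrtr_gt0 ?ler_wsqrtr// (lt_le_trans lN).
pose V1 := upto V N `&` [set v | 1 <= m * v + k].
pose V2 := upto V N `&` [set v | m * v + k <= 0].
have h1 : atmost V1 (C * (M * N / Num.sqrt (ln (M * N)))).
  move=> s us sS; rewrite -(size_map (fun v => m * v + k)); apply: hM.
    by rewrite map_inj_uniq// => u v /addIr/mulfI; apply; rewrite gt_eqF.
  move=> _ /mapP[v /sS[[Vv [v1 vN]] mv] ->]; split; first exact: VW.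
  split => //; rewrite rmorphD rmorphM/= /M mulrDl lerD//.
    by rewrite ler_wpM2l//; lra.
  by rewrite (le_trans (ler_norm _))// ler_peMr//; lra.
have h2 : atmost V2 (2 * `|k%:~R| + 1).
  apply: sub_atmost (atmost_norm_le (normr_ge0 _)) _ _ => //.
  move=> v [[_ [v1 _]] mv] /=.
  rewrite -!intr_norm ler_int; apply: le_trans (_ : m * v <= _).
    by rewrite ger0_norm ?(le_trans _ v1)// ler_peMl ?(le_trans _ v1)// -gtz0_ge1.
  by apply: le_trans (_ : - k <= _); [rewrite -subr_le0 opprK|rewrite -normrN ler_norm].
apply: sub_atmost (atmostU h1 h2) _ _.
  move=> v Vv; have [mv|] := leP 1 (m * v + k); first by left.
  by rewrite -[1]add0r ltzD1; right.
rewrite [leRHS]mulrDl lerD//.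
  apply: le_trans (_ : `|C| * (M * N / Num.sqrt (ln (M * N))) <= _).
    by rewrite ler_wpM2r// ler_norm.
  rewrite -[leRHS]mulrA [X in _ <= _ * X]mulrA.
  by rewrite ler_wpM2l.
by rewrite ler_peMr ?ratio_sqrt_ln_ge1// addr_ge0// mulr_ge0.
Qed.

Lemma landau_bounded_norm (D : nat) : (0 < D)%N ->
  landau_bounded [set n | exists X Y : int, n = X ^+ 2 + D%:Z * Y ^+ 2].
Proof.
move=> D0; have [C C0 hC] := count_admissible R D D0.
exists (2 * C), 3 => N N3 s us sS.
pose x := Num.truncn N.
have xN : x%:R <= N by rewrite -truncn_ge_nat //; lra.
have Nx : N < x%:R + 1 by rewrite natr1 -truncn_lt_nat//; lra.
have x2 : (2 <= x)%N by rewrite truncn_ge_nat//; lra.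
have x2R : 2 <= x%:R :> R by rewrite (ler_nat _ 2).
have h1 : (size s)%:R <= \sum_(1 <= n < x.+1 | admissible D n) 1 :> R.
  rewrite -(size_map absz) big_const_seq iter_addr_0 ler_nat -size_filter.
  apply: uniq_leq_size.
    rewrite map_inj_in_uniq// => u v /sS[_ [u1 _]] /sS[_ [v1 _]] /(congr1 Posz).
    by rewrite !gez0_abs// ?(le_trans _ u1) ?(le_trans _ v1).
  move=> _ /mapP[v /sS[[X [Y vE]] [v1 vN]] ->].
  have v0 : 0 <= v by rewrite (le_trans _ v1).
  have av : absz v = (absz X ^ 2 + D * absz Y ^ 2)%N.
    apply/eqP; rewrite -eqz_nat gez0_abs// PoszD PoszM -!natz !natrX !natz.
    by rewrite !abszE !real_normK ?num_real// vE.
  rewrite mem_filter mem_index_iota; apply/andP; split.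
    rewrite av; apply: norm_admissible => //; rewrite -av.
    by rewrite -ltz_nat gez0_abs// (lt_le_trans _ v1).
  rewrite -lez_nat ltnS truncn_ge_nat; last lra.
  by rewrite pmulrn gez0_abs// v1 vN.
apply: le_trans h1 _; apply: le_trans (hC x x2) _.
rewrite (mulrC 2 C) -[leRHS]mulrA ler_wpM2l//.
have lx : 0 < ln x%:R :> R by rewrite ln_gt0//; lra.
have lN : 0 < ln N by rewrite ln_gt0//; lra.
rewrite mulrA ler_pdivrMr ?sqrtr_gt0// mulrAC ler_pdivlMr ?sqrtr_gt0//.
have -> : 2 * N * Num.sqrt (ln x%:R) = N * (2 * Num.sqrt (ln x%:R)) by ring.
rewrite ler_pM ?sqrtr_ge0//.
apply: le_trans (_ : Num.sqrt (2 ^+ 2 * ln x%:R) <= _); last first.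
  by rewrite sqrtrM ?sqr_ge0// sqrtr_sqr ger0_norm.
rewrite ler_wsqrtr//.
(* Rounding [N] down to [x] costs the factor 2: [N < x + 1 <= x ^ 4], hence
   [sqrt (ln N) <= 2 sqrt (ln x)]. *)
have -> : 2 ^+ 2 * ln x%:R = ln (x%:R ^+ 4) :> R.
  rewrite lnXn; last lra.
  by rewrite -[RHS]mulr_natl -natrX.
rewrite ler_ln ?posrE ?exprn_gt0//; [|lra|lra].
apply: le_trans (ltW Nx) _.
have : x%:R ^+ 4 = x%:R * (x%:R * (x%:R * x%:R)) :> R by ring.
move=> ->; have : 2 * 2 <= x%:R * x%:R :> R by rewrite ler_pM.
have : 0 <= (x%:R - 2) * x%:R :> R by rewrite mulr_ge0//; lra.
move: (x%:R : R) x2R => u u2 *.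
have : 0 <= u * u * (u * u - 4) by rewrite mulr_ge0//; nra.
rewrite !mulrA; nra.
Qed.

End Counting.

(** * Integer polynomials on residue classes *)

Section IntegerPolynomials.
Implicit Types (s : seq int) (a b c k t x y : int).

(** Horner evaluation with the constant term first, so that [rcons s a] has leading coefficient
    [a]. *)
Definition peval s t : int := foldr (fun c v => c + t * v) 0 s.

Lemma peval_rcons s a t : peval (rcons s a) t = peval s t + a * t ^+ size s.
Proof.
elim: s => [|c s IH] /=; first by rewrite mulr0 addr0 add0r expr0 mulr1.
by rewrite IH exprS; ring.
Qed.

Lemma peval_scale c s t : peval (map (fun a => c * a) s) t = c * peval s t.
Proof. by elim: s => [|a s /= ->]; rewrite /= ?mulr0//; ring. Qed.

(** Integrality drives the induction: the strict inequality leaves a gap of 1, which is multiplied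
    by [|t| > |c|] and makes room for the next coefficient [c]. *)
Lemma peval_lt s : exists2 T : int, 1 <= T &
  forall t, T <= `|t| -> `|peval s t| < `|t| ^+ size s.
Proof.
elim: s => [|c s [T T1 IH]]; first by exists 1.
exists (Num.max T (`|c| + 1)) => [|t]; first by rewrite le_max T1.
rewrite ge_max => /andP[/IH h tc] /=.
apply: le_lt_trans (ler_normD _ _) _; rewrite normrM exprS.
have t0 : 0 <= `|t| by [].
have := ler_wpM2l t0 (_ : `|peval s t| + 1 <= `|t| ^+ size s).
rewrite lezD1 => /(_ h); rewrite mulrDr mulr1; move: (`|t| * _ ^+ _) (`|t| * `|peval s t|) => u v uv; lia.
Qed.

Lemma class_unbounded k x (T : int) : 0 < k -> 1 <= T ->
  (exists t, T <= x + k * t) /\ (exists t, T <= - (x + k * t)).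
Proof.
move=> k0 T1; have k1 : 1 <= k by rewrite -gtz0_ge1.
have h : T <= k * T by rewrite ler_peMl// (le_trans _ T1).
have xk : `|x| <= k * `|x| by rewrite ler_peMl.
have := ler_norm x; have := ler_norm (- x); rewrite normrN => x1 x2.
split; [exists (T + `|x|)|exists (- (T + `|x|))]; rewrite ?mulrN mulrDr; lra.
Qed.

(** Positivity is assumed on an arithmetic progression only, since this is what a line through [L]
    provides. *)
Lemma peval_lead_ge0 k x s a : 0 < k ->
  (forall t, 0 <= peval (rcons s a) (x + k * t)) -> 0 <= a.
Proof.
move=> k0 h; have [T T1 hT] := peval_lt s.
have [[t Tt] _] := class_unbounded x k0 T1.
have := h t; rewrite peval_rcons; set u := x + k * t in Tt *.
have u0 : 0 <= u by rewrite (le_trans _ Tt)// (le_trans _ T1).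
have := hT u; rewrite ger0_norm// => /(_ Tt) /(le_lt_trans (ler_norm _)).
set v := u ^+ size s => pv pos; rewrite leNgt; apply/negP => a0; have a1 : a <= -1 by clear -a0; lia.
have v0 : 0 <= v by exact: exprn_ge0.
have := ler_wpM2r v0 a1; lra.
Qed.

Lemma peval_lead_odd k x s a : 0 < k -> odd (size s) ->
  (forall t, 0 <= peval (rcons s a) (x + k * t)) -> a = 0.
Proof.
move=> k0 os h; apply/eqP; rewrite eq_le (peval_lead_ge0 k0 h) andbT.
have [T T1 hT] := peval_lt s.
have [_ [t Tt]] := class_unbounded x k0 T1.
have := h t; rewrite peval_rcons; set u := x + k * t in Tt *.
have u0 : u <= 0 by lia.
have := hT u; rewrite ler0_norm// => /(_ Tt) /(le_lt_trans (ler_norm _)).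
have -> : u ^+ size s = - (- u) ^+ size s by rewrite exprNn -signr_odd os expr1; ring.
set v := (- u) ^+ size s => pv pos; rewrite leNgt; apply/negP => a0; have a1 : 1 <= a by clear -a0; lia.
have v0 : 0 <= v by apply: exprn_ge0; rewrite oppr_ge0.
have := ler_wpM2r v0 a1; lra.
Qed.

Lemma peval_lead_eq0 k x s a : 0 < k ->
  (forall t, peval (rcons s a) (x + k * t) = 0) -> a = 0.
Proof.
move=> k0 h; apply/eqP; rewrite eq_le; apply/andP; split; last first.
  by apply: (peval_lead_ge0 (x := x) (s := s) k0) => t; rewrite h.
rewrite -oppr_ge0; apply: (peval_lead_ge0 (x := x) (s := map (fun a => -1 * a) s) k0) => t.
have := h t; rewrite !peval_rcons peval_scale size_map mulNr; lra.
Qed.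

Lemma peval_even_lower s a : ~~ odd (size s) -> 0 < a ->
  exists2 T, 1 <= T & forall t, T <= `|t| -> t ^+ size s <= 2 * peval (rcons s a) t.
Proof.
(* With the lower terms doubled, [2 p (t) >= 2 a t ^ n - t ^ n >= t ^ n], as the integer [a] is at
   least 1. *)
move=> es a0; have [T T1 hT] := peval_lt (map (fun a => 2 * a) s).
exists T => // t /hT; rewrite peval_scale size_map peval_rcons.
have -> : `|t| ^+ size s = t ^+ size s by rewrite -normrX ger0_norm// exprn_even_ge0.
have v0 : 0 <= t ^+ size s by rewrite exprn_even_ge0.
move: v0; set v := _ ^+ _ => v0 /ltr_normlP[h _].
have := ler_wpM2r v0 (_ : 1 <= a); rewrite -gtz0_ge1 => /(_ a0).
lra.
Qed.

Lemma peval_le s n : (size s <= n.+1)%N ->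
  exists2 K, 0 <= K & forall M t, 1 <= M -> `|t| <= M -> `|peval s t| <= K * M ^+ n.
Proof.
elim: s n => [|c s IH] n sn; first by exists 0 => // M t _ _; rewrite normr0 mul0r.
case: n sn => [|n] sn.
  have s0 : s = [::] by case: s sn {IH}.
  by exists `|c| => // M t _ _; rewrite s0 /= mulr0 addr0 expr0 mulr1.
have [K K0 hK] := IH n sn; exists (`|c| + K) => [|M t M1 tM]; first by rewrite addr_ge0.
apply: le_trans (ler_normD _ _) _; rewrite mulrDl lerD//.
  by rewrite ler_peMr// exprn_ege1.
by rewrite normrM exprS mulrCA ler_pM// hK.
Qed.

(** For large [y] this is a comparison of growth; for small [y] the other polynomial is bounded and
    the quadratic is at least 1. *)
Lemma quadratic_dominates a0 a1 a2 s : 0 < a2 -> (size s <= 3)%N ->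
  exists2 K, 0 <= K &
    forall y, 1 <= peval [:: a0; a1; a2] y -> `|peval s y| <= K * peval [:: a0; a1; a2] y.
Proof.
move=> a20 ss; have [T T1 hT] := @peval_even_lower [:: a0; a1] a2 isT a20.
have [K K0 hK] := @peval_le s 2 ss.
exists (K * 2 + K * T ^+ 2) => [|y]; first by apply: addr_ge0; apply: mulr_ge0 => //; exact: sqr_ge0.
set A := peval _ _ => A1; rewrite mulrDl.
have KT : 0 <= K * T ^+ 2 by apply: mulr_ge0 => //; exact: sqr_ge0.
have [Ty|/ltW yT] := leP T `|y|.
  apply: le_trans (hK `|y| y (le_trans T1 Ty) _) _ => //.
  rewrite -[leLHS]addr0 lerD//; last by apply: mulr_ge0 => //; exact: le_trans A1.
  rewrite -[leRHS]mulrA ler_wpM2l// -normrX ger0_norm ?sqr_ge0//; exact: hT.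
apply: le_trans (hK T y T1 yT) _.
rewrite -[leLHS]add0r lerD//; last by rewrite ler_peMr.
by apply: mulr_ge0; [exact: mulr_ge0|exact: le_trans A1].
Qed.

Definition cubic b30 b21 b12 b03 b20 b11 b02 b10 b01 b00 x y : int :=
  b30 * x ^+ 3 + b21 * x ^+ 2 * y + b12 * x * y ^+ 2 + b03 * y ^+ 3 +
  b20 * x ^+ 2 + b11 * x * y + b02 * y ^+ 2 + b10 * x + b01 * y + b00.

(** A nonempty union of cosets of [k Z^2]: what the integer plane becomes under nonsingular integer
    substitutions. *)
Definition periodic (L : int -> int -> Prop) k : Prop :=
  [/\ 0 < k, exists x y, L x y & forall x y a b, L x y -> L (x + k * a) (y + k * b)].

Definition values (L : int -> int -> Prop) (F : int -> int -> int) : set int :=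
  [set v | exists x y, L x y /\ v = F x y].

Definition quartic c4 c3 c2 c1 c0 x y : int :=
  c4 * x ^+ 4 + c3 * x ^+ 3 * y + c2 * x ^+ 2 * y ^+ 2 + c1 * x * y ^+ 3 + c0 * y ^+ 4.

End IntegerPolynomials.

(** * Leading form c x^4 *)

Section UnivariateCases.
Variable R : realType.
Implicit Types (V : set int) (N T : R).

Lemma fourth_root_spec N : 1 <= N -> let T := Num.sqrt (Num.sqrt N) in
  [/\ 1 <= T, T ^+ 4 = N & Num.sqrt N = T ^+ 2].
Proof.
move=> N1 T; have N0 : 0 <= N by lra.
have s1 : 1 <= Num.sqrt N by rewrite -(@sqrtr1 R) ler_wsqrtr.
split; first by rewrite -(@sqrtr1 R) ler_wsqrtr.
  by rewrite (exprM T 2 2) !sqr_sqrtr ?sqrtr_ge0.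
by rewrite sqr_sqrtr ?sqrtr_ge0.
Qed.

Lemma le_fourth_root (c T u : R) : 1 <= c -> 0 <= T -> 0 <= u ->
  u ^+ 4 <= c * T ^+ 4 -> u <= c * T.
Proof.
move=> c1 T0 u0 h; have c0 : 0 <= c by lra.
rewrite -(@ler_pXn2r _ 4)// ?nnegrE ?mulr_ge0//; apply: le_trans h _.
by rewrite exprMn ler_wpM2r ?exprn_ge0// exprS ler_peMr// exprn_ege1.
Qed.

Lemma le_square_root (c T u : R) : 1 <= c -> 0 <= T -> 0 <= u ->
  u ^+ 2 <= c * T ^+ 2 -> u <= c * T.
Proof.
move=> c1 T0 u0 h; have c0 : 0 <= c by lra.
rewrite -(@ler_pXn2r _ 2)// ?nnegrE ?mulr_ge0//; apply: le_trans h _.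
by rewrite exprMn ler_wpM2r ?exprn_ge0// exprS ler_peMr// exprn_ege1.
Qed.

Lemma landau_bounded_sub V W : V `<=` W -> landau_bounded R W -> landau_bounded R V.
Proof.
move=> VW; apply: (@landau_bounded_affine R 1 0) => // v Vv.
by rewrite mul1r addr0; exact: VW.
Qed.

Lemma landau_bounded_square (m k : int) V : 0 < m ->
  (forall v, V v -> exists z : int, m * v + k = z ^+ 2) -> landau_bounded R V.
Proof.
move=> m0 h; apply: (@landau_bounded_affine R m k _ _ m0 _ (landau_bounded_norm R (ltn0Sn 0))).
move=> v /h[z zE]; exists z, 0; rewrite zE; ring.
Qed.

Lemma landau_bounded_param (C : R) V (f : int -> int) : 0 <= C ->
  (forall N v, 1 <= N -> upto V N v ->
    exists2 x, v = f x & `|x%:~R| <= C * Num.sqrt (Num.sqrt N)) ->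
  landau_bounded R V.
Proof.
move=> C0 h; apply: three_quarters_bounded; exists (2 * C + 1), 1 => N N1.
have [T1 TN _] := fourth_root_spec N1; set T := Num.sqrt _ in T1 TN *.
have CT0 : 0 <= C * T by rewrite mulr_ge0//; lra.
apply: sub_atmost (atmost_image (f := f) (atmost_norm_le CT0)) _ _.
  by move=> v /(h _ _ N1)[x -> xT]; exists x.
have T3 : T <= T ^+ 3 by rewrite exprS ler_peMr// ?exprn_ege1//; lra.
have := ler_wpM2l C0 T3; lra.
Qed.

Lemma landau_bounded_points (C N0 : R) V (F : int -> int -> int) i j : (i + j = 3)%N -> 0 <= C ->
  (forall N, 1 <= N -> N0 <= N -> let T := Num.sqrt (Num.sqrt N) in
    exists S : set (int * int),
    [/\ forall v, upto V N v -> exists2 p, v = F p.1 p.2 & S p,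
        forall p, S p -> `|p.1%:~R| <= C * T ^+ i &
        forall x, atmost [set y | S (x, y)] (C * T ^+ j)]) ->
  landau_bounded R V.
Proof.
move=> ij C0 h; apply: three_quarters_bounded.
exists ((2 * C + 1) * C), (Num.max 1 N0) => N; rewrite ge_max => /andP[N1 N0N].
have [T1 TN _] := fourth_root_spec N1.
have [S [VS Sx Sy]] := h N N1 N0N; set T := Num.sqrt _ in T1 TN Sx Sy *.
have Ti1 k : 1 <= T ^+ k by exact: exprn_ege1.
have CT0 k : 0 <= C * T ^+ k by rewrite mulr_ge0//; have := Ti1 k; lra.
have hS := atmost_fiber (CT0 j) (atmost_norm_le (CT0 i)) Sx (fun x _ => Sy x).
apply: sub_atmost (atmost_image (f := fun p => F p.1 p.2) hS) _ _.
  by move=> v /VS[p -> Sp]; exists p.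
rewrite -ij exprD !mulrA; apply: ler_wpM2r; first by have := Ti1 j; lra.
rewrite -mulrA [leRHS]mulrAC ler_wpM2r//.
by have := Ti1 i; lra.
Qed.

Lemma quartic_leading_case L k c b30 b21 b12 b03 b20 b11 b02 b10 b01 b00 :
  periodic L k -> 0 < c ->
  let F x y := c * x ^+ 4 + cubic b30 b21 b12 b03 b20 b11 b02 b10 b01 b00 x y in
  (forall x y, L x y -> 0 <= F x y) -> landau_bounded R (values L F).
Proof.
move=> [k0 [x0 [y0 L0]] Lk] c0 F F0.
have Lx x y t : L x y -> L (x + k * t) y.
  by move=> Lxy; have := Lk _ _ t 0 Lxy; rewrite mulr0 addr0.
have Ly x y t : L x y -> L x (y + k * t).
  by move=> Lxy; have := Lk _ _ 0 t Lxy; rewrite mulr0 addr0.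
(* On a vertical line [F] is a cubic in [y] bounded below, so [b03 = 0]; then the coefficient
   [b12 x + b02] of [y ^ 2] is nonnegative along a progression, so [b12 = 0]. *)
have b03E : b03 = 0.
  apply: (@peval_lead_odd k y0 [:: c * x0 ^+ 4 + b30 * x0 ^+ 3 + b20 * x0 ^+ 2 + b10 * x0 + b00;
    b21 * x0 ^+ 2 + b11 * x0 + b01; b12 * x0 + b02]) => // t.
  by have := F0 _ _ (Ly _ _ t L0); congr (_ <= _); rewrite /F /cubic /=; ring.
have yy x y : L x y -> 0 <= b12 * x + b02.
  move=> Lxy; apply: (@peval_lead_ge0 k y [:: c * x ^+ 4 + b30 * x ^+ 3 + b20 * x ^+ 2 + b10 * x + b00;
    b21 * x ^+ 2 + b11 * x + b01]) => // t.
  by have := F0 _ _ (Ly _ _ t Lxy); congr (_ <= _); rewrite /F /cubic b03E /=; ring.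
have b12E : b12 = 0.
  apply: (@peval_lead_odd k x0 [:: b02]) => // t.
  by have := yy _ _ (Lx _ _ t L0); congr (_ <= _); rewrite /=; ring.
have e0 : 0 <= b02 by have := yy _ _ L0; rewrite b12E mul0r add0r.
have [b02E|b02n] := eqVneq b02 0.
  (* [F] is now linear in [y] on vertical lines, so its slope vanishes identically and [F] depends
     on [x] alone. *)
  have lin t : b21 * (x0 + k * t) ^+ 2 + b11 * (x0 + k * t) + b01 = 0.
    set x := x0 + k * t.
    apply: (@peval_lead_odd k y0 [:: c * x ^+ 4 + b30 * x ^+ 3 + b20 * x ^+ 2 + b10 * x + b00]) => // u.
    have := F0 _ _ (Ly _ _ u (Lx _ _ t L0)); congr (_ <= _).
    by rewrite /F /cubic b03E b12E b02E /= -/x; ring.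
  have b21E : b21 = 0.
    apply: (@peval_lead_eq0 k x0 [:: b01; b11]) => // t; rewrite -(lin t) /=; ring.
  have b11E : b11 = 0.
    apply: (@peval_lead_eq0 k x0 [:: b01]) => // t; rewrite -(lin t) b21E /=; ring.
  have b01E : b01 = 0.
    by have := lin 0; rewrite b21E b11E !mul0r !add0r.
  have [K K1 hK] := @peval_even_lower [:: b00; b10; b20; b30] c isT c0.
  have KR : 1 <= K%:~R :> R by rewrite -[1]/(1%:~R) ler_int.
  apply: (@landau_bounded_param (K%:~R + 2) _ (fun x => F x 0)); first by lra.
  move=> N v N1 [[x [y [Lxy vE]]] [v1 vN]].
  have vE' : v = F x 0.
    by rewrite vE /F /cubic b03E b12E b02E b21E b11E b01E; ring.
  exists x => //; have [T1 TN _] := fourth_root_spec N1.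
  set T := Num.sqrt _ in T1 TN *.
  have [Kx|/ltW xK] := leP K `|x|; last first.
    apply: le_trans (_ : K%:~R * T <= _); last by rewrite ler_wpM2r//; lra.
    apply: le_trans (_ : K%:~R <= _); last by rewrite ler_peMr//; lra.
    by rewrite -intr_norm ler_int.
  apply: le_trans (_ : 2 * T <= _); last by rewrite ler_wpM2r//; lra.
  apply: le_fourth_root => //; [lra|lra|].
  rewrite TN -normrX ger0_norm; last by rewrite exprn_even_ge0.
  apply: le_trans (_ : (2 * v)%:~R <= _); last by rewrite rmorphM/= ler_wpM2l.
  rewrite -rmorphXn/= ler_int; apply: le_trans (hK x Kx) _.
  by rewrite vE' le_eqVlt; apply/orP; left; apply/eqP; rewrite /F /cubic /=; ring.
have e1 : 0 < b02 by rewrite lt_neqAle eq_sym b02n.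
pose r4 := 4 * b02 * c - b21 ^+ 2.
pose r3 := 4 * b02 * b30 - 2 * b21 * b11.
pose r2 := 4 * b02 * b20 - b11 ^+ 2 - 2 * b21 * b01.
pose r1 := 4 * b02 * b10 - 2 * b11 * b01.
pose r0 := 4 * b02 * b00 - b01 ^+ 2.
pose Z x y := 2 * b02 * y + (b21 * x ^+ 2 + b11 * x + b01).
have FE x y : 4 * b02 * F x y = Z x y ^+ 2 + peval [:: r0; r1; r2; r3; r4] x.
  by rewrite /F /cubic b03E b12E /Z /= /r0 /r1 /r2 /r3 /r4; ring.
(* Moving [y] by multiples of [k] moves [Z] by multiples of [m = 2 b02 k], so [Z] can be brought
   into [[0, m)]; there [F >= 0] bounds the part in [x] from below. *)
have Rlow x y : L x y -> - (2 * b02 * k) ^+ 2 <= peval [:: r0; r1; r2; r3; r4] x.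
  move=> Lxy; pose m := 2 * b02 * k.
  have m0 : 0 < m by rewrite !mulr_gt0.
  have := F0 _ _ (Ly _ _ (- (Z x y %/ m)%Z) Lxy) => F1.
  have := FE x (y + k * - (Z x y %/ m)%Z).
  have -> : Z x (y + k * - (Z x y %/ m)%Z) = (Z x y %% m)%Z.
    have := divz_eq (Z x y) m; rewrite {1 3}/Z /m => h; rewrite /Z.
    set q := (_ %/ _)%Z in h *; set r := (_ %% _)%Z in h *; lra.
  have r0' := modz_ge0 (Z x y) (lt0r_neq0 m0).
  have rm := ltz_pmod (Z x y) m0.
  move=> E; have : 0 <= 4 * b02 * F x (y + k * - (Z x y %/ m)%Z) by rewrite !mulr_ge0.
  rewrite E -lerBlDl sub0r; apply: le_trans; rewrite lerN2.
  by rewrite ler_pXn2r ?nnegrE ?(ltW m0)// ltW.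
have pos s : (forall t, peval s (x0 + k * t) =
    peval [:: r0; r1; r2; r3; r4] (x0 + k * t) + (2 * b02 * k) ^+ 2) ->
    forall t, 0 <= peval s (x0 + k * t).
  by move=> h t; rewrite h -lerBlDr sub0r; exact: (Rlow _ y0 (Lx _ _ t L0)).
pose r0' := r0 + (2 * b02 * k) ^+ 2.
have r4_ge0 : 0 <= r4.
  apply: (@peval_lead_ge0 k x0 [:: r0'; r1; r2; r3]) => //; apply: pos => t.
  by rewrite /= /r0'; ring.
(* If [r4 > 0] then [x ^ 4 = O(F)] for large [x]: there are [O(T)] columns, with [O(T ^ 2)] points
   in each. *)
have [r4E|r4n] := eqVneq r4 0; last first.
  have r4_gt0 : 0 < r4 by rewrite lt_neqAle eq_sym r4n.
  have [K K1 hK] := @peval_even_lower [:: r0; r1; r2; r3] r4 isT r4_gt0.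
  have KR : 1 <= K%:~R :> R by rewrite -[1]/(1%:~R) ler_int.
  have bR : 1 <= b02%:~R :> R by rewrite -[1]/(1%:~R) ler_int.
  apply: (@landau_bounded_points (K%:~R + 8 * b02%:~R) 1 _ F 1 2) => //; first lra.
  move=> N N1 _ T; have [T1 TN TN2] := fourth_root_spec N1; rewrite -/T in T1 TN TN2.
  have T2 : 1 <= T ^+ 2 by exact: exprn_ege1.
  exists [set p | L p.1 p.2 /\ (F p.1 p.2)%:~R <= N]; split.
  - by move=> v [[x [y [Lxy vE]]] [_ vN]]; exists (x, y) => //=; rewrite -vE.
  - move=> [x y] /= [Lxy FN]; rewrite expr1.
    have [Kx|/ltW xK] := leP K `|x|; last first.
      apply: le_trans (_ : K%:~R * T <= _); last by rewrite ler_wpM2r//; lra.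
      apply: le_trans (_ : K%:~R <= _); last by rewrite ler_peMr//; lra.
      by rewrite -intr_norm ler_int.
    apply: le_trans (_ : (8 * b02%:~R) * T <= _); last by rewrite ler_wpM2r//; lra.
    apply: le_fourth_root => //; [lra|lra|].
    rewrite TN -normrX ger0_norm; last by rewrite exprn_even_ge0.
    apply: le_trans (_ : (8 * b02 * F x y)%:~R <= _).
      rewrite -rmorphXn/= ler_int; apply: le_trans (hK x Kx) _.
      have := FE x y; have := sqr_ge0 (Z x y) => z0 fe.
      have -> : 8 * b02 * F x y = 2 * (4 * b02 * F x y) by ring.
      by rewrite fe; apply: ler_wpM2l => //; rewrite lerDr.
    by rewrite !rmorphM/= ler_wpM2l//; lra.
  - move=> x.
    have q0 : 0 < b02%:~R :> R by lra.
    have N0 : 0 <= N by lra.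
    apply: sub_atmost (@atmost_quadratic R b02%:~R (b21 * x ^+ 2 + b11 * x + b01)%:~R
      (c * x ^+ 4 + b30 * x ^+ 3 + b20 * x ^+ 2 + b10 * x + b00)%:~R N q0 N0) _ _.
      move=> y /= [Lxy FN]; rewrite -rmorphXn -!rmorphM -!rmorphD/=.
      have -> : b02 * y ^+ 2 + (b21 * x ^+ 2 + b11 * x + b01) * y +
        (c * x ^+ 4 + b30 * x ^+ 3 + b20 * x ^+ 2 + b10 * x + b00) = F x y.
        by rewrite /F /cubic b03E b12E; ring.
      by rewrite FN ler0z F0.
    apply: le_trans (_ : 4 * T ^+ 2 <= _); last by rewrite ler_wpM2r//; lra.
    have : Num.sqrt (N / b02%:~R) <= T ^+ 2.
      by rewrite -TN2 ler_wsqrtr// ler_pdivrMr// ler_peMr.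
    lra.
have r3E : r3 = 0.
  apply: (@peval_lead_odd k x0 [:: r0'; r1; r2]) => //; apply: pos => t.
  by rewrite /= /r0' r4E; ring.
have r2_ge0 : 0 <= r2.
  apply: (@peval_lead_ge0 k x0 [:: r0'; r1]) => //; apply: pos => t.
  by rewrite /= /r0' r4E r3E; ring.
have [r2E|r2n] := eqVneq r2 0.
  have r1E : r1 = 0.
    apply: (@peval_lead_odd k x0 [:: r0']) => //; apply: pos => t.
    by rewrite /= /r0' r4E r3E r2E; ring.
  apply: (@landau_bounded_square (4 * b02) (- r0)); first by rewrite mulr_gt0.
  move=> v [x [y [_ ->]]]; exists (Z x y); rewrite FE /= r4E r3E r2E r1E; ring.
have r2_gt0 : 0 < r2 by rewrite lt_neqAle eq_sym r2n.
have D0 : (0 < absz (4 * r2)%R)%N by rewrite absz_gt0 mulf_neq0// gt_eqF.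
(* Multiplying by a further [4 r2] completes the square in [x], and the norm is
   [(2 r2 x + r1)^2 + 4 r2 Z^2]. *)
apply: (@landau_bounded_affine R (16 * b02 * r2) (r1 ^+ 2 - 4 * r2 * r0) _ _ _ _
  (landau_bounded_norm R D0)); first by rewrite !mulr_gt0.
move=> v [x [y [_ ->]]]; exists (2 * r2 * x + r1), (Z x y).
rewrite gez0_abs; last by rewrite mulr_ge0.
have -> : 16 * b02 * r2 * F x y = 4 * r2 * (4 * b02 * F x y) by ring.
rewrite FE /= r4E r3E; ring.
Qed.

End UnivariateCases.

(** * Leading form x^2 (a y^2 + c x^2) *)

Section MixedCase.
Variable R : realType.
Implicit Types (V : set int) (N T : R).

Lemma landau_bounded_setU V W :
  landau_bounded R V -> landau_bounded R W -> landau_bounded R (V `|` W).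
Proof.
move=> [C [N0 hV]] [C' [N0' hW]]; exists (C + C'), (Num.max N0 N0') => N.
rewrite ge_max => /andP[/hV h /hW h'].
apply: sub_atmost (atmostU h h') _ _; last by rewrite mulrDl.
by move=> v [[Vv|Wv] vN]; [left|right].
Qed.

(** Split at [|x| = T]. There are [O(T)] columns below, each with [O(sqrt N) = O(T ^ 2)] points.
    Above, the coefficient of [y ^ 2] is at least [T ^ 2 / 2], so each of the [O(T ^ 2)] columns has
    [O(T)] points. *)
Lemma quadratic_fibers a0 a1 a2 (C0 : R) (L : int -> int -> Prop) (F : int -> int -> int)
    (B G : int -> int) :
  0 < a2 -> 0 <= C0 ->
  (forall x y, L x y -> 1 <= peval [:: a0; a1; a2] x) ->
  (forall x y, L x y -> 0 <= F x y) ->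
  (forall x y, F x y = peval [:: a0; a1; a2] x * y ^+ 2 + B x * y + G x) ->
  (forall N x y, 1 <= N -> L x y -> (F x y)%:~R <= N ->
    `|x%:~R| <= C0 * Num.sqrt (Num.sqrt N) ^+ 2) ->
  landau_bounded R (values L F).
Proof.
move=> a20 C00 LA F0 FE Lx.
have [K K1 hK] := @peval_even_lower [:: a0; a1] a2 isT a20.
apply: three_quarters_bounded; exists (12 + 18 * C0 + 18), (Num.max 1 (K%:~R ^+ 4)) => N.
rewrite ge_max => /andP[N1 NK].
have [T1 TN TN2] := fourth_root_spec N1; set T := Num.sqrt (Num.sqrt N) in T1 TN TN2 *.
have T0 : 0 <= T by lra.
have N0 : 0 <= N by lra.
have KT : K%:~R <= T.
  by rewrite -(@ler_pXn2r _ 4) ?nnegrE// ?TN// ler0z (le_trans _ K1).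
pose S1 : set (int * int) := [set p | [/\ L p.1 p.2, (F p.1 p.2)%:~R <= N & `|p.1%:~R| <= T]].
pose S2 : set (int * int) := [set p | [/\ L p.1 p.2, (F p.1 p.2)%:~R <= N & T < `|p.1%:~R|]].
have fiber x (M : R) : 0 <= M -> 1 <= peval [:: a0; a1; a2] x ->
    N / (peval [:: a0; a1; a2] x)%:~R <= M ^+ 2 ->
    atmost [set y | L x y /\ (F x y)%:~R <= N] (2 * (M + 1)).
  move=> M0 A1 AM.
  have A0 : 0 < (peval [:: a0; a1; a2] x)%:~R :> R by rewrite ltr0z (lt_le_trans _ A1).
  apply: sub_atmost (@atmost_quadratic R _ (B x)%:~R (G x)%:~R N A0 N0) _ _.
    move=> y [Lxy FN]; rewrite /= -rmorphXn -!rmorphM -!rmorphD/= -FE FN.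
    by rewrite ler0z F0.
  rewrite ler_wpM2l// lerD2r; apply: le_trans (ler_wsqrtr AM) _.
  by rewrite sqrtr_sqr ger0_norm.
have h1 : atmost S1 ((2 * T + 1) * (4 * T ^+ 2)).
  apply: atmost_fiber (atmost_norm_le T0) _ _.
  - by rewrite mulr_ge0// exprn_ge0.
  - by move=> p [].
  move=> x xT; have [[y Sxy]|/forallNP noy] := pselect (exists y, S1 (x, y)); last first.
    by move=> [|y s] us sS; [rewrite mulr_ge0// exprn_ge0|case: (noy y); apply: sS; rewrite mem_head].
  have A1 := LA _ _ (let: And3 l _ _ := Sxy in l).
  have A0 : 1 <= (peval [:: a0; a1; a2] x)%:~R :> R by rewrite -[1]/(1%:~R) ler_int.
  apply: sub_atmost (fiber x (T ^+ 2) _ A1 _) _ _.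
  - by rewrite exprn_ge0.
  - by rewrite -exprM TN ler_pdivrMr ?ler_peMr//; lra.
  - by move=> z [].
  have : 1 <= T ^+ 2 by exact: exprn_ege1.
  lra.
have h2 : atmost S2 ((2 * (C0 * T ^+ 2) + 1) * (6 * T)).
  have CT0 : 0 <= C0 * T ^+ 2 by rewrite mulr_ge0// exprn_ge0.
  apply: atmost_fiber (atmost_norm_le CT0) _ _.
  - by rewrite mulr_ge0.
  - by move=> p [Lp FN _]; exact: Lx Lp FN.
  move=> x xT; have [[y Sxy]|/forallNP noy] := pselect (exists y, S2 (x, y)); last first.
    by move=> [|y s] us sS; [rewrite mulr_ge0|case: (noy y); apply: sS; rewrite mem_head].
  have A1 := LA _ _ (let: And3 l _ _ := Sxy in l).
  have xT' : T < `|x%:~R| by case: Sxy.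
  have A0 : 1 <= (peval [:: a0; a1; a2] x)%:~R :> R by rewrite -[1]/(1%:~R) ler_int.
  have Ax : T ^+ 2 <= 2 * (peval [:: a0; a1; a2] x)%:~R.
    have Kx : K <= `|x| by rewrite -(ler_int R) intr_norm (le_trans KT)// ltW.
    rewrite [leRHS](_ : _ = (2 * peval [:: a0; a1; a2] x)%:~R); last by rewrite rmorphM.
    have := hK x Kx; rewrite -(ler_int R); apply: le_trans; rewrite rmorphXn/=.
    by rewrite -(real_normK (num_real x%:~R)) ler_pXn2r ?nnegrE// ltW.
  apply: sub_atmost (fiber x (2 * T) _ A1 _) _ _.
  - by rewrite mulr_ge0.
  - rewrite ler_pdivrMr; last lra.
    rewrite -TN (exprM T 2 2) exprMn.
    have T20 : 0 <= T ^+ 2 by rewrite exprn_ge0.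
    have := ler_wpM2l T20 Ax; rewrite -expr2 => /le_trans; apply.
    have := mulr_ge0 T20 (le_trans ler01 A0); lra.
  - by move=> z [].
  lra.
apply: sub_atmost (atmost_image (f := fun p => F p.1 p.2) (atmostU h1 h2)) _ _.
  move=> v [[x [y [Lxy vE]]] [_ vN]]; exists (x, y) => //.
  have [xT|xT] := leP `|x%:~R| T; [left|right]; split => //=; by rewrite -vE.
have T23 : T ^+ 2 <= T ^+ 3 by rewrite [leRHS]exprSr ler_peMr// exprn_ge0.
have T13 : T <= T ^+ 3 by rewrite [leRHS]exprS ler_peMr// exprn_ege1.
have -> : (2 * T + 1) * (4 * T ^+ 2) + (2 * (C0 * T ^+ 2) + 1) * (6 * T) =
  8 * T ^+ 3 + 4 * T ^+ 2 + 12 * C0 * T ^+ 3 + 6 * T by ring.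
have : 0 <= C0 * T ^+ 3 by rewrite mulr_ge0// exprn_ge0.
have : 0 <= T ^+ 3 by rewrite exprn_ge0.
lra.
Qed.

Lemma quadratic_growth_bound (K S u : R) : 0 <= K -> 1 <= S -> 0 <= u ->
  u ^+ 2 <= K * u + K + S ^+ 2 -> u <= (2 * K + 2) * S.
Proof.
move=> K0 S1 u0 hu; rewrite leNgt; apply/negP => big.
have KS : 0 <= K * (S - 1) by rewrite mulr_ge0//; lra.
have KS' : 0 <= K * S by rewrite mulr_ge0//; lra.
have uK : 2 * K + 2 < u by lra.
have uS : 2 * S < u by lra.
have e1 : (2 * K + 2) * u <= u ^+ 2 by rewrite expr2 ler_wpM2r// ltW.
have e2 : S ^+ 2 <= S * (u / 2) by rewrite expr2 ler_wpM2l//; lra.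
have e3 : S * u <= u / 2 * u by rewrite ler_wpM2r//; lra.
have e4 : 0 <= K * (u - 2) by rewrite mulr_ge0//; lra.
move: hu e1 e2 e3 e4; rewrite !expr2 mulrBr !mulrDl; lra.
Qed.

Lemma mixed_leading_case L k a c b30 b21 b12 b03 b20 b11 b02 b10 b01 b00 :
  periodic L k -> 0 < a -> 0 <= c ->
  let F x y := a * x ^+ 2 * y ^+ 2 + c * x ^+ 4 +
    cubic b30 b21 b12 b03 b20 b11 b02 b10 b01 b00 x y in
  (forall x y, L x y -> 0 <= F x y) -> landau_bounded R (values L F).
Proof.
move=> [k0 [x0 [y0 L0]] Lk] a0 c0 F F0.
have Lx x y t : L x y -> L (x + k * t) y.
  by move=> Lxy; have := Lk _ _ t 0 Lxy; rewrite mulr0 addr0.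
have Ly x y t : L x y -> L x (y + k * t).
  by move=> Lxy; have := Lk _ _ 0 t Lxy; rewrite mulr0 addr0.
have b03E : b03 = 0.
  apply: (@peval_lead_odd k y0 [:: c * x0 ^+ 4 + b30 * x0 ^+ 3 + b20 * x0 ^+ 2 + b10 * x0 + b00;
    b21 * x0 ^+ 2 + b11 * x0 + b01; a * x0 ^+ 2 + b12 * x0 + b02]) => // t.
  by have := F0 _ _ (Ly _ _ t L0); congr (_ <= _); rewrite /F /cubic /=; ring.
pose A := peval [:: b02; b12; a].
pose B := peval [:: b01; b11; b21].
pose G := peval [:: b00; b10; b20; b30; c].
have FE x y : F x y = A x * y ^+ 2 + B x * y + G x.
  by rewrite /F /cubic b03E /A /B /G /=; ring.
have A_ge0 x y : L x y -> 0 <= A x.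
  move=> Lxy; apply: (@peval_lead_ge0 k y [:: G x; B x]) => // t.
  by have := F0 _ _ (Ly _ _ t Lxy); rewrite FE; congr (_ <= _); rewrite /=; ring.
have B_eq0 x y : L x y -> A x = 0 -> B x = 0.
  move=> Lxy Ax0; apply: (@peval_lead_odd k y [:: G x]) => // t.
  by have := F0 _ _ (Ly _ _ t Lxy); rewrite FE Ax0; congr (_ <= _); rewrite /=; ring.
have bounded_root (a1 a2 a3 : int) : 0 < a3 -> exists2 K : R, 0 <= K &
    forall x : int, peval [:: a1; a2; a3] x = 0 -> `|x%:~R| <= K.
  move=> a30; have [T T1 hT] := @peval_even_lower [:: a1; a2] a3 isT a30.
  exists T%:~R => [|x]; first by rewrite ler0z (le_trans _ T1).
  rewrite -intr_norm ler_int => h; rewrite leNgt; apply/negP => /ltW Tx.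
  have := hT x Tx; rewrite h mulr0 /= => x2.
  have x0' : x = 0 by apply/eqP; rewrite -sqrf_eq0 eq_le x2 sqr_ge0.
  by move: (le_trans T1 Tx); rewrite x0' normr0.
have split_values (P : int -> int -> Prop) :
    landau_bounded R (values (fun x y => L x y /\ P x y) F) ->
    landau_bounded R (values (fun x y => L x y /\ ~ P x y) F) ->
    landau_bounded R (values L F).
  move=> h1 h2; apply: landau_bounded_sub (landau_bounded_setU h1 h2).
  move=> v [x [y [Lxy vE]]]; have [Pxy|nPxy] := pselect (P x y).
    by left; exists x, y.
  by right; exists x, y.
(* Where [A x = 0], also [B x = 0], and a column may carry infinitely many points with one common
   value; here values are counted, for boundedly many [x]. *)
apply: (split_values (fun x _ => A x = 0)).
  have [K K0 hK] := bounded_root b02 b12 a a0.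
  apply: (@landau_bounded_param R K _ G) => // N v N1 [[x [y [[Lxy Ax0] ->]]] _].
  exists x; first by rewrite FE Ax0 (B_eq0 _ _ Lxy Ax0); ring.
  have [T1 _ _] := fourth_root_spec N1.
  by rewrite (le_trans (hK x Ax0))// ler_peMr.
have L1 x y : L x y -> A x <> 0 -> 1 <= A x.
  by move=> /A_ge0 + /eqP nA; rewrite le_eqVlt eq_sym (negbTE nA) gtz0_ge1.
have [KA KA0 hKA] := @peval_le [:: b02; b12; a] 2 isT.
have [cE|cn] := eqVneq c 0; last first.
  have c1 : 0 < c by rewrite lt_neqAle eq_sym cn.
  (* Lower coefficients of the sextic [4 A G - B ^ 2], whose leading coefficient is [4 a c]. As
     [4 A F >= 4 A G - B ^ 2] and [A = O(x ^ 2)], this gives [x ^ 4 = O(F)]. *)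
  pose d := [:: 4 * b02 * b00 - b01 ^+ 2;
    4 * (b02 * b10 + b12 * b00) - 2 * b01 * b11;
    4 * (b02 * b20 + b12 * b10 + a * b00) - (b11 ^+ 2 + 2 * b01 * b21);
    4 * (b02 * b30 + b12 * b20 + a * b10) - 2 * b11 * b21;
    4 * (b02 * c + b12 * b30 + a * b20) - b21 ^+ 2;
    4 * (b12 * c + a * b30)].
  have dE x : peval (rcons d (4 * a * c)) x = 4 * A x * G x - B x ^+ 2.
    by rewrite /A /B /G /=; ring.
  have d6 : 0 < 4 * a * c by rewrite !mulr_gt0.
  have [K K1 hK] := @peval_even_lower d _ isT d6.
  have KR : 1 <= K%:~R :> R by rewrite -[1]/(1%:~R) ler_int.
  have KAR : 0 <= KA%:~R :> R by rewrite ler0z.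
  apply: (@quadratic_fibers b02 b12 a (K%:~R + (8 * KA%:~R + 1)) _ _ B G) => //.
  - lra.
  - by move=> x y [Lxy nA]; apply: L1 Lxy nA.
  - by move=> x y [Lxy _]; exact: F0.
  move=> N x y N1 [Lxy nA] FN; have [T1 TN _] := fourth_root_spec N1.
  set T := Num.sqrt (Num.sqrt N) in T1 TN *.
  have T2 : T <= T ^+ 2 by rewrite expr2 ler_peMr//; lra.
  have cT : 0 <= K%:~R + (8 * KA%:~R + 1) :> R by lra.
  apply: le_trans (ler_wpM2l cT T2).
  have [Kx|/ltW xK] := leP K `|x|; last first.
    apply: le_trans (_ : K%:~R * T <= _); last by rewrite ler_wpM2r//; lra.
    apply: le_trans (_ : K%:~R <= _); last by rewrite ler_peMr//; lra.
    by rewrite -intr_norm ler_int.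
  apply: le_trans (_ : (8 * KA%:~R + 1) * T <= _); last by rewrite ler_wpM2r//; lra.
  apply: le_fourth_root => //; [lra|lra|].
  have x1 := le_trans K1 Kx.
  have Ax := hKA `|x| x x1 (lexx _).
  have A1 := L1 _ _ Lxy nA.
  have F1 := F0 _ _ Lxy.
  have x6 : x ^+ 6 <= 8 * (KA * x ^+ 2 * F x y).
    apply: le_trans (hK x Kx) _; rewrite dE.
    have -> : 8 * (KA * x ^+ 2 * F x y) = 2 * (4 * (KA * x ^+ 2) * F x y) by ring.
    rewrite ler_wpM2l//; apply: le_trans (_ : 4 * A x * F x y <= _).
      have -> : 4 * A x * F x y = (2 * A x * y + B x) ^+ 2 + (4 * A x * G x - B x ^+ 2).
        by rewrite FE; ring.
      by rewrite lerDr sqr_ge0.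
    rewrite ler_wpM2r// ler_wpM2l//; apply: le_trans (ler_norm _) _.
    by apply: le_trans Ax _; rewrite -normrX ger0_norm ?sqr_ge0.
  have x4 : x ^+ 4 <= 8 * (KA * F x y).
    have x2 : 0 < x ^+ 2 by rewrite exprn_even_gt0//= -normr_gt0 (lt_le_trans _ x1).
    rewrite -(ler_pM2r x2) -exprD; apply: le_trans x6 _.
    by rewrite le_eqVlt; apply/orP; left; apply/eqP; ring.
  rewrite TN -normrX ger0_norm; last by rewrite exprn_even_ge0.
  rewrite -(ler_int R) rmorphXn !rmorphM/= in x4; apply: le_trans x4 _.
  have := ler_wpM2l KAR FN; lra.
(* With [c = 0], rows behave like columns: [F] is a cubic in [x], hence in fact a quadratic, and the
   rows with [A' y = 0] again carry constant values. *)
have b30E : b30 = 0.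
  apply: (@peval_lead_odd k x0 [:: b02 * y0 ^+ 2 + b01 * y0 + b00;
    b12 * y0 ^+ 2 + b11 * y0 + b10; a * y0 ^+ 2 + b21 * y0 + b20]) => // t.
  by have := F0 _ _ (Lx _ _ t L0); congr (_ <= _); rewrite /F /cubic b03E cE /=; ring.
pose A' := peval [:: b20; b21; a].
pose B' := peval [:: b10; b11; b12].
pose G' := peval [:: b00; b01; b02].
have FE' x y : F x y = A' y * x ^+ 2 + B' y * x + G' y.
  by rewrite /F /cubic b03E b30E cE /A' /B' /G' /=; ring.
have A'_ge0 x y : L x y -> 0 <= A' y.
  move=> Lxy; apply: (@peval_lead_ge0 k x [:: G' y; B' y]) => // t.
  by have := F0 _ _ (Lx _ _ t Lxy); rewrite FE'; congr (_ <= _); rewrite /=; ring.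
have B'_eq0 x y : L x y -> A' y = 0 -> B' y = 0.
  move=> Lxy Ax0; apply: (@peval_lead_odd k x [:: G' y]) => // t.
  by have := F0 _ _ (Lx _ _ t Lxy); rewrite FE' Ax0; congr (_ <= _); rewrite /=; ring.
apply: landau_bounded_sub (landau_bounded_setU
  (_ : landau_bounded R (values (fun x y => L x y /\ A' y = 0) F))
  (_ : landau_bounded R (values (fun x y => [/\ L x y, A x <> 0 & A' y <> 0]) F))).
- move=> v [x [y [[Lxy nA] vE]]]; have [Ay|nAy] := pselect (A' y = 0).
    by left; exists x, y.
  by right; exists x, y.
- have [K K0 hK] := bounded_root b20 b21 a a0.
  apply: (@landau_bounded_param R K _ G') => // N v N1 [[x [y [[Lxy Ax0] ->]]] _].
  exists y; first by rewrite FE' Ax0 (B'_eq0 _ _ Lxy Ax0); ring.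
  have [T1 _ _] := fourth_root_spec N1.
  by rewrite (le_trans (hK y Ax0))// ler_peMr.
have [K1 K10 hK1] := @quadratic_dominates b20 b21 a [:: b10; b11; b12] a0 isT.
have [K2 K20 hK2] := @quadratic_dominates b20 b21 a [:: b00; b01; b02] a0 isT.
pose K : R := K1%:~R + K2%:~R.
have K1R : 0 <= K1%:~R :> R by rewrite ler0z.
have K2R : 0 <= K2%:~R :> R by rewrite ler0z.
have K0 : 0 <= K by rewrite addr_ge0.
apply: (@quadratic_fibers b02 b12 a (2 * K + 2) _ _ B G) => //.
- lra.
- by move=> x y [Lxy nA _]; apply: L1 Lxy nA.
- by move=> x y [Lxy _ _]; exact: F0.
move=> N x y N1 [Lxy nA nA'] FN; have [T1 TN _] := fourth_root_spec N1.
set T := Num.sqrt (Num.sqrt N) in T1 TN *.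
have A'1 : 1 <= A' y.
  by have /eqP nA'' := nA'; have := A'_ge0 _ _ Lxy; rewrite le_eqVlt eq_sym (negbTE nA'') gtz0_ge1.
have h1 := hK1 y A'1; have h2 := hK2 y A'1.
rewrite -/(A' y) -/(B' y) -/(G' y) in h1 h2.
(* [A'] dominates [B'] and [G']. Since [A' y >= 1], [x ^ 2] is at most [N] up to a linear term, that
   is, [x = O(T ^ 2)], as [quadratic_fibers] requires. *)
have hx : (`|x| ^+ 2 - K1 * `|x| - K2) * A' y <= F x y.
  rewrite FE'; have -> : (`|x| ^+ 2 - K1 * `|x| - K2) * A' y =
    A' y * x ^+ 2 + - (K1 * A' y * `|x|) + - (K2 * A' y).
    by rewrite -normrX ger0_norm ?sqr_ge0//; ring.
  apply: lerD; last by rewrite lerNl (le_trans _ h2)// -[leRHS]normrN; exact: ler_norm.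
  rewrite lerD2l lerNl (le_trans (_ : _ <= `|B' y| * `|x|))//; last by rewrite ler_wpM2r.
  by rewrite -normrM -[leRHS]normrN; exact: ler_norm.
pose u : R := `|x%:~R|.
have hu : u ^+ 2 <= K * u + K + T ^+ 4.
  have u0 : 0 <= u by exact: normr_ge0.
  have [neg|pos] := leP (`|x| ^+ 2 - K1 * `|x| - K2) 0.
    move: neg; rewrite -(ler_int R) !rmorphB rmorphXn rmorphM/= intr_norm -/u => neg.
    have T4 : 0 <= T ^+ 4 by rewrite exprn_ge0//; lra.
    have := mulr_ge0 K2R u0; rewrite /K mulrDl; lra.
  have := le_trans (_ : _ <= (`|x| ^+ 2 - K1 * `|x| - K2) * A' y) hx.
  move=> /(_ (`|x| ^+ 2 - K1 * `|x| - K2)); rewrite ler_peMr// => [/(_ isT)|]; last exact: ltW.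
  rewrite -(ler_int R) !rmorphB rmorphXn rmorphM/= intr_norm -/u TN => h.
  have := mulr_ge0 K2R u0; rewrite /K mulrDl; lra.
rewrite -/u; apply: quadratic_growth_bound => //.
- exact: exprn_ege1.
- exact: normr_ge0.
- by rewrite -exprM.
Qed.

End MixedCase.

(** * Definite leading form *)

Section LeadingForm.
Import numFieldNormedType.Exports.
Variable R : realType.
Implicit Types (N T : R).

Lemma quartic_shift c4 c3 c2 c1 c0 x0 y0 x y :
  quartic c4 c3 c2 c1 c0 (x0 + x) (y0 + y) = quartic c4 c3 c2 c1 c0 x y +
  cubic (4 * c4 * x0 + c3 * y0) (3 * c3 * x0 + 2 * c2 * y0)
    (2 * c2 * x0 + 3 * c1 * y0) (c1 * x0 + 4 * c0 * y0)
    (6 * c4 * x0 ^+ 2 + 3 * c3 * x0 * y0 + c2 * y0 ^+ 2)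
    (3 * c3 * x0 ^+ 2 + 4 * c2 * x0 * y0 + 3 * c1 * y0 ^+ 2)
    (c2 * x0 ^+ 2 + 3 * c1 * x0 * y0 + 6 * c0 * y0 ^+ 2)
    (4 * c4 * x0 ^+ 3 + 3 * c3 * x0 ^+ 2 * y0 + 2 * c2 * x0 * y0 ^+ 2 + c1 * y0 ^+ 3)
    (c3 * x0 ^+ 3 + 2 * c2 * x0 ^+ 2 * y0 + 3 * c1 * x0 * y0 ^+ 2 + 4 * c0 * y0 ^+ 3)
    (quartic c4 c3 c2 c1 c0 x0 y0) x y.
Proof. by rewrite /quartic /cubic; ring. Qed.

Lemma cubic_shift b30 b21 b12 b03 b20 b11 b02 b10 b01 b00 x0 y0 :
  exists d30 d21 d12 d03 d20 d11 d02 d10 d01 d00, forall x y,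
  cubic b30 b21 b12 b03 b20 b11 b02 b10 b01 b00 (x0 + x) (y0 + y) =
  cubic d30 d21 d12 d03 d20 d11 d02 d10 d01 d00 x y.
Proof.
exists b30, b21, b12, b03,
  (3 * b30 * x0 + b21 * y0 + b20), (2 * b21 * x0 + 2 * b12 * y0 + b11),
  (b12 * x0 + 3 * b03 * y0 + b02),
  (3 * b30 * x0 ^+ 2 + 2 * b21 * x0 * y0 + b12 * y0 ^+ 2 + 2 * b20 * x0 + b11 * y0 + b10),
  (b21 * x0 ^+ 2 + 2 * b12 * x0 * y0 + 3 * b03 * y0 ^+ 2 + b11 * x0 + 2 * b02 * y0 + b01),
  (cubic b30 b21 b12 b03 b20 b11 b02 b10 b01 b00 x0 y0).
by move=> x y; rewrite /cubic; ring.
Qed.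

(** Along the ray from a point of [L] in direction [(x, y)], the polynomial in the parameter has the
    form's value at [(x, y)] as its coefficient of degree 4. *)
Lemma leading_form_ge0 L k c4 c3 c2 c1 c0 b30 b21 b12 b03 b20 b11 b02 b10 b01 b00 :
  periodic L k ->
  (forall x y, L x y -> 0 <= quartic c4 c3 c2 c1 c0 x y +
    cubic b30 b21 b12 b03 b20 b11 b02 b10 b01 b00 x y) ->
  forall x y, 0 <= quartic c4 c3 c2 c1 c0 x y.
Proof.
move=> [k0 [x0 [y0 L0]] Lk] F0 x y.
have [d30 [d21 [d12 [d03 [d20 [d11 [d02 [d10 [d01 [d00 dE]]]]]]]]]] :=
  cubic_shift b30 b21 b12 b03 b20 b11 b02 b10 b01 b00 x0 y0.
have := quartic_shift c4 c3 c2 c1 c0 x0 y0.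
move: (4 * c4 * x0 + _) (3 * c3 * x0 + _) (2 * c2 * x0 + _) (c1 * x0 + _)
  (6 * c4 * x0 ^+ 2 + _ + _) (3 * c3 * x0 ^+ 2 + _ + _) (c2 * x0 ^+ 2 + _ + _)
  (4 * c4 * x0 ^+ 3 + _ + _ + _) (c3 * x0 ^+ 3 + _ + _ + _) (quartic _ _ _ _ _ _ _).
move=> f30 f21 f12 f03 f20 f11 f02 f10 f01 f00 fE.
apply: (@peval_lead_ge0 k 0 [:: f00 + d00; (f10 + d10) * x + (f01 + d01) * y;
  (f20 + d20) * x ^+ 2 + (f11 + d11) * x * y + (f02 + d02) * y ^+ 2;
  (f30 + d30) * x ^+ 3 + (f21 + d21) * x ^+ 2 * y + (f12 + d12) * x * y ^+ 2 + (f03 + d03) * y ^+ 3]).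
  exact: k0.
move=> t; have := F0 _ _ (Lk _ _ (t * x) (t * y) L0).
rewrite fE dE; congr (_ <= _); rewrite /quartic /cubic /=; ring.
Qed.

Definition real_quartic (c4 c3 c2 c1 c0 : int) (X Y : R) : R :=
  c4%:~R * X ^+ 4 + c3%:~R * X ^+ 3 * Y + c2%:~R * X ^+ 2 * Y ^+ 2 +
  c1%:~R * X * Y ^+ 3 + c0%:~R * Y ^+ 4.

Lemma real_quarticE c4 c3 c2 c1 c0 (x y : int) :
  real_quartic c4 c3 c2 c1 c0 x%:~R y%:~R = (quartic c4 c3 c2 c1 c0 x y)%:~R.
Proof. by rewrite /real_quartic /quartic !(rmorphD, rmorphM, rmorphXn). Qed.

Lemma quartic_min c4 c3 c2 c1 c0 :
  (forall t : R, real_quartic c4 c3 c2 c1 c0 t 1 != 0) ->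
  exists2 e : R, 0 < e & forall t, -1 <= t <= 1 -> e <= `|real_quartic c4 c3 c2 c1 c0 t 1|.
Proof.
move=> nz; pose p : {poly R} := Poly [:: c0%:~R; c1%:~R; c2%:~R; c3%:~R; c4%:~R].
have pE t : p.[t] = real_quartic c4 c3 c2 c1 c0 t 1.
  by rewrite /p horner_Poly /= /real_quartic; ring.
have [||t _ tP] := @EVT_min R (fun t => `|p.[t]|) (-1) 1; first by lra.
  apply: continuous_subspaceT => t; apply: continuous_comp; first exact: continuous_horner.
  exact: norm_continuous.
exists `|p.[t]|; first by rewrite normr_gt0 pE nz.
by move=> u u1; rewrite -pE; apply: tP; rewrite in_itv.
Qed.

(** By homogeneity it suffices to bound the form on the sides of the unit square, through the charts
    [X / Y] and [Y / X]. The condition [c4 != 0] excludes a zero in the direction [Y = 0], which the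
    first chart misses. *)
Lemma definite_lower_bound c4 c3 c2 c1 c0 : c4 != 0 ->
  (forall t : R, real_quartic c4 c3 c2 c1 c0 t 1 != 0) ->
  exists2 e : R, 0 < e & forall X Y M : R, (`|X| = M /\ `|Y| <= M) \/ (`|Y| = M /\ `|X| <= M) ->
    e * M ^+ 4 <= `|real_quartic c4 c3 c2 c1 c0 X Y|.
Proof.
move=> c40 nz; have [e1 e10 h1] := quartic_min nz.
have hom (X Y : R) : Y != 0 ->
    real_quartic c4 c3 c2 c1 c0 X Y = Y ^+ 4 * real_quartic c4 c3 c2 c1 c0 (X / Y) 1.
  by move=> Y0; rewrite /real_quartic; field.
have sym (X Y : R) : real_quartic c4 c3 c2 c1 c0 X Y = real_quartic c0 c1 c2 c3 c4 Y X.
  by rewrite /real_quartic; ring.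
have nz' (t : R) : real_quartic c0 c1 c2 c3 c4 t 1 != 0.
  rewrite -sym; have [->|t0] := eqVneq t 0.
    by rewrite /real_quartic !expr0n/= !mulr0 !addr0 expr1n mulr1 intr_eq0.
  by rewrite hom// mulf_neq0// expf_neq0.
have [e2 e20 h2] := quartic_min nz'.
exists (Num.min e1 e2); first by rewrite lt_min e10.
have h' (X Y M : R) (d4 d3 d2 d1 d0 : int) (e : R) : 0 < e ->
    (forall t, -1 <= t <= 1 -> e <= `|real_quartic d4 d3 d2 d1 d0 t 1|) ->
    `|Y| = M -> `|X| <= M -> e * M ^+ 4 <= `|real_quartic d4 d3 d2 d1 d0 X Y|.
  move=> e0 h YM XM; have [Y0|Y0] := eqVneq Y 0.
    by rewrite -YM Y0 normr0 expr0n mulr0.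
  have -> : real_quartic d4 d3 d2 d1 d0 X Y = Y ^+ 4 * real_quartic d4 d3 d2 d1 d0 (X / Y) 1.
    by rewrite /real_quartic; field.
  rewrite normrM mulrC normrX YM ler_wpM2l ?exprn_ge0 -?YM//.
  apply: h; rewrite -ler_norml normrM normfV YM ler_pdivrMr ?mul1r//.
  by rewrite -YM normr_gt0.
move=> X Y M [[XM YM]|[YM XM]].
  rewrite sym; apply: le_trans (h' Y X M _ _ _ _ _ _ e20 h2 XM YM).
  by rewrite ler_wpM2r ?ge_min ?lexx ?orbT// exprn_ge0// -XM.
apply: le_trans (h' X Y M _ _ _ _ _ _ e10 h1 YM XM).
by rewrite ler_wpM2r ?ge_min ?lexx// exprn_ge0// -YM.
Qed.

Lemma cubic_le b30 b21 b12 b03 b20 b11 b02 b10 b01 b00 : exists2 K : R, 0 <= K &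
  forall (x y : int) (M : R), 1 <= M -> `|x%:~R| <= M -> `|y%:~R| <= M ->
  `|(cubic b30 b21 b12 b03 b20 b11 b02 b10 b01 b00 x y)%:~R| <= K * M ^+ 3.
Proof.
pose K : R := \sum_(b <- [:: b30; b21; b12; b03; b20; b11; b02; b10; b01; b00]) `|b%:~R|.
exists K; first exact: sumr_ge0.
move=> x y M M1 xM yM.
have mon (b : int) i j : (i + j <= 3)%N -> `|b%:~R * x%:~R ^+ i * y%:~R ^+ j| <= `|b%:~R| * M ^+ 3 :> R.
  move=> ij; rewrite !normrM -mulrA ler_wpM2l// !normrX.
  apply: le_trans (_ : M ^+ i * M ^+ j <= _).
    have M0 : 0 <= M by lra.
    by rewrite ler_pM ?exprn_ge0// lerXn2r ?nnegrE.
  by rewrite -exprD ler_weXn2l.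
rewrite /cubic !(rmorphD, rmorphM, rmorphXn)/= /K !big_cons big_nil addr0 !mulrDl !addrA.
have m30 := mon b30 3%N 0%N isT; have m21 := mon b21 2%N 1%N isT.
have m12 := mon b12 1%N 2%N isT; have m03 := mon b03 0%N 3%N isT.
have m20 := mon b20 2%N 0%N isT; have m11 := mon b11 1%N 1%N isT.
have m02 := mon b02 0%N 2%N isT; have m10 := mon b10 1%N 0%N isT.
have m01 := mon b01 0%N 1%N isT; have m00 := mon b00 0%N 0%N isT.
rewrite ?expr0 ?expr1 ?mulr1 in m30 m21 m12 m03 m20 m11 m02 m10 m01 m00.
by do ! apply: le_trans (ler_normD _ _) (lerD _ _).
Qed.

Lemma definite_case L c4 c3 c2 c1 c0 b30 b21 b12 b03 b20 b11 b02 b10 b01 b00 :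
  c4 != 0 -> (forall t : R, real_quartic c4 c3 c2 c1 c0 t 1 != 0) ->
  (forall x y, 0 <= quartic c4 c3 c2 c1 c0 x y) ->
  landau_bounded R (values L (fun x y => quartic c4 c3 c2 c1 c0 x y +
    cubic b30 b21 b12 b03 b20 b11 b02 b10 b01 b00 x y)).
Proof.
move=> c40 nz h0; have [e e0 he] := definite_lower_bound c40 nz.
have [K K0 hK] := cubic_le b30 b21 b12 b03 b20 b11 b02 b10 b01 b00.
set F := fun x y => _.
(* Beyond [M = 2 K / e] the cubic part is at most half of [e M ^ 4], so [M ^ 4 <= (2 / e) N]; the
   summand [1 + 2 K / e] covers smaller [M]. *)
pose C := 1 + 2 * K / e + 2 / e.
have Ke : 0 <= 2 * K / e by rewrite !mulr_ge0// invr_ge0 ltW.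
have e2 : 0 <= 2 / e by rewrite divr_ge0// ltW.
have C1 : 1 <= C by rewrite /C; lra.
have bound N (x y : int) (M : R) : 1 <= N -> (F x y)%:~R <= N ->
    (`|x%:~R| = M /\ `|y%:~R| <= M) \/ (`|y%:~R| = M /\ `|x%:~R| <= M) ->
    M <= C * Num.sqrt (Num.sqrt N).
  move=> N1 FN MP; have [T1 TN _] := fourth_root_spec N1; set T := Num.sqrt _ in T1 TN *.
  have M0 : 0 <= M by case: MP => [[<-]|[<-]].
  have CT : C <= C * T by rewrite ler_peMr//; lra.
  have [MC|CM] := leP M (1 + 2 * K / e); first by apply: le_trans CT; rewrite /C; lra.
  have M1 : 1 <= M by lra.
  have xM : `|x%:~R| <= M by case: MP => [[<-]|[_]].
  have yM : `|y%:~R| <= M by case: MP => [[_]|[<-]].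
  have hg := hK x y M M1 xM yM.
  have hh := he _ _ _ MP; rewrite real_quarticE ger0_norm ?ler0z ?h0// in hh.
  have M3 : 0 <= M ^+ 3 by exact: exprn_ge0.
  have KM : K <= e / 2 * M.
    rewrite -ler_pdivrMl ?divr_gt0// invf_div; lra.
  have hg' : K * M ^+ 3 <= e / 2 * M ^+ 4.
    by rewrite [M ^+ 4]exprS mulrA ler_wpM2r.
  have FE : (F x y)%:~R = (quartic c4 c3 c2 c1 c0 x y)%:~R +
      (cubic b30 b21 b12 b03 b20 b11 b02 b10 b01 b00 x y)%:~R :> R by rewrite /F rmorphD.
  have lb : e / 2 * M ^+ 4 <= N.
    have := ler_norm (- (cubic b30 b21 b12 b03 b20 b11 b02 b10 b01 b00 x y)%:~R : R).
    by rewrite normrN; lra.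
  apply: le_fourth_root => //; first lra.
  apply: le_trans (_ : 2 / e * T ^+ 4 <= _); last first.
    by apply: ler_wpM2r; [apply: exprn_ge0; lra|rewrite /C; lra].
  rewrite TN; have := ler_wpM2l e2 lb.
  have en : e != 0 by rewrite gt_eqF.
  by have -> : 2 / e * (e / 2 * M ^+ 4) = M ^+ 4 by field.
apply: (@landau_bounded_points R (2 * C + 1) 1 _ F 1 2) => //; first lra.
move=> N N1 _ T; have [T1 TN TN2] := fourth_root_spec N1; rewrite -/T in T1 TN TN2.
have T0 : 0 <= T by lra.
have CT0 : 0 <= C * T by rewrite mulr_ge0//; lra.
have both x y : (F x y)%:~R <= N -> `|x%:~R| <= C * T /\ `|y%:~R| <= C * T.
  move=> FN; have [xy|/ltW yx] := leP (`|x%:~R| : R) `|y%:~R|.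
    have h := bound N x y _ N1 FN (or_intror (conj erefl xy)).
    by split => //; apply: le_trans xy _.
  have h := bound N x y _ N1 FN (or_introl (conj erefl yx)).
  by split => //; apply: le_trans yx _.
exists [set p | (F p.1 p.2)%:~R <= N]; split.
- by move=> v [[x [y [Lxy vE]]] [_ vN]]; exists (x, y) => //=; rewrite -vE.
- move=> [x y] /= FN; rewrite expr1; apply: le_trans (both _ _ FN).1 _.
  by rewrite ler_wpM2r//; lra.
- move=> x; apply: sub_atmost (atmost_norm_le CT0) _ _.
    by move=> y /= FN; exact: (both _ _ FN).2.
  have : T <= T ^+ 2 by rewrite expr2 ler_peMr.
  have T2 : 1 <= T ^+ 2 by exact: exprn_ege1.
  have C0 : 0 <= C by lra.
  move=> /(ler_wpM2l C0); lra.
Qed.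

End LeadingForm.

(** * Inhomogeneous Diophantine approximation *)

Section Approximation.
Variable R : realType.
Variable al : R.
Hypothesis al_irr : forall p q : int, q%:~R * al = p%:~R -> q = 0.

Lemma dirichlet_approx n : (0 < n)%N -> exists (X : int) (Y : nat),
  [/\ (0 < Y)%N, (Y <= n)%N & `|Y%:R * al - X%:~R| < n%:R^-1].
Proof.
case: n => // m _; set n := m.+1.
have nR : 0 < n%:R :> R by rewrite ltr0n.
pose fl (i : nat) : int := Num.floor (i%:R * al).
pose fr (i : nat) : R := i%:R * al - (fl i)%:~R.
have fr01 i : 0 <= fr i < 1.
  by have := floor_itv (i%:R * al); rewrite rmorphD/= -/(fl i) /fr; lra.
pose bin (i : 'I_n.+1) : 'I_n := inord (Num.truncn (n%:R * fr i)).
have binE (i : 'I_n.+1) : (bin i)%:R <= n%:R * fr i < (bin i)%:R + 1.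
  have /andP[f0 f1] := fr01 i.
  have nf0 : 0 <= n%:R * fr i by rewrite mulr_ge0.
  have := truncn_itv nf0; rewrite -natr1 /bin inordK//.
  by rewrite -/n truncn_lt_nat// gtr_pMr.
have /injectivePn[i [j ij bij]] : ~~ injectiveb bin.
  apply/negP => /injectiveP/leq_card; rewrite !card_ord; lia.
wlog lt_ij : i j ij bij / (i < j)%N.
  move=> H; have := ij; rewrite neq_ltn => /orP[lij|lji]; first exact: (H i j).
  by apply: (H j i) => //; rewrite eq_sym.
exists (fl j - fl i), (j - i)%N; split.
- by rewrite subn_gt0.
- by rewrite (leq_trans (leq_subr _ _))// -ltnS.
have -> : (j - i)%N%:R * al - (fl j - fl i)%:~R = fr j - fr i.
  by rewrite natrB 1?ltnW// rmorphB /fr /=; ring.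
have := binE i; have := binE j; rewrite bij => /andP[a b] /andP[c d].
rewrite -(ltr_pM2l nR) divff ?gt_eqF// -[n%:R in X in X < _](gtr0_norm nR) -normrM mulrBr.
rewrite ltr_norml; lra.
Qed.

Lemma dist_gt0 (Y : nat) : (0 < Y)%N ->
  exists2 d : R, 0 < d & forall X : int, d <= `|Y%:R * al - X%:~R|.
Proof.
move=> Y0; set t := Y%:R * al.
have /andP[f0 f1] := floor_itv t; rewrite rmorphD/= in f1.
have fn : (Num.floor t)%:~R != t.
  apply/eqP => e; have := @al_irr (Num.floor t) Y%:Z.
  by rewrite e /t pmulrn => /(_ erefl) /eqP; rewrite eqz_nat; case: (Y) Y0.
have f0' : (Num.floor t)%:~R < t by rewrite lt_neqAle fn.
exists (Num.min (t - (Num.floor t)%:~R) ((Num.floor t)%:~R + 1 - t)).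
  by rewrite lt_min; apply/andP; split; lra.
move=> X; rewrite ge_min; apply/orP.
have [Xf|fX] := leP X (Num.floor t); [left|right].
  have : X%:~R <= (Num.floor t)%:~R :> R by rewrite ler_int.
  by have := ler_norm (t - X%:~R); lra.
have : (Num.floor t + 1)%:~R <= X%:~R :> R by rewrite ler_int lezD1.
by rewrite rmorphD/=; have := ler_norm (- (t - X%:~R)); rewrite normrN; lra.
Qed.

(** Reducing a Dirichlet fraction could make its denominator small. But denominators up to [M] keep
    a distance [d > 0] from integers, and an accuracy [1 / n < d] rules them out. *)
Lemma coprime_approx M : exists (X : int) (Y : nat),
  [/\ (M < Y)%N, coprimez X Y%:Z & `|Y%:R * al - X%:~R| < Y%:R^-1].
Proof.
have [d d0 hd] : exists2 d : R, 0 < d &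
    forall (Y : nat) (X : int), (0 < Y <= M)%N -> d <= `|Y%:R * al - X%:~R|.
  elim: M => [|M [d d0 IH]]; first by exists 1 => // -[|Y].
  have [d' d'0 hd'] := dist_gt0 (ltn0Sn M).
  exists (Num.min d d') => [|Y X /andP[Y0]]; first by rewrite lt_min d0.
  rewrite leq_eqVlt => /orP[/eqP ->|YM]; first by rewrite ge_min hd' orbT.
  by rewrite ge_min IH// Y0.
pose n := (Num.truncn d^-1).+1.
have nd : n%:R^-1 < d.
  by rewrite invf_plt ?posrE ?ltr0n// truncnS_gt.
have [X [Y [Y0 Yn h]]] := dirichlet_approx (ltn0Sn _ : (0 < n)%N).
pose g := gcdn (absz X) Y.
have g0 : (0 < g)%N by rewrite gcdn_gt0 Y0 orbT.
have /dvdzP[X' XE] : (g%:Z %| X)%Z by rewrite dvdzE dvdn_gcdl.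
have /dvdnP[Y' YE] : (g %| Y)%N by rewrite dvdn_gcdr.
have gR : 0 < g%:R :> R by rewrite ltr0n.
have e : Y%:R * al - X%:~R = g%:R * (Y'%:R * al - X'%:~R).
  by rewrite XE {1}YE natrM rmorphM/= -pmulrn; ring.
have Y'0 : (0 < Y')%N by move: Y0; rewrite YE muln_gt0 => /andP[].
have h' : `|Y'%:R * al - X'%:~R| < n%:R^-1.
  apply: le_lt_trans h; rewrite e normrM (gtr0_norm gR) ler_peMl//.
  by rewrite ler1n.
have Y'n : (Y' <= n)%N.
  by apply: leq_trans Yn; rewrite YE leq_pmulr.
exists X', Y'; split.
- rewrite ltnNge; apply/negP => Y'M.
  have := hd Y' X'; rewrite Y'0 Y'M => /(_ isT); lra.
- rewrite coprimezE /coprime -(eqn_pmul2r g0) mul1n muln_gcdl; apply/eqP.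
  by rewrite /= -YE -[g in (absz X' * g)%N]/(absz g%:Z) -abszM -XE.
by apply: lt_le_trans h' _; rewrite lef_pV2 ?posrE ?ltr0n// ler_nat.
Qed.

(** Take [X / Y] close to [al], [p = floor (be Y)], and solve [x Y = p + y X] with [Y <= y < 2 Y].
    Replacing [al] by [X / Y] costs at most [2 / Y], the floor at most [1 / Y], and
    [3 / Y <= 6 / y]. *)
Lemma inhomogeneous_approx (be : R) (M : nat) : exists x y : int,
  M%:Z <= y /\ `|x%:~R - al * y%:~R - be| <= 6 / y%:~R.
Proof.
have [X [Y [MY cXY hY]]] := coprime_approx M.
have Y0 : (0 < Y)%N by exact: leq_ltn_trans MY.
have YR : 0 < Y%:R :> R by rewrite ltr0n.
have [u [v uv]] : exists u v : int, u * X + v * Y%:Z = 1.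
  have [u [v uv]] := Bezoutz X Y%:Z; exists u, v.
  by rewrite uv; move: cXY => /eqP ->.
pose p := Num.floor (be * Y%:R).
pose r := ((- p * u) %% Y%:Z)%Z.
pose y := Y%:Z + r.
have Yn0 : Y%:Z != 0 by rewrite eqz_nat -lt0n.
have r0 : 0 <= r by exact: modz_ge0.
have rY : r < Y%:Z by rewrite ltz_pmod.
have [x xE] : exists x : int, x * Y%:Z = p + y * X.
  have /dvdzP[x xE] : (Y%:Z %| p + y * X)%Z; last by exists x; rewrite xE.
  have re := divz_eq (- p * u) Y%:Z; rewrite -/r in re.
  have -> : p + y * X = (p * v + X - ((- p * u) %/ Y%:Z)%Z * X) * Y%:Z.
    rewrite /y; have -> : r = - p * u - ((- p * u) %/ Y%:Z)%Z * Y%:Z by rewrite {1}re; ring.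
    have pE : p = p * (u * X + v * Y%:Z) by rewrite uv mulr1.
    rewrite {1}pE; ring.
  exact: dvdz_mull.
have yY : Y%:R <= y%:~R :> R by rewrite pmulrn ler_int /y lerDl.
have y2Y : y%:~R <= 2 * Y%:R :> R.
  by rewrite /y rmorphD/= -pmulrn mulrDl !mul1r lerD2l pmulrn ler_int ltW.
have y0 : 0 < y%:~R :> R by lra.
exists x, y; split.
  by rewrite /y (le_trans (_ : _ <= Y%:Z))// ?lerDl// lez_nat ltnW.
have /andP[p0 p1] := floor_itv (be * Y%:R); rewrite -/p rmorphD/= in p0 p1.
have xER : x%:~R = (p%:~R + y%:~R * X%:~R) / Y%:R :> R.
  apply/eqP; rewrite eq_sym; apply/eqP; apply: (canLR (mulfK (lt0r_neq0 YR))).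
  by rewrite pmulrn -!rmorphM -rmorphD/= xE.
have dE : x%:~R - al * y%:~R - be =
    (- (y%:~R * (Y%:R * al - X%:~R)) + (p%:~R - be * Y%:R)) / Y%:R.
  by rewrite xER; field; rewrite gt_eqF.
rewrite dE normrM normfV (gtr0_norm YR).
apply: le_trans (_ : 3 / Y%:R <= _).
  apply: ler_wpM2r; first by rewrite invr_ge0 ltW.
  apply: le_trans (ler_normD _ _) _.
  have h1 : `|p%:~R - be * Y%:R| <= 1 by rewrite ler_norml; lra.
  have h2 : `|- (y%:~R * (Y%:R * al - X%:~R))| <= 2.
    rewrite normrN normrM (gtr0_norm y0).
    apply: le_trans (_ : 2 * Y%:R * Y%:R^-1 <= _).
      by rewrite ler_pM// ltW.
    by rewrite mulfK// gt_eqF.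
  lra.
rewrite ler_pdivrMr// mulrAC ler_pdivlMr//; lra.
Qed.

End Approximation.

(** * Leading form a (x^2 - D y^2)^2 *)

Section BoundedSequences.
Variable R : realType.
Implicit Types f g : nat -> R.

Definition bdd f := exists K : R, forall n, `|f n| <= K.

Lemma bddC (c : R) : bdd (fun=> c).
Proof. by exists `|c|. Qed.

Lemma bddD f g : bdd f -> bdd g -> bdd (fun n => f n + g n).
Proof.
move=> [K hK] [K' hK']; exists (K + K') => n.
by apply: le_trans (ler_normD _ _) _; rewrite lerD.
Qed.

Lemma bddM f g : bdd f -> bdd g -> bdd (fun n => f n * g n).
Proof.
move=> [K hK] [K' hK']; exists (K * K') => n.
by rewrite normrM ler_pM.
Qed.

Lemma bddX f k : bdd f -> bdd (fun n => f n ^+ k).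
Proof.
move=> [K hK]; exists (K ^+ k) => n.
by rewrite normrX lerXn2r ?nnegrE// (le_trans _ (hK n)).
Qed.

Lemma linear_sign (A : R) (s r : nat -> R) : (forall n, n%:R <= s n) ->
  bdd r -> (forall n, 0 <= A * s n + r n) -> 0 <= A.
Proof.
move=> hs [K hK] pos; rewrite leNgt; apply/negP => A0.
pose n := (Num.truncn (K / - A)).+1.
have h := pos n; have := hK n; have := hs n => sn rn.
have : K < - A * n%:R.
  rewrite mulrC -ltr_pdivrMr; last lra.
  exact: truncnS_gt.
have : - A * n%:R <= - A * s n by rewrite ler_wpM2l//; lra.
have := ler_norm (r n); lra.
Qed.

(** Points of [L] within [O(1 / y)] of the line [x = al y + be]: the base point and the step [k] of
    [L] are absorbed into the shift [be']. *)
Lemma approx_seq (L : int -> int -> Prop) k (al be : R) : periodic L k ->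
  (forall p q : int, q%:~R * al = p%:~R -> q = 0) ->
  exists x y : nat -> int, [/\ forall n, L (x n) (y n),
    forall n, (n.+1)%:Z <= y n &
    bdd (fun n => (y n)%:~R * ((x n)%:~R - al * (y n)%:~R - be))].
Proof.
move=> [k0 [x0 [y0 L0]] Lk] irr.
have kR : 1 <= k%:~R :> R by rewrite -[1]/(1%:~R) ler_int.
pose be' := (be - x0%:~R + al * y0%:~R) / k%:~R.
have /choice[p hp] : forall n, exists p : int * int,
    (n.+1 + absz y0)%N%:Z <= p.2 /\ `|p.1%:~R - al * p.2%:~R - be'| <= 6 / p.2%:~R.
  move=> n; have [x [y h]] := inhomogeneous_approx irr be' (n.+1 + absz y0)%N.
  by exists (x, y).
exists (fun n => x0 + k * (p n).1), (fun n => y0 + k * (p n).2); split.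
- by move=> n; exact: Lk.
- move=> n; have [h _] := hp n.
  have k1 : 1 <= k by rewrite -gtz0_ge1.
  have yp : 0 <= (p n).2 by rewrite (le_trans _ h).
  have := ler_wpM2r yp k1; have := ler_norm (- y0); rewrite normrN.
  move: h; rewrite PoszD abszE; move: (k * _) => u; lra.
exists ((`|y0%:~R| + k%:~R) * (6 * k%:~R)) => n; have [h1 h2] := hp n.
have y1 : 1 <= (p n).2%:~R :> R.
  by rewrite -[1]/(1%:~R) ler_int (le_trans _ h1).
set x := (p n).1 in h2 *; set y := (p n).2 in h1 h2 y1 *.
have -> : (x0 + k * x)%:~R - al * (y0 + k * y)%:~R - be =
    k%:~R * (x%:~R - al * y%:~R - be').
  by rewrite !rmorphD !rmorphM/= /be'; field; rewrite gt_eqF//; lra.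
rewrite normrM [X in _ * X]normrM (ger0_norm (_ : 0 <= k%:~R)); last lra.
have yb : `|(y0 + k * y)%:~R| <= (`|y0%:~R| + k%:~R) * y%:~R :> R.
  rewrite rmorphD rmorphM/=; apply: le_trans (ler_normD _ _) _.
  rewrite mulrDl lerD//; first by rewrite ler_peMr.
  by rewrite ger0_norm// mulr_ge0//; lra.
apply: le_trans (_ : ((`|y0%:~R| + k%:~R) * y%:~R) * (k%:~R * (6 / y%:~R)) <= _).
  apply: ler_pM => //; first by rewrite mulr_ge0//; lra.
  by rewrite ler_wpM2l//; lra.
rewrite le_eqVlt; apply/orP; left; apply/eqP; field; rewrite gt_eqF//; lra.
Qed.

End BoundedSequences.

Section IndefiniteSquare.
Variable R : realType.
Variables (a D : int) (al : R).
Hypotheses (a0 : 0 < a) (D0 : 0 < D) (alD : al ^+ 2 = D%:~R).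
Hypothesis al_irr : forall p q : int, q%:~R * al = p%:~R -> q = 0.

Let aR : 0 < a%:~R :> R. Proof. by rewrite ltr0z. Qed.

Let al_neq0 : al != 0.
Proof.
apply/eqP => h; have := alD; rewrite h expr0n/= => /esym/eqP.
by rewrite intr_eq0 gt_eqF.
Qed.

Let F b30 b21 b12 b03 b20 b11 b02 b10 b01 b00 x y :=
  a * (x ^+ 2 - D * y ^+ 2) ^+ 2 + cubic b30 b21 b12 b03 b20 b11 b02 b10 b01 b00 x y.

(** Where [x - al y] stays bounded, the quartic part is [O(y ^ 2)], while the cubic form is [y ^ 3]
    times its value at [(al, 1)] up to [O(y ^ 2)]. With [al ^ 2 = D] this value is the quantity
    bounded here. *)
Lemma cubic_along_asymptote L k b30 b21 b12 b03 b20 b11 b02 b10 b01 b00 :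
  periodic L k ->
  (forall x y, L x y -> 0 <= F b30 b21 b12 b03 b20 b11 b02 b10 b01 b00 x y) ->
  0 <= (b12 + D * b30)%:~R * al + (b03 + D * b21)%:~R.
Proof.
move=> Lk F0; have [x [y [Lxy yn hb]]] := approx_seq 0 Lk al_irr.
have y1 n : 1 <= (y n)%:~R :> R by rewrite -[1]/(1%:~R) ler_int (le_trans _ (yn n)).
pose d n : R := (x n)%:~R - al * (y n)%:~R.
pose i n : R := (y n)%:~R^-1.
have bi : bdd i.
  exists 1 => n; rewrite ger0_norm ?invr_ge0 ?(le_trans _ (y1 n))//.
  by rewrite invf_le1// (lt_le_trans _ (y1 n)).
have bd : bdd d.
  have [K hK] := bddM hb bi; exists K => n; apply: le_trans (hK n).
  by rewrite /i subr0 mulrC mulKf// gt_eqF// (lt_le_trans _ (y1 n)).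
apply: (@linear_sign _ _ (fun n => (y n)%:~R)
  (fun n => a%:~R * (d n * (2 * al + d n * i n)) ^+ 2 +
    d n * (2 * al + d n * i n) * (b30%:~R * (al + d n * i n) + b21%:~R) +
    (b12 + D * b30)%:~R * d n +
    (b20%:~R * (al + d n * i n) ^+ 2 + b11%:~R * (al + d n * i n) + b02%:~R +
     b10%:~R * (al + d n * i n) * i n + b01%:~R * i n + b00%:~R * i n ^+ 2))).
- by move=> n; rewrite pmulrn ler_int (le_trans _ (yn n))// lez_nat.
- by do ! first [exact: bi | exact: bd | exact: bddC | apply: bddD | apply: bddM | apply: bddX].
move=> n; have := F0 _ _ (Lxy n); rewrite -(ler0z R) /F /cubic.
have yp : 0 < (y n)%:~R :> R by rewrite (lt_le_trans _ (y1 n)).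
have i2 : 0 < i n ^+ 2 by rewrite exprn_gt0// invr_gt0.
rewrite -(pmulr_lge0 _ i2); congr (0 <= _).
rewrite !(rmorphD, rmorphM, rmorphXn, rmorphN)/= -alD.
have -> : (x n)%:~R = al * (y n)%:~R + d n by rewrite /d; ring.
by rewrite /i; move: (d n) => e; field; rewrite gt_eqF.
Qed.

Section Quadratic.
Variables (L : int -> int -> Prop) (k l1 l2 s e f m1 m2 m0 : int).
Hypothesis Lk : periodic L k.
Let W x y := 2 * a * (x ^+ 2 - D * y ^+ 2) + l1 * x + l2 * y.
Let G x y := 2 * a * W x y ^+ 2 + s * W x y + 2 * a * (e * x + f * y) * y + m1 * x + m2 * y + m0.
Hypothesis G0 : forall x y, L x y -> 0 <= G x y.

(* The centre of the hyperbola [W = 0] makes [W] bounded along the sequence. *)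
Let hyperbola_seq : exists x y : nat -> int,
  [/\ forall n, 0 <= (G (x n) (y n))%:~R :> R,
    forall n, 1 <= (y n)%:~R :> R, forall n, n%:R <= (y n)%:~R :> R &
    [/\ bdd (fun n => (W (x n) (y n))%:~R : R),
      bdd (fun n => (x n)%:~R - al * (y n)%:~R) & bdd (fun n => (y n)%:~R^-1 : R)]].
Proof.
(* On [x = al y + be] the coefficient of [y] in [W] is [4 a al be + l1 al + l2]; this [be] makes it
   vanish. *)
pose be : R := - (l1%:~R * al + l2%:~R) / (4 * a%:~R * al).
have [x [y [Lxy yn hb]]] := approx_seq be Lk al_irr.
have y1 n : 1 <= (y n)%:~R :> R by rewrite -[1]/(1%:~R) ler_int (le_trans _ (yn n)).
pose i n : R := (y n)%:~R^-1.
have bi : bdd i.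
  exists 1 => n; rewrite ger0_norm ?invr_ge0 ?(le_trans _ (y1 n))//.
  by rewrite invf_le1// (lt_le_trans _ (y1 n)).
pose d n : R := (x n)%:~R - al * (y n)%:~R.
have bd : bdd d.
  have [K hK] := bddD (bddM hb bi) (bddC be); exists K => n; apply: le_trans (hK n).
  rewrite /i [X in X * _]mulrC mulfK ?subrK// gt_eqF// (lt_le_trans _ (y1 n))//.
exists x, y; split => //.
- by move=> n; rewrite ler0z; exact: G0.
- by move=> n; rewrite pmulrn ler_int (le_trans _ (yn n))// lez_nat.
split => //.
have [K hK] : bdd (fun n => 4 * a%:~R * al * ((y n)%:~R * (d n - be)) +
    2 * a%:~R * d n ^+ 2 + l1%:~R * d n).
  by do ! first [exact: hb | exact: bd | exact: bddC | apply: bddD | apply: bddM | apply: bddX].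
exists K => n; apply: le_trans (hK n); rewrite le_eqVlt; apply/orP; left; apply/eqP.
congr (`| _ |); rewrite /W !(rmorphD, rmorphM, rmorphXn, rmorphN)/= -alD /be /d.
by field; rewrite al_neq0 gt_eqF.
Qed.

(** With [W] bounded, [G / y] is [2 a (e al + f) y] plus a bounded sequence. *)
Lemma quadratic_along_asymptote : 0 <= e%:~R * al + f%:~R.
Proof.
have [x [y [Gn y1 yn [bW bd bi]]]] := hyperbola_seq.
rewrite -(pmulr_rge0 _ (_ : 0 < 2 * a%:~R)); last by rewrite mulr_gt0.
pose w n : R := (W (x n) (y n))%:~R; pose d n : R := (x n)%:~R - al * (y n)%:~R.
pose i n : R := (y n)%:~R^-1.
apply: (@linear_sign _ _ (fun n => (y n)%:~R)
  (fun n => 2 * a%:~R * w n ^+ 2 * i n + s%:~R * w n * i n + 2 * a%:~R * e%:~R * d n +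
    m1%:~R * (al + d n * i n) + m2%:~R + m0%:~R * i n)) => //.
  by do ! first [exact: bi | exact: bd | exact: bW | exact: bddC | apply: bddD | apply: bddM | apply: bddX].
move=> n; have := Gn n.
have yp : 0 < (y n)%:~R :> R by rewrite (lt_le_trans _ (y1 n)).
have i0 : 0 < i n by rewrite invr_gt0.
rewrite -(pmulr_lge0 _ i0); congr (0 <= _).
rewrite /G /w; move: (W (x n) (y n)) => w'; rewrite !(rmorphD, rmorphM, rmorphXn)/=.
have -> : (x n)%:~R = al * (y n)%:~R + d n by rewrite /d; ring.
by rewrite /i; move: (d n) => d'; field; rewrite gt_eqF.
Qed.

Lemma linear_along_asymptote : e = 0 -> f = 0 -> 0 <= m1%:~R * al + m2%:~R.
Proof.
move=> e0 f0; have [x [y [Gn y1 yn [bW bd bi]]]] := hyperbola_seq.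
pose w n : R := (W (x n) (y n))%:~R; pose d n : R := (x n)%:~R - al * (y n)%:~R.
apply: (@linear_sign _ _ (fun n => (y n)%:~R)
  (fun n => 2 * a%:~R * w n ^+ 2 + s%:~R * w n + m1%:~R * d n + m0%:~R)) => //.
  by do ! first [exact: bd | exact: bW | exact: bddC | apply: bddD | apply: bddM | apply: bddX].
move=> n; have := Gn n; congr (0 <= _).
rewrite /G /w e0 f0; move: (W (x n) (y n)) => w'; rewrite !(rmorphD, rmorphM, rmorphXn)/=.
have -> : (x n)%:~R = al * (y n)%:~R + d n by rewrite /d; ring.
by ring.
Qed.

End Quadratic.
End IndefiniteSquare.

Section SquareCase.
Variable R : realType.

Lemma periodic_opp L k : periodic L k -> periodic (fun x y => L (- x) (- y)) k.
Proof.
move=> [k0 [x [y Lxy]] Lk]; split => //; first by exists (- x), (- y); rewrite !opprK.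
by move=> u v a b /(Lk _ _ (- a) (- b)); rewrite !mulrN -!opprD.
Qed.

Lemma square_form_coercive (A B C : R) : 0 < A -> exists K : R, forall t, 0 <= K /\ A / 2 * t ^+ 2 <= A * t ^+ 2 + B * t + K.
Proof.
move=> A0; exists (B ^+ 2 / (2 * A)) => t.
split; first by rewrite divr_ge0 ?sqr_ge0// mulr_ge0 ?ltW.
rewrite -subr_ge0.
have -> : A * t ^+ 2 + B * t + B ^+ 2 / (2 * A) - A / 2 * t ^+ 2 = (A * t + B) ^+ 2 / (2 * A).
  by field; rewrite gt_eqF.
by rewrite divr_ge0 ?sqr_ge0// mulr_ge0 ?ltW.
Qed.

(** Coercivity gives [W = O(T ^ 2)] and [y = O(T ^ 2)]. For fixed [y], [W] is a quadratic in [x]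
    confined to an interval of length [O(T ^ 2)], which leaves [O(T)] integers [x]. Points are
    therefore listed as [(y, x)]. *)
Lemma coercive_quadratic_case (L : int -> int -> Prop) (a D l1 l2 s e f m1 m2 m0 m : int)
    (F : int -> int -> int) :
  0 < a -> 0 < D -> 0 < f -> D * e ^+ 2 < f ^+ 2 -> 0 < m ->
  let W x y := 2 * a * (x ^+ 2 - D * y ^+ 2) + l1 * x + l2 * y in
  (forall x y, m * F x y =
    2 * a * W x y ^+ 2 + s * W x y + 2 * a * (e * x + f * y) * y + m1 * x + m2 * y + m0) ->
  landau_bounded R (values L F).
Proof.
move=> a0 D0 f0 Def m0' W FE.
have aR : 0 < a%:~R :> R by rewrite ltr0z.
have DR : 0 < D%:~R :> R by rewrite ltr0z.
have fR : 0 < f%:~R :> R by rewrite ltr0z.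
have mR : 0 < m%:~R :> R by rewrite ltr0z.
pose u : R := a%:~R * f%:~R / D%:~R.
pose v : R := 2 * a%:~R * (f%:~R / 2 - e%:~R ^+ 2 * D%:~R / (2 * f%:~R)).
have u0 : 0 < u by rewrite divr_gt0 ?mulr_gt0.
have v0 : 0 < v.
  rewrite mulr_gt0 ?mulr_gt0//.
  have -> : f%:~R / 2 - e%:~R ^+ 2 * D%:~R / (2 * f%:~R) = (f%:~R ^+ 2 - D%:~R * e%:~R ^+ 2) / (2 * f%:~R) :> R.
    by field; rewrite gt_eqF.
  rewrite divr_gt0 ?mulr_gt0// subr_gt0.
  by move: Def; rewrite -(ltr_int R) rmorphM !rmorphXn.
pose ka : R := e%:~R * D%:~R / f%:~R.
pose s' : R := s%:~R - f%:~R / (2 * D%:~R).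
pose n1 : R := m1%:~R + f%:~R / (2 * D%:~R) * l1%:~R.
pose n2 : R := m2%:~R + f%:~R / (2 * D%:~R) * l2%:~R.
(* Adding [f/(2D)] times the definition of [W] makes the quadratic part positive definite. *)
have GE x y : (m * F x y)%:~R = 2 * a%:~R * (W x y)%:~R ^+ 2 + s' * (W x y)%:~R +
    (u * (x%:~R + ka * y%:~R) ^+ 2 + n1 * (x%:~R + ka * y%:~R)) +
    (v * y%:~R ^+ 2 + (n2 - n1 * ka) * y%:~R) + m0%:~R.
  rewrite FE; set w := W x y.
  have wE : w%:~R = 2 * a%:~R * (x%:~R ^+ 2 - D%:~R * y%:~R ^+ 2) + l1%:~R * x%:~R + l2%:~R * y%:~R :> R.
    by rewrite /w /W !(rmorphD, rmorphM, rmorphXn, rmorphN).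
  have fw : f%:~R / (2 * D%:~R) * w%:~R = f%:~R / (2 * D%:~R) *
    (2 * a%:~R * (x%:~R ^+ 2 - D%:~R * y%:~R ^+ 2) + l1%:~R * x%:~R + l2%:~R * y%:~R) :> R by rewrite wE.
  rewrite /s' mulrBl fw !(rmorphD, rmorphM, rmorphXn)/= /u /v /ka /n1 /n2.
  by field; rewrite !gt_eqF.
have [K1 h1] := @square_form_coercive (2 * a%:~R) s' 0 (mulr_gt0 (ltr0n _ 2) aR).
have [K2 h2] := @square_form_coercive u n1 0 u0.
have [K3 h3] := @square_form_coercive v (n2 - n1 * ka) 0 v0.
pose K := K1 + K2 + K3 + `|m0%:~R| + m%:~R.
have K0 : 0 <= K by rewrite !addr_ge0 ?(h1 0).1 ?(h2 0).1 ?(h3 0).1// ltW.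
have low x y N : 1 <= N -> (F x y)%:~R <= N ->
    a%:~R * (W x y)%:~R ^+ 2 <= K * N /\ v / 2 * y%:~R ^+ 2 <= K * N.
  move=> N1 FN; have := GE x y; rewrite rmorphM/= => E.
  have FmN : m%:~R * (F x y)%:~R <= m%:~R * N by rewrite ler_wpM2l// ltW.
  have [k1 g1] := h1 (W x y)%:~R; have [k2 g2] := h2 (x%:~R + ka * y%:~R).
  have [k3 g3] := h3 y%:~R.
  have KN : K1 + K2 + K3 + `|m0%:~R| <= (K1 + K2 + K3 + `|m0%:~R|) * N.
    by rewrite ler_peMr// !addr_ge0.
  have mm := ler_norm (- m0%:~R : R); rewrite normrN in mm.
  have p1 : 0 <= a%:~R * (W x y)%:~R ^+ 2 :> R by rewrite mulr_ge0 ?sqr_ge0// ltW.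
  have p2 : 0 <= u / 2 * (x%:~R + ka * y%:~R) ^+ 2.
    by rewrite mulr_ge0 ?sqr_ge0// divr_ge0// ltW.
  have p3 : 0 <= v / 2 * y%:~R ^+ 2 by rewrite mulr_ge0 ?sqr_ge0// divr_ge0// ltW.
  have e1 : 2 * a%:~R / 2 = a%:~R :> R by field.
  rewrite e1 in g1; rewrite /K mulrDl; split; lra.
pose C1 := K / a%:~R + 1; pose C2 := K / (v / 2) + 1.
have v20 : 0 < v / 2 by rewrite divr_gt0.
have C10 : 1 <= C1 by rewrite /C1 lerDr divr_ge0// ltW.
have C20 : 1 <= C2 by rewrite /C2 lerDr divr_ge0// ltW.
apply: (@landau_bounded_points R (C2 + (2 * (2 * C1) + 2)) 1 _ (fun y x => F x y) 2 1) => //; first lra.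
move=> N N1 _ T; have [T1 TN TN2] := fourth_root_spec N1; rewrite -/T in T1 TN TN2.
have T0 : 0 <= T by lra.
have T2 : 0 <= T ^+ 2 by rewrite sqr_ge0.
have bounds x y : (F x y)%:~R <= N -> `|(W x y)%:~R| <= C1 * T ^+ 2 /\ `|y%:~R| <= C2 * T ^+ 2.
  move=> FN; have [b1 b2] := low x y N N1 FN; split.
    apply: le_square_root => //; rewrite -exprM TN real_normK ?num_real//.
    apply: le_trans (_ : K / a%:~R * N <= _).
      by rewrite mulrAC ler_pdivlMr// mulrC.
    by apply: ler_wpM2r; [lra|rewrite /C1 lerDl].
  apply: le_square_root => //; rewrite -exprM TN real_normK ?num_real//.
  apply: le_trans (_ : K / (v / 2) * N <= _).
    by rewrite mulrAC ler_pdivlMr// mulrC.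
  by apply: ler_wpM2r; [lra|rewrite /C2 lerDl].
exists [set p | (F p.2 p.1)%:~R <= N]; split.
- by move=> w [[x [y [Lxy vE]]] [_ vN]]; exists (y, x) => //=; rewrite -vE.
- move=> [y x] /= FN; apply: le_trans (bounds _ _ FN).2 _.
  by rewrite ler_wpM2r//; lra.
move=> y; pose M := C1 * T ^+ 2.
have M0 : 0 <= M by apply: mulr_ge0 => //; lra.
have A0 : 0 < 2 * a%:~R :> R by rewrite mulr_gt0.
have M20 : 0 <= 2 * M by rewrite mulr_ge0.
apply: sub_atmost (@atmost_quadratic R (2 * a%:~R) l1%:~R
  (l2%:~R * y%:~R - 2 * a%:~R * D%:~R * y%:~R ^+ 2 + M) (2 * M) A0 M20) _ _.
  move=> x /= FN; have [b _] := bounds _ _ FN.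
  have -> : 2 * a%:~R * x%:~R ^+ 2 + l1%:~R * x%:~R +
     (l2%:~R * y%:~R - 2 * a%:~R * D%:~R * y%:~R ^+ 2 + M) = (W x y)%:~R + M :> R.
    by rewrite /W !(rmorphD, rmorphM, rmorphXn, rmorphN)/=; ring.
  by move: b; rewrite ler_norml -/M; lra.
have a1 : 1 <= a%:~R :> R by rewrite -[1]/(1%:~R) ler_int.
have : Num.sqrt (2 * M / (2 * a%:~R)) <= C1 * T.
  rewrite -[leRHS]ger0_norm ?mulr_ge0//; last lra.
  rewrite -sqrtr_sqr ler_wsqrtr// ler_pdivrMr// exprMn /M.
  have : C1 * T ^+ 2 <= C1 ^+ 2 * T ^+ 2 by rewrite ler_wpM2r// expr2 ler_peMr//; lra.
  have CT : 0 <= C1 ^+ 2 * T ^+ 2 by rewrite mulr_ge0// sqr_ge0.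
  have := ler_wpM2l CT a1; lra.
have CT : 0 <= C1 * T by rewrite mulr_ge0//; lra.
have CT2 : 0 <= C2 * T by rewrite mulr_ge0//; lra.
rewrite expr1; lra.
Qed.

Lemma square_leading_case L k a D b30 b21 b12 b03 b20 b11 b02 b10 b01 b00 :
  periodic L k -> 0 < a -> 0 < D -> (forall p q : int, D * q ^+ 2 = p ^+ 2 -> q = 0) ->
  let F x y := a * (x ^+ 2 - D * y ^+ 2) ^+ 2 +
    cubic b30 b21 b12 b03 b20 b11 b02 b10 b01 b00 x y in
  (forall x y, L x y -> 0 <= F x y) -> landau_bounded R (values L F).
Proof.
move=> Lk a0 D0 irr F F0.
pose al : R := Num.sqrt D%:~R.
have DR : 0 < D%:~R :> R by rewrite ltr0z.
have alD : al ^+ 2 = D%:~R by rewrite sqr_sqrtr// ltW.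
have al0 : 0 < al by rewrite sqrtr_gt0.
have irrR b (p q : int) : b ^+ 2 = D%:~R -> q%:~R * b = p%:~R :> R -> q = 0.
  move=> bD qb; apply: (irr p); apply/eqP; rewrite -(eqr_int R) rmorphM !rmorphXn/=.
  by rewrite -bD -qb; apply/eqP; ring.
have al_irr (p q : int) : q%:~R * al = p%:~R -> q = 0 by exact: irrR.
have nal_irr (p q : int) : q%:~R * (- al) = p%:~R -> q = 0 by apply: irrR; rewrite sqrrN.
have nalD : (- al) ^+ 2 = D%:~R by rewrite sqrrN.
have vanish (p q : int) : p%:~R * al + q%:~R = 0 -> p = 0 /\ q = 0.
  move=> h; have p0 : p = 0 by apply: (al_irr (- q)); rewrite rmorphN/=; lra.
  by split => //; apply/eqP; rewrite -(intr_eq0 R); move: h; rewrite p0 mul0r add0r => ->.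
have Lk' := periodic_opp Lk.
(* Reflecting [L] through the origin reverses the sign of the cubic form, so its value at [(al, 1)]
   is both nonnegative and nonpositive; irrationality of [al] then separates the two
   coefficients. *)
have [E1 F1] : b12 + D * b30 = 0 /\ b03 + D * b21 = 0.
  apply: vanish; apply/eqP; rewrite eq_le; apply/andP; split; last first.
    exact: (cubic_along_asymptote alD al_irr Lk F0).
  have F0' x y : L (- x) (- y) -> 0 <= a * (x ^+ 2 - D * y ^+ 2) ^+ 2 +
      cubic (- b30) (- b21) (- b12) (- b03) b20 b11 b02 (- b10) (- b01) b00 x y.
    by move=> /F0; rewrite /F /cubic; congr (_ <= _); ring.
  have := cubic_along_asymptote alD al_irr Lk' F0'.
  rewrite !(rmorphD, rmorphM, rmorphN)/=; lra.
have b12E : b12 = - (D * b30) by lra.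
have b03E : b03 = - (D * b21) by lra.
(* The cubic form is now [(x ^ 2 - D y ^ 2) (b30 x + b21 y)], and [2 a W ^ 2] accounts for degrees 4
   and 3 of [8 a ^ 2 F]. The remaining [x ^ 2] term is traded for [s W], which adds [D s] to [f]. *)
pose W x y := 2 * a * (x ^+ 2 - D * y ^+ 2) + b30 * x + b21 * y.
pose s := 4 * a * b20 - b30 ^+ 2.
pose e := 4 * a * b11 - 2 * b30 * b21.
pose f := 4 * a * b02 - b21 ^+ 2 + D * s.
pose m1 := 8 * a ^+ 2 * b10 - s * b30.
pose m2 := 8 * a ^+ 2 * b01 - s * b21.
pose m0 := 8 * a ^+ 2 * b00.
have FE x y : 8 * a ^+ 2 * F x y =
    2 * a * W x y ^+ 2 + s * W x y + 2 * a * (e * x + f * y) * y + m1 * x + m2 * y + m0.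
  by rewrite /F /cubic b12E b03E /W /m1 /m2 /m0 /f /e /s; ring.
have m_gt0 : 0 < 8 * a ^+ 2 by rewrite mulr_gt0// exprn_gt0.
have G0 x y : L x y -> 0 <= 2 * a * W x y ^+ 2 + s * W x y +
    2 * a * (e * x + f * y) * y + m1 * x + m2 * y + m0.
  by move=> /F0; rewrite -FE; apply: mulr_ge0; exact: ltW.
have q1 := quadratic_along_asymptote a0 D0 alD al_irr Lk G0.
have q2 := quadratic_along_asymptote a0 D0 nalD nal_irr Lk G0.
(* The two asymptotes give [f >= |e| al]. If [f = 0], then [e = 0], the linear terms vanish by the
   same reflection argument, and [F] is a quadratic in [W] alone. *)
have [f0|fn] := eqVneq f 0.
  have e0 : e = 0.
    have : e%:~R * al + 0%:~R = 0 :> R by rewrite f0 in q1 q2; lra.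
    by case/vanish.
  have [m10 m20] : m1 = 0 /\ m2 = 0.
    apply: vanish; apply/eqP; rewrite eq_le; apply/andP; split; last first.
      exact: (linear_along_asymptote a0 D0 alD al_irr Lk G0 e0 f0).
    have G0' x y : L (- x) (- y) ->
        0 <= 2 * a * (2 * a * (x ^+ 2 - D * y ^+ 2) + - b30 * x + - b21 * y) ^+ 2 +
        s * (2 * a * (x ^+ 2 - D * y ^+ 2) + - b30 * x + - b21 * y) +
        2 * a * (e * x + f * y) * y + - m1 * x + - m2 * y + m0.
      by move=> /G0; rewrite /W; congr (_ <= _); ring.
    have := linear_along_asymptote a0 D0 alD al_irr Lk' G0' e0 f0.
    by rewrite !rmorphN/=; lra.
  apply: (@landau_bounded_square R (64 * a ^+ 3) (s ^+ 2 - 8 * a * m0)).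
    by rewrite mulr_gt0// exprn_gt0.
  move=> v [x [y [_ ->]]]; exists (4 * a * W x y + s).
  have -> : 64 * a ^+ 3 * F x y = 8 * a * (8 * a ^+ 2 * F x y) by ring.
  by rewrite FE e0 f0 m10 m20; ring.
have f_gt0 : 0 < f.
  rewrite lt_neqAle eq_sym fn -(ler0z R).
  by rewrite -(pmulr_rge0 _ (ltr0n R 2)); lra.
have fR : 0 < f%:~R :> R by rewrite ltr0z.
apply: (@coercive_quadratic_case L a D b30 b21 s e f m1 m2 m0 (8 * a ^+ 2) F a0 D0 f_gt0 _ m_gt0 FE).
(* [D e ^ 2 = f ^ 2] would make [e], hence [f], vanish, as [D] is not a rational square. *)
rewrite lt_neqAle; apply/andP; split.
  by apply/eqP => h; move: fn; rewrite -sqrf_eq0 -h => /eqP; rewrite (irr f e h) expr0n mulr0.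
rewrite -(ler_int R) rmorphM !rmorphXn/= -alD.
have : 0 <= (f%:~R - e%:~R * al) * (f%:~R + e%:~R * al) by rewrite mulr_ge0//; lra.
lra.
Qed.

End SquareCase.

(** * Classification of the leading form *)

Section LeadingFormClassification.
Variable R : realType.

Definition is_cubic (g : int -> int -> int) : Prop :=
  exists b30 b21 b12 b03 b20 b11 b02 b10 b01 b00,
  forall x y, g x y = cubic b30 b21 b12 b03 b20 b11 b02 b10 b01 b00 x y.

Lemma is_cubicZ a g : is_cubic g -> is_cubic (fun x y => a * g x y).
Proof.
case=> b30 [b21 [b12 [b03 [b20 [b11 [b02 [b10 [b01 [b00 gE]]]]]]]]].
exists (a * b30), (a * b21), (a * b12), (a * b03), (a * b20), (a * b11), (a * b02),
  (a * b10), (a * b01), (a * b00) => x y.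
by rewrite gE /cubic; ring.
Qed.

Lemma is_cubicD g h : is_cubic g -> is_cubic h -> is_cubic (fun x y => g x y + h x y).
Proof.
case=> b30 [b21 [b12 [b03 [b20 [b11 [b02 [b10 [b01 [b00 gE]]]]]]]]].
case=> c30 [c21 [c12 [c03 [c20 [c11 [c02 [c10 [c01 [c00 hE]]]]]]]]].
exists (b30 + c30), (b21 + c21), (b12 + c12), (b03 + c03), (b20 + c20), (b11 + c11),
  (b02 + c02), (b10 + c10), (b01 + c01), (b00 + c00) => x y.
by rewrite gE hE /cubic; ring.
Qed.

Lemma is_cubic_linear p q r s g : is_cubic g ->
  is_cubic (fun x y => g (p * x + q * y) (r * x + s * y)).
Proof.
case=> b30 [b21 [b12 [b03 [b20 [b11 [b02 [b10 [b01 [b00 gE]]]]]]]]].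
exists (b30 * p ^+ 3 + b21 * p ^+ 2 * r + b12 * p * r ^+ 2 + b03 * r ^+ 3),
  (3 * b30 * p ^+ 2 * q + b21 * (p ^+ 2 * s + 2 * p * q * r) +
   b12 * (q * r ^+ 2 + 2 * p * r * s) + 3 * b03 * r ^+ 2 * s),
  (3 * b30 * p * q ^+ 2 + b21 * (q ^+ 2 * r + 2 * p * q * s) +
   b12 * (p * s ^+ 2 + 2 * q * r * s) + 3 * b03 * r * s ^+ 2),
  (b30 * q ^+ 3 + b21 * q ^+ 2 * s + b12 * q * s ^+ 2 + b03 * s ^+ 3),
  (b20 * p ^+ 2 + b11 * p * r + b02 * r ^+ 2),
  (2 * b20 * p * q + b11 * (p * s + q * r) + 2 * b02 * r * s),
  (b20 * q ^+ 2 + b11 * q * s + b02 * s ^+ 2),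
  (b10 * p + b01 * r), (b10 * q + b01 * s), b00 => x y.
by rewrite gE /cubic; ring.
Qed.

(** Multiplying the part of degree [j] by [a ^ (3 - j)] avoids dividing by [a]; the determinant of a
    substitution is cleared in this way. *)
Lemma is_cubic_homog a g : is_cubic g ->
  exists2 g', is_cubic g' & forall x y, g' (a * x) (a * y) = a ^+ 3 * g x y.
Proof.
case=> b30 [b21 [b12 [b03 [b20 [b11 [b02 [b10 [b01 [b00 gE]]]]]]]]].
exists (cubic b30 b21 b12 b03 (a * b20) (a * b11) (a * b02) (a ^+ 2 * b10) (a ^+ 2 * b01) (a ^+ 3 * b00)).
  by do 10 eexists.
by move=> x y; rewrite gE /cubic; ring.
Qed.

(** Quantifying over [L] and over the lower-order part [g] makes this a property of the leading form
    that linear substitutions preserve. *)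
Definition landau_form (h : int -> int -> int) : Prop :=
  forall L k g, periodic L k -> is_cubic g ->
  (forall x y, L x y -> 0 <= h x y + g x y) ->
  landau_bounded R (values L (fun x y => h x y + g x y)).

Lemma landau_form_ext h h' : (forall x y, h x y = h' x y) -> landau_form h' -> landau_form h.
Proof.
move=> hh good L k g Lk gc F0.
apply: landau_bounded_sub (good L k g Lk gc _); last by move=> x y; rewrite -hh; exact: F0.
by move=> v [x [y [Lxy ->]]]; exists x, y; rewrite hh.
Qed.

(** The adjugate matrix maps the new coordinates back to [(d x, d y)], so the new polynomial takes
    the values [d ^ 4 F] on the image of [L]. Its period is [k |d|], because [d Z^2] lies in the
    image of [Z^2]. *)
Lemma landau_form_linear c4 c3 c2 c1 c0 p q r s : p * s - q * r != 0 ->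
  landau_form (fun u v => quartic c4 c3 c2 c1 c0 (s * u + - q * v) (- r * u + p * v)) ->
  landau_form (quartic c4 c3 c2 c1 c0).
Proof.
set d := p * s - q * r => dn good L k g Lk gc F0.
have [g' gc' g'E] := is_cubic_homog d gc.
pose L' u v := exists x y, [/\ L x y, u = p * x + q * y & v = r * x + s * y].
pose G u v := d * g' (s * u + - q * v) (- r * u + p * v).
have Gc : is_cubic G by apply: is_cubicZ; exact: is_cubic_linear.
have inv x y : s * (p * x + q * y) + - q * (r * x + s * y) = d * x /\
    - r * (p * x + q * y) + p * (r * x + s * y) = d * y.
  by rewrite /d; split; ring.
have FE x y : quartic c4 c3 c2 c1 c0 (s * (p * x + q * y) + - q * (r * x + s * y))
    (- r * (p * x + q * y) + p * (r * x + s * y)) + G (p * x + q * y) (r * x + s * y) =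
    d ^+ 4 * (quartic c4 c3 c2 c1 c0 x y + g x y).
  by rewrite /G !(inv x y).1 !(inv x y).2 g'E /quartic; ring.
have d4 : 0 < d ^+ 4 by rewrite exprn_even_gt0.
have [k0 [x0 [y0 L0]] Lper] := Lk.
have Lk' : periodic L' (k * `|d|).
  split.
  - by rewrite mulr_gt0// normr_gt0.
  - by exists (p * x0 + q * y0), (r * x0 + s * y0), x0, y0.
  move=> u v a b [x [y [Lxy -> ->]]].
  have -> : `|d| = Num.sg d * d by rewrite normrEsg.
  set e := Num.sg d.
  exists (x + k * (e * (s * a - q * b))), (y + k * (e * (p * b - r * a))).
  by split; [exact: Lper|rewrite /d; ring|rewrite /d; ring].
have G0 u v : L' u v -> 0 <= quartic c4 c3 c2 c1 c0 (s * u + - q * v) (- r * u + p * v) + G u v.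
  by move=> [x [y [Lxy -> ->]]]; rewrite FE mulr_ge0 ?F0// ltW.
apply: (@landau_bounded_affine R (d ^+ 4) 0 _ _ d4 _ (good L' _ G Lk' Gc G0)).
move=> v [x [y [Lxy ->]]]; exists (p * x + q * y), (r * x + s * y).
by rewrite FE addr0; split => //; exists x, y.
Qed.

Lemma landau_form_pure c : 0 < c -> landau_form (fun x _ => c * x ^+ 4).
Proof.
move=> c0 L k g Lk [b30 [b21 [b12 [b03 [b20 [b11 [b02 [b10 [b01 [b00 gE]]]]]]]]]] F0.
apply: landau_bounded_sub (@quartic_leading_case R L k c b30 b21 b12 b03 b20 b11 b02 b10 b01 b00 Lk c0 _).
  by move=> v [x [y [Lxy ->]]]; exists x, y; rewrite gE.
by move=> x y Lxy; have := F0 x y Lxy; rewrite gE.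
Qed.

Lemma landau_form_mixed a c : 0 < a -> 0 <= c ->
  landau_form (fun x y => a * x ^+ 2 * y ^+ 2 + c * x ^+ 4).
Proof.
move=> a0 c0 L k g Lk [b30 [b21 [b12 [b03 [b20 [b11 [b02 [b10 [b01 [b00 gE]]]]]]]]]] F0.
apply: landau_bounded_sub (@mixed_leading_case R L k a c b30 b21 b12 b03 b20 b11 b02 b10 b01 b00 Lk a0 c0 _).
  by move=> v [x [y [Lxy ->]]]; exists x, y; rewrite gE.
by move=> x y Lxy; have := F0 x y Lxy; rewrite gE.
Qed.

Lemma landau_form_square a D : 0 < a -> 0 < D ->
  (forall p q : int, D * q ^+ 2 = p ^+ 2 -> q = 0) ->
  landau_form (fun x y => a * (x ^+ 2 - D * y ^+ 2) ^+ 2).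
Proof.
move=> a0 D0 irr L k g Lk [b30 [b21 [b12 [b03 [b20 [b11 [b02 [b10 [b01 [b00 gE]]]]]]]]]] F0.
apply: landau_bounded_sub (@square_leading_case R L k a D b30 b21 b12 b03 b20 b11 b02 b10 b01 b00 Lk a0 D0 irr _).
  by move=> v [x [y [Lxy ->]]]; exists x, y; rewrite gE.
by move=> x y Lxy; have := F0 x y Lxy; rewrite gE.
Qed.

Lemma landau_form_definite c4 c3 c2 c1 c0 : c4 != 0 ->
  (forall t : R, real_quartic c4 c3 c2 c1 c0 t 1 != 0) ->
  landau_form (quartic c4 c3 c2 c1 c0).
Proof.
move=> c40 nz L k g Lk [b30 [b21 [b12 [b03 [b20 [b11 [b02 [b10 [b01 [b00 gE]]]]]]]]]] F0.
apply: landau_bounded_sub (definite_case L b30 b21 b12 b03 b20 b11 b02 b10 b01 b00 c40 nz _).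
  by move=> v [x [y [Lxy ->]]]; exists x, y; rewrite gE.
apply: (@leading_form_ge0 L k c4 c3 c2 c1 c0 b30 b21 b12 b03 b20 b11 b02 b10 b01 b00 Lk).
by move=> x y Lxy; have := F0 x y Lxy; rewrite gE.
Qed.

Lemma landau_form_vanishing_axis c4 c3 c2 c1 :
  (forall x y, 0 <= quartic c4 c3 c2 c1 0 x y) ->
  (exists x y, quartic c4 c3 c2 c1 0 x y <> 0) ->
  landau_form (quartic c4 c3 c2 c1 0).
Proof.
move=> h0 hn.
have c1E : c1 = 0.
  apply: (@peval_lead_odd 1 0 [:: c4; c3; c2]) => // t.
  by have := h0 1 t; rewrite /quartic /=; congr (_ <= _); ring.
subst c1.
have c2_ge0 : 0 <= c2.
  apply: (@peval_lead_ge0 1 0 [:: c4; c3]) => // t.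
  by have := h0 1 t; rewrite /quartic /=; congr (_ <= _); ring.
have [c2E|c2n] := eqVneq c2 0.
  subst c2; have c3E : c3 = 0.
    apply: (@peval_lead_odd 1 0 [:: c4]) => // t.
    by have := h0 1 t; rewrite /quartic /=; congr (_ <= _); ring.
  subst c3; apply: (@landau_form_ext _ (fun x _ => c4 * x ^+ 4)).
    by move=> x y; rewrite /quartic; ring.
  apply: landau_form_pure; rewrite lt_neqAle; apply/andP; split; last first.
    by have := h0 1 0; rewrite /quartic; congr (_ <= _); ring.
  by apply/eqP => c40; case: hn => x [y]; apply; rewrite /quartic -c40; ring.
have c2_gt0 : 0 < c2 by rewrite lt_neqAle eq_sym c2n.
(* The new variable [c3 x + 2 c2 y] completes the square in [c4 x ^ 2 + c3 x y + c2 y ^ 2]. *)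
apply: (@landau_form_linear _ _ _ _ _ 1 0 c3 (2 * c2)).
  by rewrite mul1r mul0r subr0 mulf_neq0.
apply: (@landau_form_ext _ (fun x y => (4 * c2 ^+ 3) * x ^+ 2 * y ^+ 2 +
    (4 * c2 ^+ 3 * (4 * c2 * c4 - c3 ^+ 2)) * x ^+ 4)).
  by move=> x y; rewrite /quartic; ring.
apply: landau_form_mixed; first by rewrite mulr_gt0// exprn_gt0.
by have := h0 (2 * c2) (- c3); rewrite /quartic; congr (_ <= _); ring.
Qed.

(** Nonnegativity is available at rational arguments only. Fractions with denominator [n + 1] just
    below and just above [t] give the two signs of the derivative; irrationality keeps them
    different from [t]. *)
Lemma double_root (c d2 d1 d0 : int) (t : R) :
  0 < c -> (forall x y, 0 <= quartic c 0 d2 d1 d0 x y) ->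
  (forall p q : int, q%:~R * t = p%:~R -> q = 0) ->
  real_quartic c 0 d2 d1 d0 t 1 = 0 ->
  4 * c%:~R * t ^+ 3 + 2 * d2%:~R * t + d1%:~R = 0.
Proof.
move=> c0 h0 irr ft.
pose n1 n : R := n.+1%:R.
have n1_gt0 n : 0 < n1 n by rewrite ltr0n.
have expand e : real_quartic c 0 d2 d1 d0 (t + e) 1 =
    e * ((4 * c%:~R * t ^+ 3 + 2 * d2%:~R * t + d1%:~R) +
      e * (6 * c%:~R * t ^+ 2 + d2%:~R + 4 * c%:~R * t * e + c%:~R * e ^+ 2)).
  by rewrite -[LHS]subr0 -ft /real_quartic; ring.
have ratpos (p : int) n : 0 <= real_quartic c 0 d2 d1 d0 (p%:~R / n1 n) 1.
  have n4 : 0 < n1 n ^+ 4 by rewrite exprn_gt0.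
  rewrite -(pmulr_rge0 _ n4).
  have -> : n1 n ^+ 4 * real_quartic c 0 d2 d1 d0 (p%:~R / n1 n) 1 =
      (quartic c 0 d2 d1 d0 p n.+1%:Z)%:~R.
    by rewrite -real_quarticE /real_quartic -pmulrn -/(n1 n); field; rewrite gt_eqF.
  by rewrite ler0z.
pose fl n := Num.floor (n1 n * t).
have fl1 n : (fl n)%:~R <= n1 n * t < (fl n)%:~R + 1.
  by have := floor_itv (n1 n * t); rewrite rmorphD.
have fln n : (fl n)%:~R != n1 n * t.
  apply/eqP => e; have := irr (fl n) n.+1%:Z.
  by rewrite -pmulrn -/(n1 n) => /(_ (esym e)).
have key (s : R) (e : nat -> R) : (forall n, 0 < s * e n) -> (forall n, `|n1 n * e n| <= 1) ->
    (forall n, exists p : int, t + e n = p%:~R / n1 n) -> `|s| = 1 ->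
    0 <= s * (4 * c%:~R * t ^+ 3 + 2 * d2%:~R * t + d1%:~R).
  move=> se ne rat s1.
  have bn : bdd (fun n => n1 n * e n) by exists 1.
  have be : bdd e.
    exists 1 => n; apply: le_trans (ne n); rewrite normrM ler_peMl//.
    by rewrite ger0_norm ?ler1n// ltW.
  apply: (@linear_sign _ _ n1 (fun n => s * (n1 n * e n) *
     (6 * c%:~R * t ^+ 2 + d2%:~R + 4 * c%:~R * t * e n + c%:~R * e n ^+ 2))).
  - by move=> n; rewrite ler_nat.
  - by do ! first [exact: bn | exact: be | exact: bddC | apply: bddD | apply: bddM | apply: bddX].
  move=> n; have [p pE] := rat n; have := ratpos p n; rewrite -pE expand.
  have s2 : s ^+ 2 = 1 by rewrite -real_normK ?num_real// s1 expr1n.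
  have -> : forall A B, e n * (A + e n * B) = (s * e n) * (s * (A + e n * B)).
    by move=> A B; rewrite mulrACA -expr2 s2 mul1r.
  rewrite pmulr_rge0// -(pmulr_rge0 _ (n1_gt0 n)); congr (0 <= _); ring.
apply/eqP; rewrite eq_le; apply/andP; split.
  have := @key (-1) (fun n => (fl n)%:~R / n1 n - t).
  rewrite mulN1r oppr_ge0; apply; last by rewrite normrN1.
  - move=> n; rewrite mulN1r opprB subr_gt0 ltr_pdivrMr// mulrC.
    by rewrite lt_neqAle fln; case/andP: (fl1 n).
  - move=> n; rewrite mulrBr mulrCA divff ?gt_eqF// mulr1 distrC ger0_norm; last first.
      by rewrite subr_ge0; case/andP: (fl1 n).
    by rewrite lerBlDl ltW//; case/andP: (fl1 n).
  - by move=> n; exists (fl n); rewrite addrC subrK.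
have := @key 1 (fun n => (fl n + 1)%:~R / n1 n - t).
rewrite mul1r; apply; last by rewrite normr1.
- move=> n; rewrite mul1r subr_gt0 ltr_pdivlMr// mulrC rmorphD/=.
  by case/andP: (fl1 n).
- move=> n; rewrite mulrBr mulrCA divff ?gt_eqF// mulr1 rmorphD/= ger0_norm; last first.
    by rewrite subr_ge0 ltW//; case/andP: (fl1 n).
  by rewrite lerBlDr addrC lerD2l; case/andP: (fl1 n).
- by move=> n; exists (fl n + 1); rewrite addrC subrK.
Qed.

(** The Euclidean algorithm on [f] and its derivative [f'], which share the root [t]: any relation
    of degree 1 in [t] splits into two integer relations by irrationality. *)
Lemma depressed_square (c d2 d1 d0 : int) (t : R) :
  0 < c -> (forall x y, 0 <= quartic c 0 d2 d1 d0 x y) ->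
  (forall p q : int, q%:~R * t = p%:~R -> q = 0) ->
  real_quartic c 0 d2 d1 d0 t 1 = 0 -> [/\ d1 = 0, d2 ^+ 2 = 4 * c * d0 & d2 < 0].
Proof.
move=> c0 h0 irr ft; have ft' := double_root c0 h0 irr ft.
have vanish (p q : int) : p%:~R * t + q%:~R = 0 -> p = 0 /\ q = 0.
  move=> h; have p0 : p = 0 by apply: (irr (- q)); rewrite rmorphN/=; lra.
  by split => //; apply/eqP; rewrite -(intr_eq0 R); move: h; rewrite p0 mul0r add0r => ->.
have cR : 0 < c%:~R :> R by rewrite ltr0z.
have I : 2 * d2%:~R * t ^+ 2 + 3 * d1%:~R * t + 4 * d0%:~R = 0.
  have -> : 2 * d2%:~R * t ^+ 2 + 3 * d1%:~R * t + 4 * d0%:~R =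
    4 * real_quartic c 0 d2 d1 d0 t 1 - t * (4 * c%:~R * t ^+ 3 + 2 * d2%:~R * t + d1%:~R).
    by rewrite /real_quartic; ring.
  by rewrite ft ft' !mulr0 subrr.
have d2n : d2 != 0.
  apply/eqP => d2E.
  have [d1E d0E] : 3 * d1 = 0 /\ 4 * d0 = 0.
    by apply: vanish; rewrite !rmorphM/= -[RHS]I d2E; ring.
  have t0 : t = 0.
    have d1E' : d1 = 0 by lra.
    have d0E' : d0 = 0 by lra.
    move: ft; rewrite /real_quartic d2E d1E' d0E' !mul0r !addr0 => /eqP.
    by rewrite mulf_eq0 expf_eq0 gt_eqF//= => /eqP.
  by have := irr 0 1; rewrite t0 mulr0 => /(_ erefl).
(* The remainder of [d2 ^ 2 f'] modulo the quadratic relation [I], which came from [4 f - t f']. *)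
have [II III] : c * (9 * d1 ^+ 2 - 8 * d0 * d2) + 2 * d2 ^+ 3 = 0 /\
    12 * c * d0 * d1 + d1 * d2 ^+ 2 = 0.
  apply: vanish; rewrite !(rmorphD, rmorphM, rmorphXn, rmorphN)/=.
  transitivity (d2%:~R ^+ 2 * (4 * c%:~R * t ^+ 3 + 2 * d2%:~R * t + d1%:~R) +
    (3 * c%:~R * d1%:~R - 2 * c%:~R * d2%:~R * t) *
    (2 * d2%:~R * t ^+ 2 + 3 * d1%:~R * t + 4 * d0%:~R)); first by ring.
  by rewrite ft' I !mulr0 addr0.
have d1E : d1 = 0.
  (* If [d1] were nonzero, [II] and [III] would make the discriminant of [I] vanish, and
     [4 d2 t + 3 d1 = 0] would make [t] rational. *)
  apply/eqP/negPn/negP => d1n.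
  have e1 : 12 * c * d0 + d2 ^+ 2 = 0.
    by apply/eqP; rewrite -(mulrI_eq0 _ (mulfI d1n)) -III; apply/eqP; ring.
  have e2 : 27 * c * d1 ^+ 2 + 8 * d2 ^+ 3 = 0.
    have -> : 27 * c * d1 ^+ 2 + 8 * d2 ^+ 3 = 3 * (c * (9 * d1 ^+ 2 - 8 * d0 * d2) + 2 * d2 ^+ 3)
      + 2 * d2 * (12 * c * d0 + d2 ^+ 2) by ring.
    by rewrite II e1 !mulr0 addr0.
  have disc : 3 * c * (9 * d1 ^+ 2 - 32 * d0 * d2) = 0.
    have -> : 3 * c * (9 * d1 ^+ 2 - 32 * d0 * d2) = (27 * c * d1 ^+ 2 + 8 * d2 ^+ 3)
      - 8 * d2 * (12 * c * d0 + d2 ^+ 2) by ring.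
    by rewrite e2 e1 mulr0 subrr.
  have disc' : 9 * d1 ^+ 2 - 32 * d0 * d2 = 0.
    apply/eqP; move/eqP: disc; rewrite mulf_eq0 => /orP[|//].
    by rewrite mulf_eq0/= gt_eqF.
  have sq : ((4 * d2)%:~R * t + (3 * d1)%:~R) ^+ 2 = 0.
    have dR : 9 * d1%:~R ^+ 2 - 32 * d0%:~R * d2%:~R = 0 :> R.
      by have := congr1 (fun z : int => z%:~R : R) disc'; rewrite !(rmorphD, rmorphM, rmorphXn, rmorphN).
    rewrite !rmorphM/=.
    have -> : (4 * d2%:~R * t + 3 * d1%:~R) ^+ 2 =
      8 * d2%:~R * (2 * d2%:~R * t ^+ 2 + 3 * d1%:~R * t + 4 * d0%:~R) +
      (9 * d1%:~R ^+ 2 - 32 * d0%:~R * d2%:~R) by ring.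
    by rewrite I dR mulr0 addr0.
  move/eqP: sq; rewrite sqrf_eq0 => /eqP/vanish[_ d1E].
  by move: d1n; have -> : d1 = 0 by lra.
have d2E : d2 ^+ 2 = 4 * c * d0.
  apply: (mulfI d2n); apply/eqP; rewrite -subr_eq0; apply/eqP.
  move: II; rewrite d1E => II; lra.
split => //; rewrite ltNge; apply/negP => d2_ge0.
have d2R : 0 < d2%:~R :> R by rewrite ltr0z lt_neqAle eq_sym d2n.
have t2 : 0 <= t ^+ 2 by exact: sqr_ge0.
have d0_gt0 : 0 < d0%:~R :> R.
  have c4 : 0 < 4 * c by rewrite mulr_gt0.
  by rewrite ltr0z -(pmulr_rgt0 _ c4) -d2E exprn_gt0// lt_neqAle eq_sym d2n.
have := mulr_ge0 (ltW d2R) t2; move: I; rewrite d1E; lra.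
Qed.

Lemma landau_form_irrational_zero c4 c3 c2 c1 c0 (t : R) :
  (forall x y, 0 <= quartic c4 c3 c2 c1 c0 x y) ->
  (forall x y, quartic c4 c3 c2 c1 c0 x y = 0 -> x = 0 /\ y = 0) ->
  real_quartic c4 c3 c2 c1 c0 t 1 = 0 ->
  landau_form (quartic c4 c3 c2 c1 c0).
Proof.
move=> h0 nz ht.
have c4_gt0 : 0 < c4.
  rewrite lt_neqAle; apply/andP; split; last first.
    by have := h0 1 0; rewrite /quartic; congr (_ <= _); ring.
  by apply/eqP => c4E; have [] := nz 1 0; rewrite // /quartic -c4E; ring.
have c4n : 8 * c4 != 0 by rewrite mulf_neq0// gt_eqF.
(* The shift [u = 2 (4 c4 x + c3 y)] removes the term [u ^ 3 v]. *)
apply: (@landau_form_linear _ _ _ _ _ (8 * c4) (2 * c3) 0 1).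
  by rewrite mulr1 mulr0 subr0.
pose d2 := c2 * (8 * c4) ^+ 2 - 3 * (8 * c4) * c3 ^+ 2.
pose d1 := 8 * (8 * c4) * c3 ^+ 3 - 4 * c2 * c3 * (8 * c4) ^+ 2 + c1 * (8 * c4) ^+ 3.
pose d0 := quartic c4 c3 c2 c1 c0 (- (2 * c3)) (8 * c4).
have dE u v : quartic c4 c3 c2 c1 c0 (1 * u + - (2 * c3) * v) (- 0 * u + 8 * c4 * v) =
    quartic c4 0 d2 d1 d0 u v by rewrite /d2 /d1 /d0 /quartic; ring.
apply: (landau_form_ext dE).
have h0' u v : 0 <= quartic c4 0 d2 d1 d0 u v by rewrite -dE.
have nz' u v : quartic c4 0 d2 d1 d0 u v = 0 -> u = 0 /\ v = 0.
  rewrite -dE => /nz[]; rewrite oppr0 mul0r add0r mul1r => eu /eqP.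
  by rewrite mulf_eq0 (negbTE c4n)/= => /eqP v0; move: eu; rewrite v0 mulr0 addr0.
pose ta : R := 8 * c4%:~R * t + 2 * c3%:~R.
have hta : real_quartic c4 0 d2 d1 d0 ta 1 = 0.
  transitivity ((8 * c4%:~R) ^+ 4 * real_quartic c4 c3 c2 c1 c0 t 1); last by rewrite ht mulr0.
  rewrite /ta /real_quartic /d2 /d1 /d0 /quartic.
  by rewrite !(rmorphD, rmorphM, rmorphXn, rmorphN)/=; ring.
have irr (p q : int) : q%:~R * ta = p%:~R -> q = 0.
  move=> qp; suff /nz'[] : quartic c4 0 d2 d1 d0 p q = 0 by [].
  apply/eqP; rewrite -(intr_eq0 R) -real_quarticE -qp; apply/eqP.
  transitivity (q%:~R ^+ 4 * real_quartic c4 0 d2 d1 d0 ta 1); last by rewrite hta mulr0.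
  by rewrite /real_quartic; ring.
have [d1E d2E d2_lt0] := depressed_square c4_gt0 h0' irr hta.
(* Now [4 c4] times the form is [(2 c4 u ^ 2 + d2 v ^ 2) ^ 2]; replacing [v] by [2 c4 v] puts it in
   the shape [c4 (u ^ 2 - D v ^ 2) ^ 2] with [D = - 2 c4 d2 > 0]. *)
apply: (@landau_form_linear _ _ _ _ _ (2 * c4) 0 0 1).
  by rewrite mulr1 mulr0 subr0 mulf_neq0// gt_eqF.
have sqE u v : quartic c4 0 d2 d1 d0 (1 * u + - 0 * v) (- 0 * u + 2 * c4 * v) =
    c4 * (u ^+ 2 - (- (2 * c4 * d2)) * v ^+ 2) ^+ 2.
  transitivity (c4 * u ^+ 4 + 4 * c4 ^+ 2 * d2 * u ^+ 2 * v ^+ 2 + 4 * c4 ^+ 3 * (4 * c4 * d0) * v ^+ 4).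
    by rewrite d1E /quartic; ring.
  by rewrite -d2E; ring.
apply: (landau_form_ext sqE); apply: landau_form_square => //.
  by rewrite oppr_gt0 pmulr_rlt0// mulr_gt0.
move=> p q pq; have : quartic c4 0 d2 d1 d0 (1 * p + - 0 * q) (- 0 * p + 2 * c4 * q) = 0.
  by rewrite sqE pq subrr expr0n mulr0.
move=> /nz'[_]; rewrite oppr0 mul0r add0r => /eqP.
by rewrite mulf_eq0 mulf_eq0/= gt_eqF//= => /eqP.
Qed.

Lemma landau_form_quartic c4 c3 c2 c1 c0 :
  (exists x y, quartic c4 c3 c2 c1 c0 x y <> 0) -> landau_form (quartic c4 c3 c2 c1 c0).
Proof.
move=> hn L k g Lk gc F0.
have h0 : forall x y, 0 <= quartic c4 c3 c2 c1 c0 x y.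
  have [b30 [b21 [b12 [b03 [b20 [b11 [b02 [b10 [b01 [b00 gE]]]]]]]]]] := gc.
  apply: (@leading_form_ge0 L k c4 c3 c2 c1 c0 b30 b21 b12 b03 b20 b11 b02 b10 b01 b00 Lk).
  by move=> x y Lxy; have := F0 x y Lxy; rewrite gE.
suff good : landau_form (quartic c4 c3 c2 c1 c0) by exact: (good L k g).
have [[r [s [rs hrs]]]|nz] :=
    pselect (exists r s, ~ (r = 0 /\ s = 0) /\ quartic c4 c3 c2 c1 c0 r s = 0).
  (* The substitution [(s x - r y, r x + s y)], of determinant [r ^ 2 + s ^ 2], carries the zero
     [(r, s)] to the axis [u = 0]. *)
  have dn : s * s - - r * r != 0.
    apply/eqP => h; apply: rs.
    have r2 := sqr_ge0 r; have s2 := sqr_ge0 s; rewrite !expr2 in r2 s2.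
    have rr : r * r = 0 by lra.
    have ss : s * s = 0 by lra.
    by split; apply/eqP; rewrite -sqrf_eq0 expr2 ?rr ?ss.
  apply: (landau_form_linear dn).
  pose e4 := quartic c4 c3 c2 c1 c0 s (- r).
  have [e3 [e2 [e1 eE]]] : exists e3 e2 e1, forall u v,
      quartic c4 c3 c2 c1 c0 (s * u + - - r * v) (- r * u + s * v) = quartic e4 e3 e2 e1 0 u v.
    exists (4 * c4 * s ^+ 3 * r + c3 * (s ^+ 4 - 3 * s ^+ 2 * r ^+ 2) +
        c2 * (2 * s * r ^+ 3 - 2 * s ^+ 3 * r) + c1 * (3 * s ^+ 2 * r ^+ 2 - r ^+ 4) - 4 * c0 * r ^+ 3 * s),
      (6 * c4 * s ^+ 2 * r ^+ 2 + c3 * (3 * s ^+ 3 * r - 3 * s * r ^+ 3) +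
       c2 * (s ^+ 4 - 4 * s ^+ 2 * r ^+ 2 + r ^+ 4) + c1 * (3 * s * r ^+ 3 - 3 * s ^+ 3 * r) +
       6 * c0 * s ^+ 2 * r ^+ 2),
      (4 * c4 * s * r ^+ 3 + c3 * (3 * s ^+ 2 * r ^+ 2 - r ^+ 4) +
       c2 * (2 * s ^+ 3 * r - 2 * s * r ^+ 3) + c1 * (s ^+ 4 - 3 * s ^+ 2 * r ^+ 2) - 4 * c0 * r * s ^+ 3).
    move=> u v; by rewrite -[X in quartic _ _ _ _ X u v]hrs /e4 /quartic; ring.
  apply: (landau_form_ext eE); apply: landau_form_vanishing_axis.
    by move=> x y; rewrite -eE.
  have [x [y hxy]] := hn; exists (s * x + - r * y), (r * x + s * y); rewrite -eE.
  have -> : quartic c4 c3 c2 c1 c0 (s * (s * x + - r * y) + - - r * (r * x + s * y))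
      (- r * (s * x + - r * y) + s * (r * x + s * y)) =
      (s * s - - r * r) ^+ 4 * quartic c4 c3 c2 c1 c0 x y by rewrite /quartic; ring.
  by apply/eqP; rewrite mulf_neq0 ?expf_neq0//; apply/eqP.
have nz' x y : quartic c4 c3 c2 c1 c0 x y = 0 -> x = 0 /\ y = 0.
  by move=> hxy; apply: contrapT => n0; apply: nz; exists x, y.
have [[t ht]|nr] := pselect (exists t : R, real_quartic c4 c3 c2 c1 c0 t 1 = 0).
  exact: landau_form_irrational_zero ht.
apply: landau_form_definite; last by move=> t; apply/eqP => ht; apply: nr; exists t.
by apply/eqP => c4E; have [] := nz' 1 0; rewrite // /quartic c4E; ring.
Qed.

End LeadingFormClassification.

(** * From rational to integer coefficients *)

Lemma common_denominator (s : seq rat) :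
  exists2 d : int, 0 < d & forall q, q \in s -> exists z : int, d%:~R * q = z%:~R.
Proof.
elim: s => [|q s [d d0 IH]]; first by exists 1.
exists (d * denq q) => [|r]; first by rewrite mulr_gt0// denq_gt0.
rewrite inE rmorphM/= => /orP[/eqP ->|/IH[z zE]]; last first.
  by exists (denq q * z); rewrite rmorphM/= -zE; ring.
by exists (d * numq q); rewrite rmorphM/= numqE; ring.
Qed.

Lemma is_cubic_monomial z i j : (i + j <= 3)%N ->
  is_cubic (fun x y => z * x ^+ i * y ^+ j).
Proof.
move=> ij; pose b i' j' : int := if (i == i') && (j == j') then z else 0.
exists (b 3%N 0%N), (b 2%N 1%N), (b 1%N 2%N), (b 0%N 3%N), (b 2%N 0%N), (b 1%N 1%N), (b 0%N 2%N),
  (b 1%N 0%N), (b 0%N 1%N), (b 0%N 0%N) => x y; rewrite /cubic /b {b}.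
by case: i ij => [|[|[|[|i]]]]; case: j => [|[|[|[|j]]]] //= _; ring.
Qed.

Lemma is_cubic_sum (T : eqType) (s : seq T) (z : T -> int) (u v : T -> nat) :
  (forall t, t \in s -> (u t + v t <= 3)%N) ->
  is_cubic (fun x y => \sum_(t <- s) z t * x ^+ u t * y ^+ v t).
Proof.
elim: s => [|t s IH] h.
  have [b30 [b21 [b12 [b03 [b20 [b11 [b02 [b10 [b01 [b00 bE]]]]]]]]]] := @is_cubic_monomial 0 0 0 isT.
  exists b30, b21, b12, b03, b20, b11, b02, b10, b01, b00 => x y.
  by rewrite -bE big_nil !mul0r.
have := is_cubicD (is_cubic_monomial (z t) (h t (mem_head t s))) (IH _).
case=> [r rs|b30 [b21 [b12 [b03 [b20 [b11 [b02 [b10 [b01 [b00 bE]]]]]]]]]].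
  by apply: h; rewrite inE rs orbT.
exists b30, b21, b12, b03, b20, b11, b02, b10, b01, b00 => x y.
by rewrite -bE big_cons.
Qed.

Lemma quartic_eq0 c4 c3 c2 c1 c0 : (forall x y, quartic c4 c3 c2 c1 c0 x y = 0) ->
  [/\ c4 = 0, c3 = 0, c2 = 0, c1 = 0 & c0 = 0].
Proof.
move=> h.
have z4 : c4 = 0.
  apply: (@peval_lead_eq0 1 0 [:: c0; c1; c2; c3]) => // t.
  by rewrite -[RHS](h (0 + 1 * t) 1) /quartic /=; ring.
have z3 : c3 = 0.
  apply: (@peval_lead_eq0 1 0 [:: c0; c1; c2]) => // t.
  by rewrite -[RHS](h (0 + 1 * t) 1) z4 /quartic /=; ring.
have z2 : c2 = 0.
  apply: (@peval_lead_eq0 1 0 [:: c0; c1]) => // t.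
  by rewrite -[RHS](h (0 + 1 * t) 1) z4 z3 /quartic /=; ring.
have z1 : c1 = 0.
  apply: (@peval_lead_eq0 1 0 [:: c0]) => // t.
  by rewrite -[RHS](h (0 + 1 * t) 1) z4 z3 z2 /quartic /=; ring.
have z0 : c0 = 0 by rewrite -(h 0 1) /quartic; ring.
by [].
Qed.

Section ClearDenominators.
Variable F : Qxy.

Let i0 : 'I_2 := ord0.
Let i1 : 'I_2 := lift ord0 ord0.

Lemma eval_xyE x y : eval_xy F x y =
  \sum_(m <- mpoly.msupp F) mpoly.mcoeff m F * (x%:~R ^+ m i0 * y%:~R ^+ m i1).
Proof.
rewrite /eval_xy mpoly.mevalE; apply: eq_bigr => m _; congr (_ * _).
by rewrite !big_ord_recl big_ord0 mulr1.
Qed.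

Lemma mdeg2E (m : mpoly.multinom 2) : mpoly.mdeg m = (m i0 + m i1)%N.
Proof. by rewrite mpoly.mdegE !big_ord_recl big_ord0 addn0. Qed.

Let M (i : nat) : mpoly.multinom 2 :=
  mpoly.Multinom [tuple i; (4 - i)%N].

Let M_inj : uniq (map M (iota 0 5)).
Proof.
rewrite map_inj_in_uniq ?iota_uniq// => i j _ _ /(congr1 (fun m : mpoly.multinom 2 => m i0)).
by rewrite !mpoly.multinomE.
Qed.

Let mem_M m : (m \in map M (iota 0 5)) = (mpoly.mdeg m == 4).
Proof.
apply/mapP/eqP => [[i ii ->]|].
  rewrite mdeg2E !mpoly.multinomE !(tnth_nth 0%N)/=.
  by move: ii; rewrite mem_iota/= => i5; rewrite subnKC.
rewrite mdeg2E => m4; exists (m i0); first by rewrite mem_iota; lia.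
apply/mpoly.mnmP => i; rewrite mpoly.multinomE (tnth_nth 0%N).
have [->|->] : i = i0 \/ i = i1.
  by case: i => [[|[|i]] ii] //; [left|right]; apply/val_inj.
- by [].
- by rewrite /=; lia.
Qed.

Lemma clear_denominators : has_degree F 4 -> exists d : int, exists c4 c3 c2 c1 c0 g,
  [/\ 0 < d, is_cubic g, exists x y, quartic c4 c3 c2 c1 c0 x y <> 0 &
    forall x y, d%:~R * eval_xy F x y = (quartic c4 c3 c2 c1 c0 x y + g x y)%:~R].
Proof.
move=> degF.
have [d d0 hd] := common_denominator (map (fun m => mpoly.mcoeff m F) (mpoly.msupp F)).
have /choice[z zE] : forall m, exists z : int, d%:~R * mpoly.mcoeff m F = z%:~R.
  move=> m; have [mF|mF] := boolP (m \in mpoly.msupp F).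
    by apply: hd; exact: map_f.
  by exists 0; rewrite mpoly.memN_msupp_eq0// mulr0.
have z0 m : m \notin mpoly.msupp F -> z m = 0.
  move=> mF; apply/eqP; rewrite -(intr_eq0 rat) -zE mpoly.memN_msupp_eq0//.
  by rewrite mulr0.
pose s3 := [seq m <- mpoly.msupp F | mpoly.mdeg m != 4].
exists d, (z (M 4)), (z (M 3)), (z (M 2)), (z (M 1)), (z (M 0)),
  (fun x y => \sum_(m <- s3) z m * x ^+ m i0 * y ^+ m i1); split => //.
- apply: is_cubic_sum => m; rewrite mem_filter -mdeg2E => /andP[m4 mF].
  by have := mpoly.msize_mdeg_lt mF; rewrite degF; lia.
(* A top form vanishing on [Z^2] has zero coefficients, which contradicts degree 4. *)
- apply: contrapT => /forallNP h.
  have [z4 z3 z2 z1 z00] : [/\ z (M 4) = 0, z (M 3) = 0, z (M 2) = 0, z (M 1) = 0 & z (M 0) = 0].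
    by apply: quartic_eq0 => x y; apply: contrapT => hxy; apply: (h x); exists y.
  have zM m : mpoly.mdeg m = 4%N -> z m = 0.
    move=> /eqP; rewrite -mem_M => /mapP[i + ->]; rewrite mem_iota/=.
    by case: i => [|[|[|[|[|i]]]]].
  have : (mpoly.msize F <= 4)%N.
    rewrite mpoly.msizeE; apply/bigmax_leqP_seq => m mF _.
    have := mpoly.msize_mdeg_lt mF; rewrite degF !ltnS leq_eqVlt => /orP[/eqP m4|//].
    have := zM m m4 => zm; have := zE m; rewrite zm => /eqP.
    by rewrite mulf_eq0 intr_eq0 gt_eqF//= mpoly.mcoeff_eq0 mF.
  by rewrite degF.
move=> x y; rewrite eval_xyE mulr_sumr.
transitivity ((\sum_(m <- mpoly.msupp F) z m * x ^+ m i0 * y ^+ m i1)%:~R : rat).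
  rewrite rmorph_sum; apply: eq_bigr => m _.
  by rewrite mulrA zE !rmorphM !rmorphXn/= mulrA.
congr (_%:~R); rewrite (bigID (fun m => mpoly.mdeg m == 4))/= -[X in _ + X]big_filter.
congr (_ + _).
transitivity (\sum_(m <- map M (iota 0 5)) z m * x ^+ m i0 * y ^+ m i1).
  rewrite [RHS](bigID (fun m => m \in mpoly.msupp F))/= [X in _ + X]big1 ?addr0; last first.
    by move=> m /z0 ->; rewrite !mul0r.
  rewrite -big_filter -[RHS]big_filter; apply: perm_big; apply: uniq_perm.
  - by rewrite filter_uniq// mpoly.msupp_uniq.
  - by rewrite filter_uniq.
  - by move=> m; rewrite !mem_filter mem_M andbC.
rewrite /= !big_cons big_nil /quartic !mpoly.multinomE !(tnth_nth 0%N)/=.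
ring.
Qed.

End ClearDenominators.

(** * From sets of integers back to [count_values] *)

Section CountValues.
Import finmap.

Lemma count_values_le (R : realType) (F : Qxy) (N b : R) :
  int_values F `<=` nonneg_integers ->
  atmost (values_upto F N : set rat) b -> (count_values F N)%:R <= b.
Proof.
move=> FN; apply; first exact: fset_uniq.
by move=> q; rewrite in_fset_set; [move/set_mem|exact: finite_values_upto].
Qed.

End CountValues.

Unset Implicit Arguments.

Theorem theorem1p6 (R : realType) (F : Qxy) :
  has_degree F 4 ->
  irreducible_elt F ->
  int_values F `<=` nonneg_integers ->
  exists2 c : R, 0 < c &
    \forall N \near +oo%R, (count_values F N)%:R <= c * (N / Num.sqrt (ln N)).
Proof.
move=> degF _ FN.
have [d [c4 [c3 [c2 [c1 [c0 [g [d0 gc hn dF]]]]]]]] := clear_denominators degF.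
pose L (x y : int) := True.
have Lk : periodic L 1 by split => //; exists 0, 0.
have F0 x y : L x y -> 0 <= quartic c4 c3 c2 c1 c0 x y + g x y.
  move=> _; rewrite -(ler0z rat) -dF mulr_ge0 ?ler0z ?(ltW d0)//.
  by have [|n _ <-] := FN (eval_xy F x y); first by exists (x, y).
pose V : set int := [set v | int_values F v%:~R].
have [C [N0 hV]] : landau_bounded R V.
  (* The coefficients of [F] need not be integers; the affine map [v |-> d v] leads to values of the
     integer polynomial. *)
  apply: (@landau_bounded_affine R d 0 V _ d0 _ (landau_form_quartic R hn Lk gc F0)).
  move=> v [[x y] _ /= vE]; exists x, y; split => //.
  by apply/eqP; rewrite addr0 -(eqr_int rat) -dF vE rmorphM.
exists (`|C| + 1); first by rewrite ltr_pwDr.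
exists (Num.max N0 3); split; first exact: num_real.
move=> N /=; rewrite gt_max => /andP[/ltW N0N N3].
have ratio0 : 0 <= N / Num.sqrt (ln N) by rewrite divr_ge0 ?sqrtr_ge0//; lra.
apply: le_trans (_ : C * (N / Num.sqrt (ln N)) <= _); last first.
  by rewrite ler_wpM2r// (le_trans (ler_norm C))// lerDl.
(* The values of [F] are rationals that happen to be integers; on them [numq] is injective and
   carries the bound for [V] over to [values_upto]. *)
have numqE q : values_upto F N q -> q = (numq q)%:~R.
  by move=> [/FN[n _ <-] _]; rewrite pmulrn numq_int.
apply: count_values_le => // s us sS; rewrite -(size_map numq); apply: hV => //.
  by rewrite map_inj_in_uniq// => p q /sS/numqE pE /sS/numqE qE pq; rewrite pE qE pq.
move=> _ /mapP[q /sS qS ->]; have [Fq /andP[q1 qN]] := qS.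
rewrite (numqE _ qS) ratr_int in q1 qN.
split; first by rewrite /V/= -numqE.
by split; [rewrite -(ler_int R)|].
Qed.
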